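(* Let $I=[0,1]$, let $(a_i)_{i\ge1}$ be a sequence of positive real numbers with $\sum_{i=1}^\infty a_i^2<\infty$, and equip the Hilbert cube $I^\omega$ with the metric $d_a(x,y)=\left(\sum_{i=1}^{\infty}a_i^2(x_i-y_i)^2\right)^{1/2}$. Then the standard product Lebesgue measure $\mu$ on $I^\omega$ is congruence-invariant with respect to $d_a$: $\mu(\sigma(B))=\mu(B)$ for every Borel set $B\subset I^\omega$ and every congruence $\sigma$ defined on $B$.
   Context: A congruence is a $d_a$-isometry (distance-preserving map) $\sigma:B\to\sigma(B)\subset I^\omega$ defined on a subset $B\subset I^\omega$; it need not extend to all of $I^\omega$. The standard product Lebesgue measure is the countable product of the Lebesgue measure on $[0,1]$. *)

(* Defs.v *)
From HB Require Import structures.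
From mathcomp Require Import all_boot all_order all_algebra.
From mathcomp Require Import all_classical all_reals all_analysis.

Set Implicit Arguments.
Unset Strict Implicit.
Unset Printing Implicit Defensive.

Import Order.TTheory GRing.Theory Num.Theory.
Import numFieldNormedType.Exports.

Local Open Scope classical_set_scope.
Local Open Scope ring_scope.

(* Real sequences with the Borel sigma-algebra of the product topology.  The
   Hilbert cube is a closed subset, so its Borel subsets are the measurable
   sets of [Romega R] contained in it.  On the cube the product topology is
   also the topology of the metric [dist_a a] below, for every positive
   square-summable [a]. *)
Definition Romega (R : realType) :=
  g_sigma_algebraType (@open {ptws nat -> R}).

Definition hilbert_cube (R : realType) : set (Romega R) :=
  [set x | forall i : nat, x i \in `[0, 1]].

(* Indices start at 0: [a i], [x i] are the terms numbered i + 1 in the usual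
   notation.  For [x], [y] in the cube and [a] square-summable the series
   converges; elsewhere the value carries no meaning. *)
Definition dist_a (R : realType) (a : nat -> R) (x y : Romega R) : R :=
  Num.sqrt (limn (series (fun i : nat => a i ^+ 2 * (x i - y i) ^+ 2))).

(* [mu] is the countable product of the Lebesgue measure on [0, 1], extended by
   0 outside the cube.  The measurable rectangles are stable under intersection
   and generate the sigma-algebra, so this determines [mu]; the case [n = 0]
   says that [mu] has total mass 1. *)
Definition is_product_lebesgue (R : realType)
    (mu : {measure set (Romega R) -> \bar R}) : Prop :=
  forall (n : nat) (A : nat -> set R), (forall i, measurable (A i)) ->
    mu [set x | forall i : nat, (i < n)%N -> A i (x i)] =
    (\prod_(i < n) lebesgue_measure (A i `&` `[0%R, 1%R]))%E.

(* Only the values of [sigma] on [B] matter: a map defined on [B] alone is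
   represented by any total extension of it. *)
Definition congruence (R : realType) (a : nat -> R) (B : set (Romega R))
    (sigma : Romega R -> Romega R) : Prop :=
  [/\ B `<=` @hilbert_cube R,
      sigma @` B `<=` @hilbert_cube R &
      forall x y, B x -> B y -> dist_a a (sigma x) (sigma y) = dist_a a x y].

(* Main.v *)
Require Import Defs.
From HB Require Import structures.
From mathcomp Require Import all_boot all_order all_algebra.
From mathcomp Require Import all_classical all_reals all_analysis.
From mathcomp Require Import measurable_realfun.
From mathcomp Require fingroup perm.
From mathcomp Require Import ring lra zify.

Set Implicit Arguments.
Unset Strict Implicit.
Unset Printing Implicit Defensive.

Import Order.TTheory GRing.Theory Num.Theory.
Import numFieldNormedType.Exports.

Local Open Scope classical_set_scope.
Local Open Scope ring_scope.

(** It suffices to show [mu (sigma B) >= mu B] for closed [B] and nonincreasing [a],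
and to apply this to the inverse congruence.  When [mu B > 0], for each [i] there are
two points of [B] that differ in the coordinate [i] only; the image of their difference,
divided by its length, is the column [u i] of a matrix [u] with orthonormal columns.
On points of [B] which agree outside finitely many coordinates, [sigma] acts as the
linear map with entries [r j i = u j i * a i / a j].

Restrict [B] to a dyadic cell which it almost fills, and intersect it with its
reflection through the centre of the cell: for most [t] in a cube, all coordinates
[\sum_i r j i * t i] of the image are at most 1 in absolute value.  Moments of orders
2, 4, 6 and 8 of such sums show that a row of [r] with squared norm close to 1 (or
larger) has one main entry; points where one [t i] is close to its maximum then bound
the total excess of the rows, weighted by the square of the main entry, uniformly in the
number of rows.

The weights [w j i = u j i ^+ 2] have column sums 1 and row sums at most 1.  Summing
[\sum_i w j i * ln (1 + a i ^+ 2 / t) - ln (1 + a j ^+ 2 / t)] over the rows, the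
previous bound makes the defect [\sum_(i < M) (1 - \sum_(j < M) w j i)] arbitrarily small
for suitable large [M].  The [M x M] corner of [u] has squared determinant at least
1 minus this defect, and the change of variables formula in the first [M] coordinates
gives [mu (sigma B) >= mu B] in the limit. *)

(** * Topology of sequences and measurable rectangles *)

(** Orthonormal columns alone do not suffice: the shift with [u i.+1 i = 1] has defect 1 for every
    [M] > 0. What forbids it is that the image stays in the cube. The shift stretches coordinate [i]
    by [a i / a i.+1]; each factor may be as close to 1 as one likes, but the logarithms add up to
    infinity because [a] tends to 0. So a bound on the excess of each single row is useless, and the
    total must be bounded uniformly in the number of rows. The potential [ln (1 + v i / t)], with
    [v i = a i ^+ 2], behaves like [ln (v i / t)] cut off near [v i = t]: its sum over all rows
    converges, while its first value tends to infinity as [t] tends to 0. A row spread over many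
    small entries acts like a Gaussian variable, which exceeds 1 with a probability bounded below;
    this excludes it. A row of squared norm below 499/500 needs no exclusion, since concavity of the
    logarithm leaves room there. *)

Section Topology.
Context {R : realType}.
Local Notation T := {ptws nat -> R}.

(** Used with [e = n.+1%:R^-1], so that a single index runs through a countable neighbourhood basis
    of the product topology. *)
Definition near_upto (n : nat) (e : R) (x y : nat -> R) :=
  forall i, (i < n)%N -> `|x i - y i| < e.

Lemma ptws_coord_continuous i : continuous (fun x : T => x i).
Proof. exact: (@proj_continuous nat (fun=> R) i). Qed.

Lemma cvg_ptws (u : nat -> T) (x : T) :
  (forall i, (fun n => u n i) @ \oo --> x i) -> u @ \oo --> x.
Proof. by move=> h; apply/pointwise_cvgP. Qed.

(** Otherwise points outside [O], the [n]-th one close to [x] in the first [n] coordinates, would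
    converge to [x] coordinatewise and hence in the topology. *)
Lemma open_near_upto (O : set T) (x : T) : open O -> O x ->
  exists n, forall y, near_upto n n.+1%:R^-1 x y -> O y.
Proof.
move=> oO Ox; apply: contrapT => h.
have /choice[u uP] : forall n, exists y : T,
    near_upto n n.+1%:R^-1 x y /\ ~ O y.
  move=> n; apply: contrapT => k; apply: h; exists n => y xy.
  by apply: contrapT => Oy; apply: k; exists y.
have : u @ \oo --> x.
  apply: cvg_ptws => i; apply/cvgrPdist_lt => e e0.
  near=> n; apply: (@lt_trans _ _ n.+1%:R^-1).
    by apply: (uP n).1; near: n; exact: nbhs_infty_gt.
  by near: n; exact: near_infty_natSinv_lt (PosNum e0).
move/(_ O); rewrite /= => /(_ (open_nbhs_nbhs (conj oO Ox))) [N _ /(_ N (leqnn _))].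
exact: (uP N).2.
Unshelve. all: by end_near. Qed.

Lemma near_upto_open (A : set T) n (e : R) :
  open [set x : T | exists2 y, A y & near_upto n e x y].
Proof.
rewrite openE => x [y Ay xy]; rewrite /interior.
have : nbhs x [set z : T | forall i : 'I_n, `|z i - y i| < e].
  have /(_ _)/= := @filter_forall T _ (fun (i : 'I_n) (z : T) => `|z i - y i| < e) (nbhs (x : T)) _.
  apply => i.
  apply: (@ptws_coord_continuous i _ [set s | `|s - y i| < e]).
  exists (e - `|x i - y i|) => /=; first by rewrite subr_gt0 xy.
  move=> z /= xz; rewrite -(subrK (x i) z) -addrA.
  by rewrite (le_lt_trans (ler_normD _ _))// -ltrBrDr distrC.
by apply: filterS => z h; exists y => // i ni; exact: (h (Ordinal ni)).
Qed.

Lemma hausdorff_ptws : hausdorff_space T.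
Proof. by apply: hausdorff_product => _; exact: norm_hausdorff. Qed.

Lemma cube_compact : compact ([set x : T | forall i, x i \in `[0, 1]] : set T).
Proof.
have := @tychonoff nat (fun=> R) (fun=> `[0, 1]%classic) (fun=> @segment_compact R 0 1).
by congr compact; apply/seteqP; split => x /= h i; have := h i.
Qed.

Lemma closed_bigcap_near_upto (A : set T) : closed A ->
  A = \bigcap_n [set x : T | exists2 y, A y & near_upto n n.+1%:R^-1 x y].
Proof.
move=> cA; apply/seteqP; split => [x Ax n _|x h].
  by exists x => // i _; rewrite subrr normr0 invr_gt0.
apply: contrapT => nAx.
have [|n nP] := @open_near_upto (~` A) x _ nAx; first by rewrite openC.
by have [y Ay xy] := h n I; exact: (nP y xy).
Qed.

End Topology.

(** * Rectangles generate the Borel sets and determine finite measures *)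

Section BorelRectangles.
Context {R : realType}.
Local Notation T := {ptws nat -> R}.
Local Notation W := (Romega R).

Lemma open_measurable (O : set T) : open O -> measurable (O : set W).
Proof. exact: sub_sigma_algebra. Qed.

Lemma closed_measurable (C : set T) : closed C -> measurable (C : set W).
Proof.
move=> cC; rewrite -(setCK C); apply: measurableC.
by apply: open_measurable; rewrite openC.
Qed.

Lemma measurable_coord i : measurable_fun setT (fun x : W => x i).
Proof.
apply: (measurability _ (RGenOInfty.measurableE R)).
move=> _ [_ [a ->] <-]; rewrite setTI; apply: open_measurable.
apply: (@open_comp T R (fun x => x i)); last exact: interval_open.
by move=> x _; exact: (@ptws_coord_continuous R i x).
Qed.

Definition rectangle (n : nat) (A : nat -> set R) : set W :=
  [set x | forall i, (i < n)%N -> A i (x i)].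

Definition rectangles : set (set W) :=
  [set X | exists n, exists2 A, (forall i, measurable (A i)) & X = rectangle n A].

Lemma rectangle_measurable n A : (forall i, measurable (A i)) ->
  measurable (rectangle n A).
Proof.
move=> mA; have -> : rectangle n A = \bigcap_(i in `I_n) ((fun x : W => x i) @^-1` A i).
  by apply/seteqP; split.
apply: bigcap_measurableType => i _; rewrite -[X in measurable X]setTI.
exact: measurable_coord.
Qed.

(** Lists of pairs of rationals make this family countable, so every open set is a countable union
    of rectangles. *)
Definition ratbox (l : seq (rat * rat)) : set W :=
  rectangle (size l) (fun i => `]ratr (nth (0, 0) l i).1, ratr (nth (0, 0) l i).2[%classic).

Lemma open_bigcup_ratbox (O : set T) : open O ->
  O = \bigcup_(l in [set l | ratbox l `<=` O]) ratbox l.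
Proof.
move=> oO; apply/seteqP; split => [x Ox|x [l lO]]; last exact: lO.
have [n] := open_near_upto oO Ox.
have : 0 < n.+1%:R^-1 :> R by rewrite invr_gt0.
move: (n.+1%:R^-1) => e e0 nP.
have /choice[q qP] : forall i, exists q : rat * rat,
    x i - e / 2 < ratr q.1 < x i /\ x i < ratr q.2 < x i + e / 2.
  move=> i.
  have [p pP] : exists p, ratr p \in `]x i - e / 2, x i[.
    by apply: rat_in_itvoo; lra.
  have [r rP] : exists r, ratr r \in `]x i, x i + e / 2[.
    by apply: rat_in_itvoo; lra.
  by exists (p, r); rewrite !in_itv/= in pP rP.
exists (mkseq q n) => [y yP|i]; last first.
  rewrite size_mkseq => ni; rewrite nth_mkseq//= in_itv/=.
  by have [/andP[_ ->] /andP[-> _]] := qP i.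
apply: nP => i ni; have := yP i; rewrite size_mkseq => /(_ ni).
rewrite nth_mkseq//= in_itv/= => /andP[y1 y2].
have [/andP[q1 q2] /andP[q3 q4]] := qP i.
rewrite ltr_norml; apply/andP; split; lra.
Qed.

Lemma measurable_rectangles : @measurable _ W = <<s rectangles >>.
Proof.
apply/seteqP; split; last first.
  apply: smallest_sub; first exact: sigma_algebra_measurable.
  by move=> _ [n [A mA ->]]; exact: rectangle_measurable.
apply: smallest_sub; first exact: smallest_sigma_algebra.
move=> O /open_bigcup_ratbox ->.
rewrite bigcup_mkcond; apply: (@countable_bigcupT_measurable _
  (g_sigma_algebraType rectangles)) => // l.
case: ifP => _; last exact: measurable0.
apply: sub_sigma_algebra; exists (size l); eexists; last by [].
by move=> i; exact: measurable_itv.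
Qed.

Lemma setI_closed_rectangles : setI_closed rectangles.
Proof.
move=> _ _ [n [A mA ->]] [m [B mB ->]].
exists (maxn n m).
exists (fun i => (if (i < n)%N then A i else setT) `&` (if (i < m)%N then B i else setT)).
  by move=> i; apply: measurableI; case: ifP.
apply/seteqP; split => x /=.
  by move=> [h1 h2] i _; split; case: ifP => // ?; [exact: h1|exact: h2].
move=> h; split => i ni; have := h i; rewrite leq_max ni ?orbT => -[]//.
Qed.

Lemma measure_unique_rectangles (m1 m2 : {measure set W -> \bar R}) :
  (m1 setT < +oo)%E ->
  (forall n A, (forall i, measurable (A i)) ->
    m1 (rectangle n A) = m2 (rectangle n A)) ->
  forall X, measurable X -> m1 X = m2 X.
Proof.
move=> m1T m12; apply: (measure_unique rectangles (fun=> setT)).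
- exact: measurable_rectangles.
- exact: setI_closed_rectangles.
- by move=> _; exists 0%N, (fun=> setT) => //; apply/seteqP; split.
- by apply/seteqP; split => // x _; exists 0%N.
- by move=> _ [n [A mA ->]]; exact: m12.
- by [].
Qed.

End BorelRectangles.

(** * Resampling one coordinate *)

Section Resampling.
Context {R : realType}.
Local Notation W := (Romega R).
Local Notation lam := (@lebesgue_measure R).

Definition upd (x : W) (i : nat) (s : R) : W := fun k => if k == i then s else x k.

Definition updp (i : nat) (p : W * measurableTypeR R) : W := upd p.1 i p.2.

Lemma measurable_updp i : measurable_fun setT (updp i).
Proof.
apply: (measurability _ (@measurable_rectangles R)).
move=> _ [_ [n [A mA ->]] <-]; rewrite setTI.
rewrite (_ : _ @^-1` _ = rectangle n (fun k => if k == i then setT else A k) `*`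
    (if (i < n)%N then A i else setT)).
  apply: measurableX; last by case: ifP => _; [exact: mA|exact: measurableT].
  by apply: rectangle_measurable => k; case: ifP.
apply/seteqP; split => -[x s] /=; rewrite /updp /upd/=.
  move=> h; split => [k kn|].
    by have := h k kn; case: ifP.
  by case: ifP => // /h; rewrite eqxx.
move=> [h1 h2] k kn; have := h1 k kn; case: (eqVneq k i) => // ki _.
by move: h2; rewrite -ki kn.
Qed.

HB.instance Definition _ i := isMeasurableFun.Build _ _ _ _ (updp i) (measurable_updp i).

Lemma ge0_integral_mrestr d (T : measurableType d) (m : {measure set T -> \bar R})
    (D : set T) (mD : measurable D) (f : T -> \bar R) :
  measurable_fun setT f -> (forall x, 0 <= f x)%E ->
  (\int[mrestr m mD]_x f x = \int[m]_(x in D) f x)%E.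
Proof.
move=> mf f0; have mC := measurableC mD.
rewrite -[X in (\int[_]_(_ in X) _)%E = _](setUv D) ge0_integral_setU//; last 2 first.
- exact: measurable_funTS.
- by rewrite disj_set2E setICr.
rewrite [X in (_ + X)%E](_ : _ = 0%E) ?adde0.
  by apply: eq_measure_integral => A mA AD; rewrite /= /mrestr setIidl.
apply: null_set_integral => //; first exact: measurable_funS mf.
by rewrite /= /mrestr setICl measure0.
Qed.

Variable P : probability W R.
Hypothesis P_prod : is_product_lebesgue P.

Lemma probability_rectangle n (A : nat -> set R) : (forall i, measurable (A i)) ->
  P (rectangle n A) = (\prod_(i < n) lam (A i `&` `[0%R, 1%R]))%E.
Proof. exact: P_prod. Qed.

Lemma lebesgue_unit_itv : lam (setT `&` `[0%R, 1%R]) = 1%E.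
Proof. by rewrite setTI lebesgue_measure_itv/= lte_fin ltr01 oppr0 adde0. Qed.

Definition strip : set (W * measurableTypeR R) := setT `*` `[0, 1]%classic.

Lemma measurable_strip : measurable strip.
Proof. by apply: measurableX. Qed.

Local Notation resampled i := (pushforward (mrestr (P \x lam)%E measurable_strip) (updp i)).

(** Replacing coordinate [i] by an independent uniform value of [0, 1] preserves the law, as one
    sees on rectangles. This gives Fubini's theorem for one factor without splitting the infinite
    product. *)
Let resampledE i X : measurable X -> resampled i X = P X.
Proof.
move=> mX; apply: measure_unique_rectangles mX => [|n A mA].
- rewrite /= /pushforward preimage_setT /mrestr setTI product_measure1E//.
  rewrite [X in (X * _)%E](_ : _ = 1%E); last exact: (probability_setT P).
  by rewrite mul1e /= lebesgue_measure_itv/= lte_fin ltr01 oppr0 adde0 ltry.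
rewrite /= /pushforward /mrestr.
rewrite (_ : _ `&` _ = rectangle n (fun k => if k == i then setT else A k) `*`
    ((if (i < n)%N then A i else setT) `&` `[0, 1]%classic)); last first.
  apply/seteqP; split => -[x s] /=; rewrite /updp /upd/=.
    move=> [h [_ s01]]; split => [k kn|]; first by have := h k kn; case: ifP.
    by split => //; case: ifP => // /h; rewrite eqxx.
  move=> [h1 [h2 s01]]; split => // k kn; have := h1 k kn.
  by case: (eqVneq k i) => // ki _; move: h2; rewrite -ki kn.
rewrite product_measure1E; last 2 first.
- by apply: rectangle_measurable => k; case: ifP.
- by apply: measurableI; [case: ifP => _; [exact: mA|exact: measurableT]|exact: measurable_itv].
rewrite probability_rectangle//= [X in (X * _)%E](_ : _ =
    (\prod_(k < n) lam ((if (k : nat) == i then setT else A k) `&` `[0%R, 1%R]))%E);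
  last by apply: (@probability_rectangle n (fun k => if k == i then setT else A k)) => k; case: ifP.
have [ni|ni] := ltnP i n; last first.
  rewrite lebesgue_unit_itv mule1; apply: eq_bigr => k _.
  by case: eqP => // ki; move: ni; rewrite -ki leqNgt ltn_ord.
rewrite (bigD1 (Ordinal ni))//= eqxx lebesgue_unit_itv mul1e.
rewrite [RHS](bigD1 (Ordinal ni))//= muleC; congr (_ * _)%E.
by apply: eq_bigr => k; rewrite -val_eqE /= => /negbTE ->.
Qed.

Lemma integral_resample i (f : W -> \bar R) : measurable_fun setT f ->
  (forall x, 0 <= f x)%E ->
  (\int[P]_x f x = \int[P]_x \int[lam]_(s in `[0%R, 1%R]) f (upd x i s))%E.
Proof.
move=> mf f0.
pose m : {measure set (W * measurableTypeR R)%type -> \bar R} := mrestr (P \x lam)%E measurable_strip.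
have := @ge0_integral_pushforward _ _ _ _ _ _ (measurable_updp i) m _ _ measurableT mf (fun x _ => f0 x).
rewrite preimage_setT => E; apply: (eq_trans (eq_trans _ E)) => {E}.
  by apply: eq_measure_integral => A mA _; exact/esym/resampledE.
rewrite ge0_integral_mrestr//=; last first.
  exact: (measurableT_comp mf (measurable_updp i)).
rewrite integral_mkcond fubini_tonelli1//=; last 2 first.
- apply/(measurable_restrict _ measurable_strip) => //; apply: measurable_funTS.
  exact: (measurableT_comp mf (measurable_updp i)).
- by move=> z; rewrite patchE; case: ifP => // _; exact: f0.
apply: eq_integral => x _; rewrite /fubini_F [RHS]integral_mkcond.
apply: eq_integral => s _; rewrite !patchE /updp/=; congr (if _ then _ else _).
by apply/idP/idP; rewrite !inE /strip /=; tauto.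
Qed.

End Resampling.

(** * Boxes and integration along one of their sides *)

Section Boxes.
Context {R : realType}.
Local Notation W := (Romega R).
Local Notation lam := (@lebesgue_measure R).

Lemma integral_affine_pow (p : nat) (z b c f : R) : 0 < f -> b != 0 ->
  (\int[lam]_(s in `[(c - f)%R, (c + f)%R]) ((z + b * (s - c)) ^+ p)%:E =
   (((z + b * f) ^+ p.+1 - (z - b * f) ^+ p.+1) / (b * p.+1%:R))%:E)%E.
Proof.
move=> f0 b0.
pose g : R^o -> R^o := cst z + b *: (id - cst c).
pose F : R^o -> R^o := (b * p.+1%:R)^-1 *: g ^+ p.+1.
have gE s : g s = z + b * (s - c) by [].
have FE s : F s = (b * p.+1%:R)^-1 * g s ^+ p.+1.
  by rewrite /F exprfctE.
have dg (x : R) : is_derive x (1 : R) g b.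
  have := is_deriveD (is_derive_cst z x 1)
    (is_deriveZ b (is_deriveB (is_derive_id x 1) (is_derive_cst c x 1))).
  by rewrite add0r subr0 /GRing.scale/= mulr1.
have dF (x : R) : is_derive x (1 : R) F ((z + b * (x - c)) ^+ p).
  have := is_deriveZ (b * p.+1%:R)^-1 (@is_deriveX _ _ g p.+1 x 1 b (dg x)).
  rewrite /GRing.scale/= gE => /is_derive_eq; apply.
  by field; rewrite b0 addrC natr1 pnatr_eq0.
have dG (x : R) : derivable F x 1 by [].
have cF : continuous F by move=> x; apply/differentiable_continuous/derivable1_diffP.
rewrite (@continuous_FTC2 _ (fun s => (z + b * (s - c)) ^+ p) F).
- rewrite -EFinB; congr EFin; rewrite !FE !gE.
  have -> : c + f - c = f by ring.
  have -> : c - f - c = - f by ring.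
  by rewrite mulrN -mulrBr mulrC.
- by lra.
- apply: continuous_subspaceT => x.
  apply: (@continuous_comp _ _ _ g (fun y : R => y ^+ p)); last exact: exprn_continuous.
  by apply/differentiable_continuous/derivable1_diffP.
- split; first by move=> x _.
  + exact/cvg_at_right_filter/cF.
  + exact/cvg_at_left_filter/cF.
- by move=> x _; rewrite derive1E; apply: derive_val.
Qed.

(** [c] holds centres and [f] half-widths, because the moments and the reflection are both taken
    about the centre. *)
Definition box_itv (c f : nat -> R) (i : nat) : set R := `[c i - f i, c i + f i]%classic.

Definition box (N : nat) (c f : nat -> R) : set W := rectangle N (box_itv c f).

Definition subunit (c f : nat -> R) :=
  forall i, [/\ 0 < f i, 0 <= c i - f i & c i + f i <= 1].

Lemma measurable_box_itv c f i : measurable (box_itv c f i).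
Proof. exact: measurable_itv. Qed.

Lemma measurable_box N c f : measurable (box N c f).
Proof. by apply: rectangle_measurable => i; exact: measurable_box_itv. Qed.

Lemma updE (x : W) i s k : upd x i s k = if k == i then s else x k.
Proof. by []. Qed.

Lemma upd_upd (x : W) i s s' : upd (upd x i s) i s' = upd x i s'.
Proof. by apply/funext => k; rewrite !updE; case: eqP. Qed.

Lemma measurable_upd_r i (x : W) :
  measurable_fun setT (fun s : measurableTypeR R => upd x i s).
Proof.
exact: (measurableT_comp (measurable_updp i)
  (measurable_fun_pair (measurable_cst x) (@measurable_id _ (measurableTypeR R) setT))).
Qed.

Lemma measurable_integral_upd i (J : set R) (g : W -> \bar R) : measurable J ->
  measurable_fun setT g -> (forall x, 0 <= g x)%E ->
  measurable_fun setT (fun x => \int[lam]_(s in J) g (upd x i s))%E.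
Proof.
move=> mJ mg g0.
have mS : measurable (setT `*` J : set (W * measurableTypeR R)) by exact: measurableX.
have h : measurable_fun setT ((g \o updp i) \_ (setT `*` J)).
  apply/(measurable_restrict _ mS) => //; apply: measurable_funTS.
  exact: (measurableT_comp mg (measurable_updp i)).
have h0 z : (0 <= ((g \o updp i) \_ (setT `*` J)) z)%E.
  by apply: erestrict_ge0 => ? _; exact: g0.
have := measurable_fun_fubini_tonelli_F (m2 := lam) _ h h0.
congr measurable_fun; apply/funext => x; rewrite /fubini_F [RHS]integral_mkcond.
apply: eq_integral => s _; rewrite !patchE /updp/=; congr (if _ then _ else _).
by apply/idP/idP; rewrite !inE /=; tauto.
Qed.

Lemma integral_upd_ge0 i (J : set R) (g : W -> \bar R) x : (forall x, 0 <= g x)%E ->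
  (0 <= \int[lam]_(s in J) g (upd x i s))%E.
Proof. by move=> g0; apply: integral_ge0. Qed.

Variable P : probability W R.
Hypothesis P_prod : is_product_lebesgue P.

Lemma box_updE N c f i x s : (i < N)%N ->
  box N c f (upd x i s) <->
  rectangle N (fun k => if k == i then setT else box_itv c f k) x /\ box_itv c f i s.
Proof.
move=> iN; split=> [h|[h js] k kN]; last first.
  by rewrite updE; have := h k kN; case: eqP => // ->.
split=> [k kN|]; first by have := h k kN; rewrite updE; case: eqP.
by have := h i iN; rewrite updE eqxx.
Qed.

Lemma box_itv_sub c f i : subunit c f -> box_itv c f i `<=` `[0, 1]%classic.
Proof.
move=> /(_ i)[f0 c0 c1] s; rewrite /box_itv /= !in_itv/= => /andP[h1 h2].
by apply/andP; split; [exact: le_trans h1|exact: le_trans c1].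
Qed.

Lemma box_itv_measure c f i : subunit c f -> lam (box_itv c f i) = (2 * f i)%:E.
Proof.
move=> /(_ i)[f0 _ _]; rewrite /box_itv lebesgue_measure_itv/= lte_fin ifT; last by lra.
by rewrite -EFinB; congr EFin; ring.
Qed.

Lemma box_measure N c f : subunit c f -> P (box N c f) = (\prod_(i < N) (2 * f i))%:E.
Proof.
move=> cf; rewrite /box probability_rectangle//; last by move=> i; exact: measurable_box_itv.
rewrite (eq_bigr (fun i : 'I_N => (2 * f i)%:E)) => [|i _].
  by rewrite prodEFin.
by rewrite setIidl ?box_itv_measure//; exact: box_itv_sub.
Qed.

Lemma integral_box_resample N c f i (g : W -> \bar R) : subunit c f -> (i < N)%N ->
  measurable_fun setT g -> (forall x, 0 <= g x)%E ->
  ((2 * f i)%:E * \int[P]_(x in box N c f) g x =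
   \int[P]_(x in box N c f) \int[lam]_(s in box_itv c f i) g (upd x i s))%E.
Proof.
move=> cf iN mg g0; have mb := measurable_box N c f.
pose J := box_itv c f i; have mJ : measurable J by exact: measurable_box_itv.
(* The box without its constraint on coordinate [i]: membership of [upd x i s] in the box splits
   into [Q'] for [x] and the side for [s]. *)
pose Q' : set W := rectangle N (fun k => if k == i then setT else box_itv c f k).
have mQ' : measurable Q'.
  apply: rectangle_measurable => k; case: ifP => _ //; exact: measurable_box_itv.
pose H (x : W) := (\int[lam]_(s in J) g (upd x i s))%E.
have mH : measurable_fun setT H by exact: measurable_integral_upd.
have H0 x : (0 <= H x)%E by exact: integral_upd_ge0.
have Hu x s : H (upd x i s) = H x by apply: eq_integral => r _; rewrite upd_upd.
have key (G : W -> \bar R) : measurable_fun setT G -> (forall x, 0 <= G x)%E ->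
    (\int[P]_(x in box N c f) G x =
     \int[P]_(x in Q') \int[lam]_(s in J) G (upd x i s))%E.
  move=> mG G0; rewrite integral_mkcond (integral_resample P_prod i); last 2 first.
  - by apply/(measurable_restrict _ mb) => //; exact: measurable_funTS.
  - by apply: erestrict_ge0.
  rewrite [RHS]integral_mkcond; apply: eq_integral => x _.
  rewrite patchE integral_mkcond; case: ifPn => xQ.
    rewrite [RHS]integral_mkcond; apply: eq_integral => s _; rewrite !patchE.
    case: ifPn => [_|/negP s01]; last first.
      case: ifPn => // /set_mem sJ; exfalso; apply: s01.
      by apply/mem_set; exact: box_itv_sub sJ.
    congr (if _ then _ else _).
    by apply/idP/idP => /set_mem h; apply/mem_set; [have [] := (box_updE c f x s iN).1 h|
       apply/(box_updE c f x s iN); split => //; exact: set_mem].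
  apply: integral0_eq => s _; rewrite !patchE; case: ifP => // _; case: ifPn => // /set_mem.
  by move=> /(box_updE c f x s iN)[/mem_set]; rewrite (negbTE xQ).
(* [H] does not depend on coordinate [i], so its inner integral over the side is [H] times the
   length [2 * f i]. *)
rewrite (key g)// (key H)// -ge0_integralZl_EFin//; last 2 first.
- exact: measurable_funTS mH.
- by have [/ltW ? _ _] := cf i; apply: mulr_ge0.
apply: eq_integral => x _; rewrite (_ : (fun s => H (upd x i s)) = cst (H x)); last by apply/funext => s; rewrite Hu.
rewrite integral_cst// muleC; congr (H x * _)%E; exact/esym/box_itv_measure.
by move=> x _; exact: H0.
Qed.

End Boxes.

(** * Moments of linear forms *)

Section Moments.
Context {R : realType}.
Local Notation W := (Romega R).
Local Notation lam := (@lebesgue_measure R).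

(** [q z y] is the mean of [(z + y * s) ^+ p] for [s] uniform in [-1, 1]. It is given as a
    polynomial, through an identity without division, so that it also covers [b = 0]. *)
Lemma integral_box_itv_pow (p : nat) (q : R -> R -> R) (c f : nat -> R) (b z : R) i :
  0 < f i -> (0 < p)%N ->
  (forall z y, (z + y) ^+ p.+1 - (z - y) ^+ p.+1 = 2 * p.+1%:R * (y * q z y)) ->
  q z 0 = z ^+ p ->
  (\int[lam]_(s in box_itv c f i) ((z + b * (s - c i)) ^+ p)%:E =
   (2 * f i)%:E * (q z (b * f i))%:E)%E.
Proof.
move=> f0 p0 pq q0; have [->|b0] := eqVneq b 0.
  under eq_integral do rewrite mul0r addr0.
  rewrite (@integral_cst _ _ _ lam _ _ (z ^+ p)%:E); last exact: measurable_itv.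
  rewrite mul0r q0 /= /box_itv lebesgue_measure_itv/= lte_fin ifT; last by lra.
  by rewrite -EFinB -!EFinM; congr EFin; ring.
rewrite integral_affine_pow// -EFinM pq; congr EFin.
by field; rewrite b0 addrC natr1 pnatr_eq0.
Qed.

Definition lform (L : nat) (b c : nat -> R) (x : W) : R :=
  \sum_(i < L) b i * (x i - c i).

Lemma lformS L b c x s :
  lform L.+1 b c (upd x L s) = lform L b c x + b L * (s - c L).
Proof.
rewrite /lform big_ord_recr/= updE eqxx; congr (_ + _).
by apply: eq_bigr => i _; rewrite updE ltn_eqF// ltn_ord.
Qed.

Lemma measurable_lform L b c : measurable_fun setT (lform L b c).
Proof.
apply: measurable_sum => i.
apply: measurable_funM; first exact: measurable_cst.
by apply: measurable_funB; [exact: measurable_coord|exact: measurable_cst].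
Qed.

Lemma measurable_lform_pow L b c p :
  measurable_fun setT (fun x => ((lform L b c x) ^+ p)%:E).
Proof.
by apply/measurable_EFinP; apply: measurable_funX; exact: measurable_lform.
Qed.

Lemma mule_pinj (k : R) (x y : \bar R) : 0 < k -> (k%:E * x = k%:E * y -> x = y)%E.
Proof.
move=> k0 h; rewrite -[x]mul1e -[y]mul1e -(@mulVf _ k) ?gt_eqF//.
by rewrite EFinM -!muleA h.
Qed.

Variable P : probability W R.
Hypothesis P_prod : is_product_lebesgue P.
Variables (N : nat) (c f b : nat -> R).
Hypothesis cf : subunit c f.

Definition moment p L : \bar R := (\int[P]_(x in box N c f) ((lform L b c x) ^+ p)%:E)%E.


Lemma moment_step p (q : R -> R -> R) L : (L < N)%N -> ~~ odd p -> (0 < p)%N ->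
  (forall z y, 0 <= q z y) -> (forall z, q z 0 = z ^+ p) ->
  (forall z y, (z + y) ^+ p.+1 - (z - y) ^+ p.+1 = 2 * p.+1%:R * (y * q z y)) ->
  measurable_fun setT (fun x => (q (lform L b c x) (b L * f L))%:E) ->
  (moment p L.+1 = \int[P]_(x in box N c f) (q (lform L b c x) (b L * f L))%:E)%E.
Proof.
move=> LN op p0 qge0 q0 pq mq; have [f0 _ _] := cf L.
apply: (@mule_pinj (2 * f L)); first by rewrite mulr_gt0.
rewrite /moment integral_box_resample//; last 2 first.
- exact: measurable_lform_pow.
- by move=> x; rewrite lee_fin exprn_even_ge0.
rewrite -ge0_integralZl_EFin//; last 4 first.
- exact: measurable_box.
- by move=> x _; rewrite lee_fin.
- exact: measurable_funTS mq.
- by rewrite mulr_ge0// ltW.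
apply: eq_integral => x _; under eq_integral do rewrite lformS.
exact: integral_box_itv_pow.
Qed.



Lemma integral_even_comb n (co : nat -> R) L : (forall k, 0 <= co k) ->
  (\int[P]_(x in box N c f) (\sum_(k < n) co k * lform L b c x ^+ k.*2)%:E =
   \sum_(k < n) (co k)%:E * moment k.*2 L)%E.
Proof.
move=> co0.
under eq_integral do rewrite -sumEFin.
have t0 k x : (0 <= (co k * lform L b c x ^+ k.*2)%:E)%E.
  by rewrite lee_fin mulr_ge0// exprn_even_ge0// odd_double.
rewrite ge0_integral_sum//; last 2 first.
- exact: measurable_box.
- move=> k; apply: measurable_funTS; apply/measurable_EFinP.
  by apply: measurable_funM; [exact: measurable_cst|apply/measurable_EFinP; exact: measurable_lform_pow].
apply: eq_bigr => k _; under eq_integral do rewrite EFinM.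
rewrite ge0_integralZl_EFin//.
- exact: measurable_box.
- by move=> x _; rewrite lee_fin exprn_even_ge0// odd_double.
- by apply: measurable_funTS; exact: measurable_lform_pow.
Qed.


(** Coordinate [L] is independent of the earlier ones and symmetric about its centre, so averaging
    over it leaves only even powers of the partial form; [co k y] is the coefficient of [z ^+ k.*2]
    in that average. *)
Lemma moment_rec n (co : nat -> R -> R) (m : nat -> R) pb L : (L < N)%N ->
  (forall k y, 0 <= co k y) -> (forall k, co k 0 = (k == n.+1)%:R) ->
  (forall z y, (z + y) ^+ n.+1.*2.+1 - (z - y) ^+ n.+1.*2.+1 =
     2 * n.+1.*2.+1%:R * (y * \sum_(k < n.+2) co k y * z ^+ k.*2)) ->
  (forall k, (k < n.+2)%N -> moment k.*2 L = (m k * pb)%:E)%E ->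
  moment n.+1.*2 L.+1 = ((\sum_(k < n.+2) co k (b L * f L) * m k) * pb)%:E.
Proof.
move=> LN co0 co1 pq mk.
rewrite (@moment_step _ (fun z y => \sum_(k < n.+2) co k y * z ^+ k.*2))//.
- rewrite (@integral_even_comb n.+2 (fun k => co k (b L * f L)))//.
  rewrite mulr_suml -sumEFin; apply: eq_bigr => k _.
  by rewrite mk// -EFinM mulrA.
- by rewrite odd_double.
- by move=> z y; apply: sumr_ge0 => k _; rewrite mulr_ge0// exprn_even_ge0// odd_double.
- move=> z; rewrite (bigD1 ord_max)//= co1 eqxx mul1r big1 ?addr0// => k.
  by rewrite co1 -val_eqE/= => /negbTE ->; rewrite mul0r.
- apply/measurable_EFinP; apply: measurable_sum => k.
  apply: measurable_funM; first exact: measurable_cst.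
  by apply/measurable_EFinP; exact: measurable_lform_pow.
Qed.

Definition seminorm2 L := \sum_(i < L) (b i * f i) ^+ 2.
Definition seminorm4 L := \sum_(i < L) (b i * f i) ^+ 4.

(** The form has variance [A / 3], and [A ^+ 2 / 3], [5 / 9 * A ^+ 3], [35 / 27 * A ^+ 4] are the
    moments of orders 4, 6 and 8 of a Gaussian variable of that variance. The terms with [B] come
    from the negative fourth cumulant of the uniform law; the lower bound for [m6] leaves out its
    positive sixth cumulant. *)
Lemma moments_bounds pb L : (L <= N)%N -> P (box N c f) = pb%:E ->
  let A := seminorm2 L in let B := seminorm4 L in
  [/\ moment 2 L = (A / 3 * pb)%:E,
      moment 4 L = ((A ^+ 2 / 3 - 2 / 15 * B) * pb)%:E &
      exists m6 m8, [/\ moment 6 L = (m6 * pb)%:E, moment 8 L = (m8 * pb)%:E,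
        5 / 9 * A ^+ 3 - 2 / 3 * A * B <= m6 <= 5 / 9 * A ^+ 3 &
        m8 <= 35 / 27 * A ^+ 4]].
Proof.
move=> LN hpb.
have m0 l : moment 0 l = (1 * pb)%:E.
  rewrite /moment mul1r -hpb; under eq_integral do rewrite expr0.
  by rewrite integral_cst ?mul1e//; exact: measurable_box.
have B0 l : 0 <= seminorm4 l by apply: sumr_ge0 => i _; rewrite exprn_even_ge0.
have A0 l : 0 <= seminorm2 l by apply: sumr_ge0 => i _; rewrite exprn_even_ge0.
elim: L LN => [_|L IH LN].
  rewrite /seminorm2 /seminorm4 !big_ord0.
  have mz k : (0 < k)%N -> moment k 0 = 0%E.
    move=> k0; apply: integral0_eq => x _.
    by rewrite /lform big_ord0 expr0n gtn_eqF.
  split; [by rewrite mz// !mul0r|by rewrite mz// expr0n/= mul0r mulr0 subrr mul0r|].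
  exists 0, 0; split; rewrite ?mz ?mul0r//.
  by rewrite ?exprS ?mulr0 ?mul0r ?mulr0 ?subrr ?lexx.
have [h2 h4 [m6 [m8 [h6 h8 b6 b8]]]] := IH (ltnW LN).
set A := seminorm2 L in h2 h4 b6 b8; set B := seminorm4 L in h4 b6.
have A0' : 0 <= A := A0 L; have B0' : 0 <= B := B0 L.
set y := b L * f L.
have EA : seminorm2 L.+1 = A + y ^+ 2 by rewrite /seminorm2 big_ord_recr.
have EB : seminorm4 L.+1 = B + y ^+ 4 by rewrite /seminorm4 big_ord_recr.
pose m k := nth 0 [:: 1; A / 3; A ^+ 2 / 3 - 2 / 15 * B; m6; m8] k.
have mk k : (k < 5)%N -> moment k.*2 L = (m k * pb)%:E.
  by case: k => [|[|[|[|[|]]]]]//= _; rewrite m0.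
have y2 (z : R) : [/\ 0 <= z ^+ 2, 0 <= z ^+ 4, 0 <= z ^+ 6 & 0 <= z ^+ 8].
  by rewrite !exprn_even_ge0.
have R2 : moment 2 L.+1 = ((A / 3 + y ^+ 2 / 3) * pb)%:E.
  rewrite (@moment_rec 0 (fun k y => nth 0 [:: y ^+ 2 / 3; 1] k) m pb)//.
  - by rewrite !big_ord_recr big_ord0/= /m/= -/y; congr (_%:E); ring.
  - by move=> [|[|[]]]//= z; case: (y2 z) => *; lra.
  - by move=> [|[|[]]]//=; rewrite ?exprS ?mul0r.
  - move=> z w; rewrite !big_ord_recr big_ord0.
    change ((z + w) ^+ 3 - (z - w) ^+ 3 = 2 * 3 * (w * (0 + w ^+ 2 / 3 * z ^+ 0 + 1 * z ^+ 2))).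
    by field.
  - by move=> k k2; apply: mk; apply: leq_trans k2 _.
have R4 : moment 4 L.+1 = ((m 2 + 2 * y ^+ 2 * (A / 3) + y ^+ 4 / 5) * pb)%:E.
  rewrite (@moment_rec 1 (fun k y => nth 0 [:: y ^+ 4 / 5; 2 * y ^+ 2; 1] k) m pb)//.
  - by rewrite !big_ord_recr big_ord0/= /m/= -/y; congr (_%:E); ring.
  - move=> [|[|[|[]]]]//= z; case: (y2 z) => *; lra.
  - by move=> [|[|[|[]]]]//=; rewrite ?exprS ?mul0r ?mulr0.
  - move=> z w; rewrite !big_ord_recr big_ord0.
    change ((z + w) ^+ 5 - (z - w) ^+ 5 = 2 * 5 * (w * (0 + w ^+ 4 / 5 * z ^+ 0 + 2 * w ^+ 2 * z ^+ 2 + 1 * z ^+ 4))).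
    by field.
  - by move=> k k2; apply: mk; apply: leq_trans k2 _.
have R6 : moment 6 L.+1 =
    ((m6 + 5 * y ^+ 2 * m 2 + 3 * y ^+ 4 * (A / 3) + y ^+ 6 / 7) * pb)%:E.
  rewrite (@moment_rec 2 (fun k y => nth 0 [:: y ^+ 6 / 7; 3 * y ^+ 4; 5 * y ^+ 2; 1] k) m pb)//.
  - by rewrite !big_ord_recr big_ord0/= /m/= -/y; congr (_%:E); ring.
  - by move=> [|[|[|[|[]]]]]//= z; case: (y2 z) => *; lra.
  - by move=> [|[|[|[|[]]]]]//=; rewrite ?exprS ?mul0r ?mulr0.
  - move=> z w; rewrite !big_ord_recr big_ord0.
    change ((z + w) ^+ 7 - (z - w) ^+ 7 = 2 * 7 * (w * (0 + w ^+ 6 / 7 * z ^+ 0 + 3 * w ^+ 4 * z ^+ 2 + 5 * w ^+ 2 * z ^+ 4 + 1 * z ^+ 6))).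
    by field.
  - by move=> k k2; apply: mk; apply: leq_trans k2 _.
have R8 : moment 8 L.+1 = ((m8 + 28 / 3 * y ^+ 2 * m6 + 14 * y ^+ 4 * m 2 +
    4 * y ^+ 6 * (A / 3) + y ^+ 8 / 9) * pb)%:E.
  rewrite (@moment_rec 3 (fun k y => nth 0 [:: y ^+ 8 / 9; 4 * y ^+ 6; 14 * y ^+ 4;
     28 / 3 * y ^+ 2; 1] k) m pb)//.
  - by rewrite !big_ord_recr big_ord0/= /m/= -/y; congr (_%:E); ring.
  - by move=> [|[|[|[|[|[]]]]]]//= z; case: (y2 z) => *; lra.
  - by move=> [|[|[|[|[|[]]]]]]//=; rewrite ?exprS ?mul0r ?mulr0.
  - move=> z w; rewrite !big_ord_recr big_ord0.
    change ((z + w) ^+ 9 - (z - w) ^+ 9 = 2 * 9 * (w * (0 + w ^+ 8 / 9 * z ^+ 0 + 4 * w ^+ 6 * z ^+ 2 + 14 * w ^+ 4 * z ^+ 4 + 28 / 3 * w ^+ 2 * z ^+ 6 + 1 * z ^+ 8))).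
    by field.
rewrite EA EB; split.
- by rewrite R2; congr (_%:E); field.
- by rewrite R4 /m/=; congr (_%:E); field.
have [Y1 Y2 Y3 Y4] := y2 y.
exists (m6 + 5 * y ^+ 2 * m 2 + 3 * y ^+ 4 * (A / 3) + y ^+ 6 / 7).
exists (m8 + 28 / 3 * y ^+ 2 * m6 + 14 * y ^+ 4 * m 2 + 4 * y ^+ 6 * (A / 3) + y ^+ 8 / 9).
have /andP[b61 b62] := b6.
have A2 : 0 <= A ^+ 2 by rewrite exprn_ge0.
have A3 : 0 <= A ^+ 3 by rewrite exprn_ge0.
have p1 : 0 <= y ^+ 2 * B by rewrite mulr_ge0.
have p2 : 0 <= A * y ^+ 4 by rewrite mulr_ge0.
have p3 : 0 <= y ^+ 2 * A ^+ 2 by rewrite mulr_ge0.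
have p4 : 0 <= y ^+ 2 * (5 / 9 * A ^+ 3 - m6) by rewrite mulr_ge0// subr_ge0.
have p5 : 0 <= y ^+ 4 * B by rewrite mulr_ge0.
have p6 : 0 <= y ^+ 4 * A ^+ 2 by rewrite mulr_ge0.
have p7 : 0 <= y ^+ 6 * A by rewrite mulr_ge0.
rewrite /m/=; split => //.
- by apply/andP; split; lra.
- by lra.
Qed.

End Moments.

(** * Probability estimates from moments *)

Section Tails.
Context {R : realType}.
Local Notation W := (Romega R).
Local Notation lam := (@lebesgue_measure R).
Variable P : probability W R.

Definition pr (A : set W) : R := fine (P A).

Lemma prE A : measurable A -> P A = (pr A)%:E.
Proof. by move=> mA; rewrite /pr fineK// fin_num_measure. Qed.

Lemma pr_ge0 A : 0 <= pr A.
Proof. exact: fine_ge0. Qed.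

Lemma pr_le A B : measurable A -> measurable B -> A `<=` B -> pr A <= pr B.
Proof.
by move=> mA mB AB; rewrite -lee_fin -!prE//; apply: le_measure; rewrite ?inE.
Qed.

Lemma prU A B : measurable A -> measurable B -> pr (A `|` B) <= pr A + pr B.
Proof.
move=> mA mB; rewrite -lee_fin EFinD -!prE//; last exact: measurableU.
exact: measureU2.
Qed.

Hypothesis P_prod : is_product_lebesgue P.

Lemma pr_box N c f : subunit c f -> pr (box N c f) = \prod_(i < N) (2 * f i).
Proof. by move=> cf; rewrite /pr box_measure. Qed.

Lemma pr_box_gt0 N c f : subunit c f -> 0 < pr (box N c f).
Proof. by move=> cf; rewrite pr_box//; apply: prodr_gt0 => i _; have [? _ _] := cf i; rewrite mulr_gt0. Qed.

Lemma integral_box_indic N c f (S : set W) : measurable S ->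
  (\int[P]_(x in box N c f) (\1_S x)%:E = (pr (box N c f `&` S))%:E)%E.
Proof.
move=> mS; have mb := measurable_box N c f.
by rewrite integral_indic// -prE 1?setIC//; exact: measurableI.
Qed.

(** Integrates a pointwise polynomial inequality. The polynomial is split into [pc] and [nc] with
    nonnegative coefficients so that only nonnegative functions are integrated. *)
Lemma poly_markov N c f b L (m pc nc : nat -> R) n K (S : set W) :
  subunit c f -> (L <= N)%N -> measurable S -> 0 <= K ->
  (forall k, 0 <= pc k) -> (forall k, 0 <= nc k) ->
  (forall k, (k < n)%N -> moment P N c f b k.*2 L = (m k * pr (box N c f))%:E) ->
  (forall x, box N c f x ->
    \sum_(k < n) pc k * lform L b c x ^+ k.*2 <=
    K * \1_S x + \sum_(k < n) nc k * lform L b c x ^+ k.*2) ->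
  (\sum_(k < n) (pc k - nc k) * m k) * pr (box N c f) <= K * pr (box N c f `&` S).
Proof.
move=> cf LN mS K0 pc0 nc0 mE h; have mb := measurable_box N c f.
have mpow (d : nat -> R) : (forall k, 0 <= d k) ->
    measurable_fun (box N c f) (fun x => (\sum_(k < n) d k * lform L b c x ^+ k.*2)%:E).
  move=> d0; apply: measurable_funTS; apply/measurable_EFinP; apply: measurable_sum => k.
  apply: measurable_funM; first exact: measurable_cst.
  by apply/measurable_EFinP; exact: measurable_lform_pow.
have ge0 (d : nat -> R) x : (forall k, 0 <= d k) -> 0 <= \sum_(k < n) d k * lform L b c x ^+ k.*2.
  by move=> d0; apply: sumr_ge0 => k _; rewrite mulr_ge0// exprn_even_ge0// odd_double.
have mI : measurable_fun (box N c f) (fun x => (K * \1_S x)%:E).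
  apply: measurable_funTS; apply/measurable_EFinP.
  by apply: measurable_funM; [exact: measurable_cst|exact: measurable_indic].
have K1 x : 0 <= K * \1_S x by rewrite mulr_ge0.
have : (\int[P]_(x in box N c f) (\sum_(k < n) pc k * lform L b c x ^+ k.*2)%:E <=
   \int[P]_(x in box N c f) ((K * \1_S x)%:E +
      (\sum_(k < n) nc k * lform L b c x ^+ k.*2)%:E))%E.
  apply: ge0_le_integral => //.
  - by move=> x _; rewrite lee_fin ge0.
  - exact: mpow.
  - by apply: emeasurable_funD => //; exact: mpow.
rewrite ge0_integralD//; last 3 first.
- by move=> x _; rewrite lee_fin.
- by move=> x _; rewrite lee_fin ge0.
- exact: mpow.
rewrite !(@integral_even_comb _ P N c f b)//.
have sE (d : nat -> R) : (\sum_(k < n) (d k)%:E * moment P N c f b k.*2 L =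
    ((\sum_(k < n) d k * m k) * pr (box N c f))%:E)%E.
  by rewrite mulr_suml -sumEFin; apply: eq_bigr => k _; rewrite mE// -EFinM mulrA.
rewrite !sE; under eq_integral do rewrite EFinM.
rewrite ge0_integralZl_EFin//; last first.
  by apply: measurable_funTS; apply/measurable_EFinP; exact: measurable_indic.
rewrite integral_box_indic// -EFinM -EFinD lee_fin => h'.
rewrite (eq_bigr (fun k : 'I_n => pc k * m k - nc k * m k)) => [|k _]; last by rewrite mulrBl.
by rewrite sumrB mulrBl; lra.
Qed.

Lemma lform_zero N (c f b : nat -> R) x : (forall i, 0 < f i) -> seminorm2 f b N = 0 -> lform N b c x = 0.
Proof.
move=> f0 /eqP; rewrite /seminorm2 psumr_eq0 => [/allP h|i _]; last exact: exprn_even_ge0.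
rewrite /lform big1// => i _; have := h i (mem_index_enum i).
by rewrite sqrf_eq0 mulf_eq0 (gt_eqF (f0 i)) orbF => /eqP ->; rewrite mul0r.
Qed.

Lemma measurable_lform_gt N (b c : nat -> R) (g : R -> R) (l : R) : measurable_fun setT g ->
  measurable [set x : W | l < g (lform N b c x)].
Proof.
move=> mg; rewrite (_ : [set _ | _] = (g \o lform N b c) @^-1` `]l, +oo[%classic); last first.
  by apply/seteqP; split=> x/=; rewrite in_itv/= andbT.
rewrite -[X in measurable X]setTI; apply: (measurableT_comp mg (measurable_lform N b c)) => //.
Qed.

Lemma measurable_lform_ge N (b c : nat -> R) (g : R -> R) (l : R) : measurable_fun setT g ->
  measurable [set x : W | l <= g (lform N b c x)].
Proof.
move=> mg; rewrite (_ : [set _ | _] = (g \o lform N b c) @^-1` `[l, +oo[%classic); last first.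
  by apply/seteqP; split=> x/=; rewrite in_itv/= andbT.
rewrite -[X in measurable X]setTI; apply: (measurableT_comp mg (measurable_lform N b c)) => //.
Qed.

(* Second moment method: [1_{v >= th} >= 2 be (v - th) - be^2 (v - th)^2] with
   [v = z^2 / E z^2], [be = (1 - th) / 3], and [E z^4 <= 3 (E z^2)^2]. *)
Lemma paley_zygmund N c f b (th : R) : subunit c f -> 0 <= th <= 1 ->
  (1 - th) ^+ 2 / 3 * pr (box N c f) <=
  pr (box N c f `&` [set x | th * (seminorm2 f b N / 3) <= lform N b c x ^+ 2]).
Proof.
move=> cf /andP[th0 th1]; have mb := measurable_box N c f.
set S := [set x | _].
have mS : measurable S.
  by apply: (@measurable_lform_ge N b c (fun y => y ^+ 2)); exact: measurable_funX.
have p0 := pr_ge0 (box N c f).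
have A0 : 0 <= seminorm2 f b N by apply: sumr_ge0 => i _; exact: exprn_even_ge0.
(* In the degenerate case the form vanishes identically, the threshold is 0 and the event is the
   whole box. *)
have [Az|An] := eqVneq (seminorm2 f b N) 0.
  apply: (@le_trans _ _ (pr (box N c f))).
    by rewrite -[leRHS]mul1r ler_wpM2r//; nra.
  apply: pr_le => //; first exact: measurableI.
  move=> x xb; split => //; rewrite /S /= Az (@lform_zero _ _ f)//; last by move=> i; case: (cf i).
  by rewrite mul0r mulr0 expr0n.
have Ap : 0 < seminorm2 f b N by rewrite lt_neqAle eq_sym An.
have [h2 h4 _] := moments_bounds P_prod b cf (leqnn N) (prE mb).
set A := seminorm2 f b N in h2 h4 An Ap A0 S mS *.
set B := seminorm4 f b N in h4.
have B0 : 0 <= B by apply: sumr_ge0 => i _; exact: exprn_even_ge0.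
pose be : R := (1 - th) / 3; have be0 : 0 <= be by rewrite divr_ge0// subr_ge0.
have a0 : 0 < 3 / A by rewrite divr_gt0.
have := @poly_markov N c f b N
  (fun k => nth 0 [:: 1; A / 3; A ^+ 2 / 3 - 2 / 15 * B] k)
  (fun k => nth 0 [:: 0; (2 * be + 2 * be ^+ 2 * th) * (3 / A)] k)
  (fun k => nth 0 [:: 2 * be * th + be ^+ 2 * th ^+ 2; 0; be ^+ 2 * (3 / A) ^+ 2] k) 3 1 S
  cf (leqnn N) mS ler01.
rewrite !big_ord_recr !big_ord0/= mul1r => H; apply: le_trans (H _ _ _ _).
- rewrite ler_wpM2r//.
  rewrite [leRHS](_ : _ = 2 * be * (1 - th) + 2 * be ^+ 2 * th - be ^+ 2 * th ^+ 2 -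
    be ^+ 2 * 3 + be ^+ 2 * (3 / A) ^+ 2 * (2 / 15) * B); last by field.
  have : 0 <= be ^+ 2 * (3 / A) ^+ 2 * (2 / 15) * B.
    by apply: mulr_ge0 => //; rewrite -exprMn mulr_ge0 ?sqr_ge0//; lra.
  have : 0 <= be ^+ 2 * (2 * th - th ^+ 2) by rewrite mulr_ge0 ?sqr_ge0//; nra.
  rewrite /be; lra.
- move=> [|[|[]]]//=; apply: mulr_ge0; [|exact: ltW].
  by have : 0 <= be ^+ 2 * th; [rewrite mulr_ge0// sqr_ge0|lra].
- move=> [|[|[|[]]]]//=; last by rewrite -exprMn sqr_ge0.
  by have := sqr_ge0 (be * th); have : 0 <= be * th; [rewrite mulr_ge0|lra].
- move=> [|[|[|]]]//= _; rewrite /moment.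
  + under eq_integral do rewrite expr0.
    by rewrite integral_cst// mul1r mul1e; exact: prE.
- move=> x _; rewrite !big_ord_recr !big_ord0/=.
  set z := lform N b c x; set v := z ^+ 2 * (3 / A).
  have zv : z ^+ 2 = v * (A / 3) by rewrite /v; field.
  rewrite !(add0r, mul0r, addr0, expr0, mulr1).
  have -> : be ^+ 2 * (3 / A) ^+ 2 * z ^+ 4 = be ^+ 2 * v ^+ 2.
    by rewrite /v; field.
  have -> : (2 * be + 2 * be ^+ 2 * th) * (3 / A) * z ^+ 2 = (2 * be + 2 * be ^+ 2 * th) * v.
    by rewrite /v; ring.
  rewrite indicE mul1r; have [Sx|Sx] := pselect (S x).
    rewrite mem_set//=; have := sqr_ge0 (be * (v - th) - 1); rewrite /=; lra.
  rewrite memNset//=.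
  have vth : v <= th.
    move/negP: Sx; rewrite /S/= -/z -ltNge zv ltr_pM2r; last lra.
    by move/ltW.
  have := sqr_ge0 (be * (v - th)); have : 0 <= be * (th - v) by rewrite mulr_ge0// subr_ge0.
  by rewrite /=; lra.
Qed.

End Tails.

(** * Large values of a form caused by a single coordinate *)

Section Single.
Context {R : realType}.
Local Notation W := (Romega R).
Local Notation lam := (@lebesgue_measure R).
Variable P : probability W R.
Hypothesis P_prod : is_product_lebesgue P.

(** Fubini along coordinate [i]: the line through each point of [T] meets [S] in at least the
    proportion [k] of the side. *)
Lemma resample_lower N (c f : nat -> R) i (S T : set W) k :
  subunit c f -> (i < N)%N -> measurable S -> measurable T -> 0 <= k ->
  (forall x, T x -> exists J : set R, [/\ measurable J, J `<=` box_itv c f i,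
     ((k * (2 * f i))%:E <= lam J)%E & forall s, J s -> S (upd x i s)]) ->
  k * pr P (box N c f `&` T) <= pr P (box N c f `&` S).
Proof.
move=> cf iN mS mT k0 h; have mb := measurable_box N c f.
have [f0 _ _] := cf i; have f2 : 0 < 2 * f i by rewrite mulr_gt0.
rewrite -(ler_pM2l f2) -lee_fin !EFinM -!integral_box_indic//.
have mI (A : set W) : measurable A -> measurable_fun setT (fun x => (\1_A x)%:E : \bar R).
  by move=> mA; apply/measurable_EFinP; exact: measurable_indic.
have I0 (A : set W) x : (0 <= (\1_A x : R)%:E)%E by rewrite lee_fin.
rewrite (integral_box_resample P_prod _ iN (mI S mS))// muleA -EFinM.
rewrite -ge0_integralZl_EFin//; last 2 first.
- exact: measurable_funTS (mI T mT).
- by rewrite mulr_ge0// ltW.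
apply: ge0_le_integral => //.
- by move=> x _; rewrite mule_ge0// lee_fin mulr_ge0// ltW.
- apply: measurable_funTS; apply: emeasurable_funM => //; exact: mI.
- apply: measurable_funTS.
  apply: (@measurable_integral_upd _ i _ (fun x => (\1_S x)%:E)) => //; [exact: measurable_box_itv|exact: mI].
move=> x _; rewrite indicE; have [Tx|Tx] := pselect (T x); last first.
  by rewrite memNset// mule0 integral_ge0.
rewrite mem_set// mule1; have [J [mJ JI lJ JS]] := h x Tx.
rewrite mulrC; apply: (le_trans lJ).
have -> : lam J = (\int[lam]_(s in box_itv c f i) (\1_J s)%:E)%E.
  by rewrite integral_indic ?setIidl//; exact: measurable_box_itv.
apply: ge0_le_integral => //.
- exact: measurable_box_itv.
- by apply: measurable_funTS; apply/measurable_EFinP; exact: measurable_indic.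
- apply: measurable_funTS; exact: (measurableT_comp (mI S mS) (measurable_upd_r i x)).
move=> s _; rewrite lee_fin !indicE; have [Js|Js] := pselect (J s).
  by rewrite !mem_set//; exact: JS.
by rewrite memNset.
Qed.

Definition wipe (i : nat) (b : nat -> R) : nat -> R := fun k => if k == i then 0 else b k.

Lemma lform_wipe N b c i x : (i < N)%N ->
  lform N b c x = b i * (x i - c i) + lform N (wipe i b) c x.
Proof.
move=> iN; rewrite /lform (bigD1 (Ordinal iN))//= [in RHS](bigD1 (Ordinal iN))//=.
rewrite /wipe eqxx mul0r add0r; congr (_ + _); apply: eq_bigr => k.
by rewrite -val_eqE/= => /negbTE ->.
Qed.

Lemma lform_wipe_upd N b c i x s : lform N (wipe i b) c (upd x i s) = lform N (wipe i b) c x.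
Proof. by apply: eq_bigr => k _; rewrite /wipe updE; case: eqP => // _; rewrite !mul0r. Qed.

Lemma measurable_far i (c : R) l : measurable [set x : W | l < `|x i - c|].
Proof.
rewrite (_ : [set _ | _] = (fun x : W => `|x i - c|) @^-1` `]l, +oo[%classic); last first.
  by apply/seteqP; split=> x/=; rewrite in_itv/= andbT.
rewrite -[X in measurable X]setTI.
have : measurable_fun setT (fun x : W => x i - c).
  by apply: measurable_funB => //; exact: measurable_coord.
by move=> h; apply: (measurableT_comp (@normr_measurable R setT) h) => //; exact: measurable_itv.
Qed.

(** With probability at least [(1 - th) ^+ 2 / 3] the rest of the form has absolute value at least
    [l]. At one of the two ends of side [i] the main term has the same sign as the rest, so there
    the absolute values add up; that end layer is the proportion [d / 2] of the side. *)
Lemma boundary_layer N (c f b : nat -> R) i (d th l : R) :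
  subunit c f -> (i < N)%N -> 0 <= d <= 1 -> 0 <= th <= 1 -> 0 <= l ->
  3 * l ^+ 2 <= th * seminorm2 f (wipe i b) N ->
  1 < (1 - d) * (`|b i| * f i) + l ->
  d / 2 * ((1 - th) ^+ 2 / 3) * pr P (box N c f) <=
  pr P (box N c f `&` ([set x | (1 - d) * f i < `|x i - c i|] `&`
     [set x | 1 < `|lform N b c x|])).
Proof.
move=> cf iN /andP[d0 d1] th01 l0 hl hb; have [f0 _ _] := cf i.
set S : set W := _ `&` [set x | 1 < _].
have mS : measurable S.
  apply: measurableI; first exact: measurable_far.
  exact: (@measurable_lform_gt _ N b c (fun y => `|y|)).
have d2 : 0 <= d / 2 by rewrite divr_ge0.
rewrite -mulrA.
apply: le_trans (ler_wpM2l d2 (paley_zygmund P_prod N (wipe i b) cf th01)) _.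
apply: (resample_lower cf iN mS) => //.
  by apply: (@measurable_lform_ge _ N _ c (fun y => y ^+ 2)); exact: measurable_funX.
move=> x /= Tx; set y := lform N (wipe i b) c x in Tx.
have ly : l <= `|y|.
  by rewrite -(ler_pXn2r (ltn0Sn 1)) ?nnegrE// real_normK ?num_real//; lra.
have dS (s : R) : `|b i * (s - c i) + y| = `|b i| * `|s - c i| + `|y| ->
    (1 - d) * f i < `|s - c i| -> S (upd x i s).
  move=> e hs; split; first by rewrite /= updE eqxx.
  rewrite /= (lform_wipe _ _ _ iN) lform_wipe_upd updE eqxx e.
  apply: (lt_le_trans hb); apply: lerD => //; rewrite mulrCA ler_wpM2l//; exact: ltW.
(* The upper layer serves when [b i] and [y] have equal signs, the lower one when the signs are
   opposite. *)
have [by0|by0] := leP 0 (b i * y).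
- exists `](c i + (1 - d) * f i), (c i + f i)]%classic; split => //.
  + move=> s; rewrite /box_itv /= !in_itv/= => /andP[h1 h2]; apply/andP; split => //; nra.
  + rewrite lebesgue_measure_itv/= lte_fin; case: ifPn => hh.
      by rewrite -EFinB lee_fin; lra.
    by rewrite lee_fin; move: hh; rewrite -leNgt; nra.
  + move=> s; rewrite /= in_itv/= => /andP[h1 h2]; have s0 : 0 <= s - c i by nra.
    apply: dS; last by rewrite ger0_norm//; lra.
    rewrite -normrM; have t0 : 0 <= b i * (s - c i) * y by nra.
    have [u0|u0] := leP 0 (b i * (s - c i)).
      have [y0|y0] := leP 0 y; first by rewrite !ger0_norm// addr_ge0.
      have -> : b i * (s - c i) = 0 by nra.
      by rewrite add0r normr0 add0r.
    have y0 : y <= 0 by nra.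
    by rewrite !ler0_norm//; [ring|lra..].
- exists `[(c i - f i), (c i - (1 - d) * f i)[%classic; split => //.
  + move=> s; rewrite /box_itv /= !in_itv/= => /andP[h1 h2]; apply/andP; split => //; nra.
  + rewrite lebesgue_measure_itv/= lte_fin; case: ifPn => hh.
      by rewrite -EFinB lee_fin; lra.
    by rewrite lee_fin; move: hh; rewrite -leNgt; nra.
  + move=> s; rewrite /= in_itv/= => /andP[h1 h2]; have s0 : s - c i <= 0 by nra.
    apply: dS; last by rewrite ler0_norm//; lra.
    rewrite -normrM; have t0 : 0 <= b i * (s - c i) * y by nra.
    have [u0|u0] := leP 0 (b i * (s - c i)).
      have [y0|y0] := leP 0 y; first by rewrite !ger0_norm// addr_ge0.
      have -> : b i * (s - c i) = 0 by nra.
      by rewrite add0r normr0 add0r.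
    have y0 : y <= 0 by nra.
    by rewrite !ler0_norm//; [ring|lra..].
Qed.

End Single.

(** * Main entries of rows *)

Section Main.
Context {R : realType}.

(** For [m] near 1 the left side is tiny and [1 / 200 < Y] suffices; for smaller [m] the norm
    condition forces [Y] to be at least about [1 - m ^+ 2]. *)
Lemma two_coordinates_margin (m Y : R) : 0 <= m -> 499 / 500 <= m ^+ 2 + Y ->
  m ^+ 2 + Y <= 1 -> 2 / 5 <= m ^+ 2 -> 1 / 200 < Y ->
  (1 - m + 1 / 500) ^+ 2 < 4 / 15 * Y.
Proof.
move=> m0 A1 A2 m4 hY.
have m1 : m <= 1 by rewrite -(@expr_le1 _ 2)//; lra.
have m6 : 5 / 8 <= m.
  rewrite leNgt; apply/negP => h; have : m ^+ 2 <= (5 / 8) ^+ 2 by apply: lerXn2r; rewrite ?nnegrE; lra.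
  by move=> h2; clear -h2 m4; lra.
have [m9|m9] := leP (99 / 100) m.
  have h : (1 - m + 1 / 500) ^+ 2 <= (3 / 250) ^+ 2.
    by clear -m9 m1; apply: lerXn2r; rewrite ?nnegrE; lra.
  by clear -h hY; lra.
have h : 0 <= (m - 5 / 8) * (99 / 100 - m) by clear -m6 m9; apply: mulr_ge0; lra.
by clear -h A1 m9; lra.
Qed.

(* With [B <= 2/5 A] the mean of [z^6 - z^4] is at least
   [5/9 A^3 - 3/5 A^2 + 4/75 A], about [2/225] at [A = 1]. *)
Lemma sixth_moment_margin (A B m6 m8 : R) : 499 / 500 <= A <= 1 -> B <= 2 / 5 * A ->
  5 / 9 * A ^+ 3 - 2 / 3 * A * B <= m6 -> m8 <= 35 / 27 * A ^+ 4 ->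
  1 / 500 < m6 - (A ^+ 2 / 3 - 2 / 15 * B) - 1 / 500 * m8.
Proof.
move=> /andP[A1 A2] BA b6 b8; have A0 : 0 <= A by lra.
have h4 : A ^+ 4 <= 1 by rewrite expr_le1.
have hB : (2 / 3 * A - 2 / 15) * B <= (2 / 3 * A - 2 / 15) * (2 / 5 * A).
  by apply: ler_wpM2l; lra.
have h2 : (499 / 500) ^+ 2 <= A ^+ 2 by apply: lerXn2r; rewrite ?nnegrE; lra.
have h3 : (499 / 500) ^+ 3 <= A ^+ 3 by apply: lerXn2r; rewrite ?nnegrE; lra.
have h1 : A ^+ 2 <= A by rewrite expr2 ler_piMl.
by clear -h1 h2 h3 h4 hB b6 b8 A1 A2; lra.
Qed.

Local Notation W := (Romega R).
Local Notation lam := (@lebesgue_measure R).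
Variable P : probability W R.
Hypothesis P_prod : is_product_lebesgue P.

Variables (N : nat) (c f : nat -> R) (E : set W).
Hypothesis cf : subunit c f.
Hypothesis mE : measurable E.
Local Notation Q := (box N c f).
Variable eps : R.
Hypothesis eps_small : 500 * (500 * eps) <= 1.
Variable K : R.
Hypothesis K_def : K = 500 * 500 * 500.
Hypothesis K_eps : K * eps <= 1 / 500.
Hypothesis rareE : pr P (Q `&` E) <= eps * pr P Q.

(** In the application [b] is twice a row of the linear map, and [E] contains the points that miss
    [B] or whose reflection misses [B]. *)
Definition caught (b : nat -> R) := forall x, Q x -> 1 < `|lform N b c x| -> E x.

Lemma caught_layer b i (d th l : R) : caught b -> (i < N)%N ->
  0 <= d <= 1 -> 0 <= th <= 1 -> 0 <= l ->
  3 * l ^+ 2 <= th * seminorm2 f (wipe i b) N ->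
  1 < (1 - d) * (`|b i| * f i) + l -> d / 2 * ((1 - th) ^+ 2 / 3) <= eps.
Proof.
move=> cb iN d01 th01 l0 hl hb; rewrite -(ler_pM2r (pr_box_gt0 P_prod N cf)).
apply: le_trans (boundary_layer P_prod cf iN d01 th01 l0 hl hb) _.
apply: le_trans rareE; apply: pr_le.
- apply: measurableI; [exact: measurable_box|apply: measurableI].
    exact: measurable_far.
  exact: (@measurable_lform_gt _ N b c (fun y => `|y|)).
- by apply: measurableI => //; exact: measurable_box.
- by move=> x [Qx [_ h]]; split => //; exact: cb.
Qed.

Lemma main_entry_le b i : caught b -> (i < N)%N -> `|b i| * f i <= 10 / 9.
Proof.
move=> cb iN; rewrite leNgt; apply/negP => h.
have s0 : 0 <= seminorm2 f (wipe i b) N by apply: sumr_ge0 => k _; exact: exprn_even_ge0.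
have : (1 / 10 / 2 * ((1 - 0) ^+ 2 / 3)) <= eps.
  apply: (@caught_layer b i (1 / 10) 0 0 cb iN); rewrite ?expr0n/= ?mulr0 ?mul0r//; lra.
by move=> h1; have e := eps_small; lra.
Qed.

Lemma seminorm2_wipe b i : (i < N)%N ->
  seminorm2 f b N = (`|b i| * f i) ^+ 2 + seminorm2 f (wipe i b) N.
Proof.
move=> iN; rewrite /seminorm2 (bigD1 (Ordinal iN))//= [in RHS](bigD1 (Ordinal iN))//=.
rewrite /wipe eqxx mul0r expr0n add0r !exprMn real_normK ?num_real//; congr (_ + _).
by apply: eq_bigr => k; rewrite -val_eqE/= => /negbTE ->.
Qed.

Lemma two_coordinates_excluded b i : caught b -> (i < N)%N ->
  499 / 500 <= seminorm2 f b N <= 1 -> 2 / 5 <= (`|b i| * f i) ^+ 2 ->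
  seminorm2 f (wipe i b) N <= 1 / 200.
Proof.
move=> cb iN A1 m4; rewrite leNgt; apply/negP => hY.
have m0 : 0 <= `|b i| * f i by rewrite mulr_ge0// ltW//; case: (cf i).
move: A1; rewrite (seminorm2_wipe _ iN); set m := `|b i| * f i in m4 m0 *.
set Y := seminorm2 _ _ _ in hY * => /andP[A1 A2].
(* The largest [l] with [3 * l ^+ 2 <= th * Y] for [th = 4 / 5]. *)
pose l := Num.sqrt (4 / 15 * Y).
have l2 : l ^+ 2 = 4 / 15 * Y by rewrite sqr_sqrtr//; lra.
have l0 : 0 <= l by exact: sqrtr_ge0.
have : (1 / 500 / 2 * ((1 - 4 / 5) ^+ 2 / 3)) <= eps.
  apply: (@caught_layer b i (1 / 500) (4 / 5) l cb iN); [lra|lra|exact: l0|by rewrite l2 mulrA -/Y (_ : 3 * (4 / 15) = 4 / 5) ?lexx; last field|].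
  rewrite -/m; have hm := two_coordinates_margin m0 A1 A2 m4 hY; rewrite -l2 in hm.
  have m1 : m <= 1 by rewrite -(@expr_le1 _ 2)//; lra.
  have u0 : 0 <= 1 - m + 1 / 500 by lra.
  have hl : 1 - m + 1 / 500 < l.
    rewrite ltNge; apply/negP => h.
    have h2 : l ^+ 2 <= (1 - m + 1 / 500) ^+ 2.
      by apply: lerXn2r; rewrite ?nnegrE; [exact: l0|exact: u0|exact: h].
    by move: (lt_le_trans hm h2); rewrite ltxx.
  by lra.
rewrite (_ : (1 - 4 / 5) ^+ 2 = 1 / 25 :> R); last by field.
by move=> h1; have e := eps_small; lra.
Qed.

Lemma small_coordinates_excluded b : caught b ->
  499 / 500 <= seminorm2 f b N <= 1 ->
  exists2 i, (i < N)%N & 2 / 5 <= (`|b i| * f i) ^+ 2.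
Proof.
move=> cb /andP[A1 A2]; apply: contrapT => hno.
have hlt i : (i < N)%N -> (b i * f i) ^+ 2 <= 2 / 5.
  move=> iN; rewrite leNgt; apply/negP => h; apply: hno; exists i => //.
  by rewrite exprMn real_normK ?num_real// -exprMn ltW.
have mb := measurable_box N c f.
have [h2 h4 [m6 [m8 [h6 h8 /andP[b6 _] b8]]]] :=
  moments_bounds P_prod b cf (leqnn N) (prE P mb).
set A := seminorm2 f b N in h2 h4 b6 b8 A1 A2; set B := seminorm4 f b N in h4 b6.
have BA : B <= 2 / 5 * A.
  rewrite /B /A /seminorm4 /seminorm2 mulr_sumr; apply: ler_sum => i _.
  by rewrite (exprD _ 2 2) ler_wpM2r ?sqr_ge0// hlt.
have B0 : 0 <= B by apply: sumr_ge0 => i _; exact: exprn_even_ge0.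
have Q0 := pr_box_gt0 P_prod N cf.
have K0 : 0 <= K by rewrite K_def; lra.
have [g gE g0] : exists2 g : R, g = 1 / 500 & 0 <= g by exists (1 / 500); [reflexivity|apply: divr_ge0; [exact: ler01|exact: ler0n]].
have := @poly_markov _ P N c f b N
  (fun k => nth 0 [:: 1; A / 3; A ^+ 2 / 3 - 2 / 15 * B; m6; m8] k)
  (fun k => nth 0 [:: 0; 0; 0; 1] k)
  (fun k => nth 0 [:: 0; 0; 1; 0; g] k) 5 K E cf (leqnn N) mE K0.
rewrite !big_ord_recr !big_ord0/= => H.
have : (m6 - (A ^+ 2 / 3 - 2 / 15 * B) - g * m8) * pr P Q <= K * (eps * pr P Q).
  apply: le_trans (ler_wpM2l _ rareE); last exact: K0.
  apply: le_trans (H _ _ _ _).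
  - by rewrite le_eqVlt; apply/orP; left; apply/eqP; ring.
  - by move=> [|[|[|[|[]]]]]//=.
  - by move=> [|[|[|[|[|[]]]]]]//=.
  - move=> [|[|[|[|[|]]]]]//= _; rewrite /moment.
    under eq_integral do rewrite expr0.
    by rewrite integral_cst// mul1r mul1e; exact: prE.
  - move=> x Qx; rewrite !big_ord_recr !big_ord0/=; set z := lform N b c x.
    rewrite !(add0r, mul0r, addr0, mul1r).
    have e6 : z ^+ 6 = (z ^+ 2) ^+ 3 by rewrite -exprM.
    have e4 : z ^+ 4 = (z ^+ 2) ^+ 2 by rewrite -exprM.
    have e8 : z ^+ 8 = (z ^+ 2) ^+ 4 by rewrite -exprM.
    change (z ^+ 6 <= K * \1_E x + (z ^+ 4 + g * z ^+ 8)); rewrite e6 e4 e8.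
    set w := z ^+ 2; have w0 : 0 <= w by exact: sqr_ge0.
    have w8 : 0 <= w ^+ 4 by exact: exprn_ge0.
    have gw : 0 <= g * w ^+ 4 by rewrite mulr_ge0.
    (* Three ranges of [w]: up to 1 the fourth power dominates; from 1 to 500 the point lies in [E]
       and [w ^+ 3 <= 500 ^+ 3 = K]; beyond 500 the term [g * w ^+ 4] with [g = 1 / 500]
       dominates. *)
    have [z1|z1] := leP `|z| 1.
      have w1 : w <= 1 by rewrite /w -(real_normK (num_real z)) expr_le1.
      have : w ^+ 3 <= w ^+ 2 by rewrite exprS ler_piMl// sqr_ge0.
      have : 0 <= K * \1_E x by rewrite mulr_ge0//.
      lra.
    rewrite indicE mem_set ?mulr1; last exact: cb.
    have w2 : 0 <= w ^+ 2 by exact: sqr_ge0.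
    have [w250|w250] := leP w 500.
      have : w ^+ 3 <= 500 ^+ 3.
        by apply: lerXn2r; rewrite ?nnegrE; [exact: w0|exact: ler0n|exact: w250].
      by rewrite K_def; lra.
    have : 500 * w ^+ 3 <= w ^+ 4 by rewrite [leRHS]exprS; apply: ler_wpM2r; [exact: exprn_ge0|exact: ltW].
    by rewrite K_def gE; lra.
rewrite mulrA ler_pM2r// => h; have := sixth_moment_margin _ BA b6 b8.
by rewrite A1 A2 => /(_ isT); rewrite -gE => h'; have Ke := K_eps; rewrite -gE in Ke; move: (le_lt_trans Ke h') => /lt_le_trans /(_ h); rewrite ltxx.
Qed.

Lemma caught_scale b s : 0 <= s <= 1 -> caught b -> caught (fun k => s * b k).
Proof.
move=> /andP[s0 s1] cb x Qx.
have -> : lform N (fun k => s * b k) c x = s * lform N b c x.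
  by rewrite /lform mulr_sumr; apply: eq_bigr => i _; rewrite mulrA.
rewrite normrM (ger0_norm s0) => h; apply: cb => //.
by apply: (lt_le_trans h); rewrite ler_piMl.
Qed.

(** A long row is scaled down to norm about 1, which keeps it caught. The scaled row shows that the
    rest is small relative to the main entry, and [main_entry_le], applied before scaling, bounds
    the main entry itself. *)
Lemma main_column_scaled b s : caught b -> 0 <= s <= 1 ->
  499 / 500 <= s ^+ 2 * seminorm2 f b N <= 1 ->
  499 / 500 <= seminorm2 f b N ->
  exists i, [/\ (i < N)%N, seminorm2 f (wipe i b) N <= 1 / 100,
     9 / 10 <= `|b i| * f i & `|b i| * f i <= 10 / 9].
Proof.
move=> cb s01 sA A1; have cs := caught_scale s01 cb.
set A := seminorm2 f b N in sA A1.
have scE b' : seminorm2 f (fun k => s * b' k) N = s ^+ 2 * seminorm2 f b' N.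
  by rewrite /seminorm2 mulr_sumr; apply: eq_bigr => i _; rewrite -exprMn mulrA.
have wE i : wipe i (fun k => s * b k) = fun k => s * wipe i b k.
  by apply/funext => k; rewrite /wipe; case: eqP; rewrite ?mulr0.
have sA' : 499 / 500 <= seminorm2 f (fun k => s * b k) N <= 1 by rewrite scE.
have [i iN mi] := small_coordinates_excluded cs sA'.
have := two_coordinates_excluded cs iN sA' mi; rewrite wE scE => Y1.
have m9 := main_entry_le cb iN.
have := seminorm2_wipe b iN; rewrite -/A.
have m0 : 0 <= `|b i| * f i by rewrite mulr_ge0// ltW//; case: (cf i).
set m := `|b i| * f i in m9 m0 *; set Y := seminorm2 _ _ _ in Y1 * => AE.
have Y0 : 0 <= Y by apply: sumr_ge0 => k _; exact: exprn_even_ge0.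
have m2 : m ^+ 2 <= (10 / 9) ^+ 2 by apply: lerXn2r; rewrite ?nnegrE; lra.
have s2 : 0 <= s ^+ 2 by exact: sqr_ge0.
move/andP: sA => [sA1 sA2].
have h1 : 190 * Y <= m ^+ 2.
  have [s_0|s_n0] := eqVneq (s ^+ 2) 0; first by move: sA1; rewrite s_0 mul0r; lra.
  have sp : 0 < s ^+ 2 by rewrite lt_neqAle eq_sym s_n0.
  rewrite -(ler_pM2l sp); rewrite AE in sA1; lra.
have hY : Y <= 1 / 100 by lra.
exists i; split => //; rewrite -/m leNgt; apply/negP => hm.
have h : 0 < (9 / 10 - m) * (9 / 10 + m) by apply: mulr_gt0; lra.
by move: A1; rewrite AE => A1; lra.
Qed.


Lemma main_column b : caught b -> 499 / 500 <= seminorm2 f b N ->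
  exists i, [/\ (i < N)%N, seminorm2 f (wipe i b) N <= 1 / 100,
     9 / 10 <= `|b i| * f i & `|b i| * f i <= 10 / 9].
Proof.
move=> cb A1; have A0 : 0 < seminorm2 f b N by lra.
set A := seminorm2 f b N in A0 A1.
pose s := Num.min 1 (Num.sqrt A)^-1.
have sA0 : 0 < Num.sqrt A by rewrite sqrtr_gt0.
have sAA : Num.sqrt A ^+ 2 = A by rewrite sqr_sqrtr// ltW.
have s01 : 0 <= s <= 1.
  by rewrite /s le_min ler01 invr_ge0 (ltW sA0)/= ge_min lexx.
have [s1|s1] : (s = 1 /\ Num.sqrt A <= 1) \/ s * Num.sqrt A = 1.
  - have [h|h] := leP (Num.sqrt A) 1; [left|right]; rewrite /s.
      by split => //; apply/min_idPl; rewrite -invr1 lef_pV2 ?posrE.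
    by rewrite min_r ?mulVf ?gt_eqF// -[leRHS]invr1 lef_pV2 ?posrE// ltW.
  - case: s1 => s1 h; have sA : 499 / 500 <= s ^+ 2 * A <= 1.
      rewrite s1 expr1n mul1r A1/= -sAA.
      by rewrite expr_le1// ltW.
    exact: (@main_column_scaled b s).
have sA : 499 / 500 <= s ^+ 2 * A <= 1 by rewrite -sAA -exprMn s1 expr1n; lra.
exact: (@main_column_scaled b s).
Qed.

End Main.

(** * Total excess of many rows *)

Section Block.
Context {R : realType}.
Local Notation W := (Romega R).
Variable P : probability W R.
Hypothesis P_prod : is_product_lebesgue P.

Lemma prod_1sub (n : nat) (d : nat -> R) : (forall i, 0 <= d i <= 1) ->
  1 - \sum_(i < n) d i <= \prod_(i < n) (1 - d i).
Proof.
move=> d01; elim: n => [|n IH]; first by rewrite !big_ord0 subr0.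
rewrite !big_ord_recr/=; have /andP[d0 d1] := d01 n.
have p1 : \prod_(i < n) (1 - d i) <= 1.
  apply: prodr_ile1 => i _; have /andP[? ?] := d01 i; apply/andP; split; lra.
have h : 0 <= d n * (1 - \prod_(i < n) (1 - d i)) by rewrite mulr_ge0// subr_ge0.
lra.
Qed.

Variables (N : nat) (c f : nat -> R) (E : set W).
Hypothesis cf : subunit c f.
Hypothesis mE : measurable E.
Local Notation Q := (box N c f).
Variable eps : R.
Hypothesis rareE : pr P (Q `&` E) <= eps * pr P Q.
Local Notation caught b := (caught N c f E b).
Local Notation offmain i b := (Num.sqrt (seminorm2 f (wipe i b) N)).

(** Cuts the end layers off all sides except [i], which makes the events for different [i]
    disjoint. *)
Definition shrink (d : nat -> R) (i k : nat) : R :=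
  if (k < N)%N && (k != i) then (1 - d k) * f k else f k.

(** For each [i] consider the event that coordinate [i], and no other one, lies in its end layer
    while the form of row [i] exceeds 1. These events are disjoint parts of [E], so their
    probabilities add up to at most [eps] times that of the box. *)
Lemma block_small (bb : nat -> nat -> R) (d : nat -> R) :
  (forall i, (i < N)%N -> 0 <= d i) -> \sum_(i < N) d i <= 1 / 4 ->
  (forall i, (i < N)%N -> 0 < d i ->
     caught (bb i) /\ 1 < (1 - d i) * (`|bb i i| * f i) + 3 / 10 * offmain i (bb i)) ->
  (\sum_(i < N) d i) / 32 <= eps.
Proof.
move=> d0 ds hb.
have d4 i : (i < N)%N -> d i <= 1 / 4.
  move=> iN; apply: le_trans ds; rewrite (bigD1 (Ordinal iN))//= lerDl sumr_ge0// => k _.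
  by apply: d0.
pose f' i := shrink d i.
have cf' i : subunit c (f' i).
  move=> k; have [f0 f1 f2] := cf k; rewrite /f' /shrink; case: ifP => // /andP[kN _].
  have := d0 k kN; have := d4 k kN => h1 h2.
  have h3 : 0 <= d k * f k by apply: mulr_ge0 => //; exact: ltW.
  by split; [apply: mulr_gt0 => //; lra|lra|lra].
have fi i : f' i i = f i by rewrite /f' /shrink eqxx andbF.
have sub i : box N c (f' i) `<=` Q.
  move=> x h k kN; have := h k kN; rewrite /box_itv/= !in_itv/=.
  have [f0 _ _] := cf k; have := d0 k kN => h2.
  have h3 : 0 <= d k * f k by apply: mulr_ge0 => //; exact: ltW.
  by rewrite /f' /shrink; case: ifP => // _ /andP[h4 h5]; apply/andP; split; lra.
have mQ : measurable Q by exact: measurable_box.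
have vol i : 3 / 4 * pr P Q <= pr P (box N c (f' i)).
  rewrite !pr_box//.
  pose d' k := if (k < N)%N && (k != i) then d k else 0.
  have d'01 k : 0 <= d' k <= 1.
    rewrite /d'; case: ifP => [/andP[kN _]|_]; last by rewrite lexx ler01.
    by rewrite d0//=; apply: le_trans (d4 k kN) _; lra.
  have -> : \prod_(k < N) (2 * f' i k) = (\prod_(k < N) (1 - d' k)) * \prod_(k < N) (2 * f k).
    rewrite -big_split/=; apply: eq_bigr => k _; rewrite /f' /shrink /d'.
    by case: ifP => _; ring.
  apply: ler_wpM2r; first by apply: prodr_ge0 => k _; apply: mulr_ge0 => //; case: (cf k) => /ltW.
  apply: le_trans (prod_1sub N d'01).
  have : \sum_(k < N) d' k <= \sum_(k < N) d k.
    by apply: ler_sum => k _; rewrite /d'; case: ifP => // _; exact: d0.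
  by lra.
pose G i : set W := if d i == 0 then set0 else box N c (f' i) `&`
   ([set x | (1 - d i) * f i < `|x i - c i|] `&` [set x | 1 < `|lform N (bb i) c x|]).
have mG i : measurable (G i).
  rewrite /G; case: ifP => // _; apply: measurableI; first exact: measurable_box.
  apply: measurableI; first exact: measurable_far.
  exact: (@measurable_lform_gt _ N (bb i) c (fun y => `|y|)).
have Gsub i : (i < N)%N -> G i `<=` Q `&` E.
  move=> iN x; rewrite /G; case: ifPn => // di [h1 [_ h3]]; have Qx := sub i x h1.
  have di0 : 0 < d i by rewrite lt_neqAle eq_sym di d0.
  by have [cb _] := hb i iN di0; split => //; exact: cb.
have Glow i : (i < N)%N -> d i / 32 * pr P Q <= pr P (G i).
  move=> iN; rewrite /G; case: ifPn => [/eqP ->|di].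
    by rewrite mul0r mul0r; exact: pr_ge0.
  have di0 : 0 < d i by rewrite lt_neqAle eq_sym di d0.
  have [cb h1] := hb i iN di0.
  have q0 : 0 <= seminorm2 f (wipe i (bb i)) N by apply: sumr_ge0 => k _; exact: exprn_even_ge0.
  have qq : offmain i (bb i) ^+ 2 = seminorm2 f (wipe i (bb i)) N by exact: sqr_sqrtr.
  (* The sides keep at least 3/4 of their length, so [th = 1 / 2] and [l] equal to 3/10 of the norm
     of the rest are admissible: 3 * 9/100 is at most 1/2 * 9/16. The volume loss of at most 1/4
     gives d/2 * 1/12 * 3/4 = d/32. *)
  have := @boundary_layer _ P P_prod N c (f' i) (bb i) i (d i) (1 / 2)
    (3 / 10 * offmain i (bb i)) (cf' i) iN.
  rewrite fi => H; apply: le_trans (H _ _ _ _ h1).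
  - have := d0 i iN; have := vol i => h2 h3.
    have : d i / 2 * ((1 - 1 / 2) ^+ 2 / 3) * (3 / 4 * pr P Q) <=
       d i / 2 * ((1 - 1 / 2) ^+ 2 / 3) * pr P (box N c (f' i)).
      by apply: ler_wpM2l => //; apply: mulr_ge0; lra.
    by lra.
  - by rewrite d0//=; have := d4 i iN; lra.
  - by lra.
  - by apply: mulr_ge0; [lra|exact: sqrtr_ge0].
  - rewrite exprMn qq.
    suff : 9 / 16 * seminorm2 f (wipe i (bb i)) N <= seminorm2 (f' i) (wipe i (bb i)) N.
      by move: q0; set s := seminorm2 f _ _; set s' := seminorm2 (f' i) _ _ => ? ?; lra.
    rewrite /seminorm2 mulr_sumr; apply: ler_sum => k _; rewrite !exprMn mulrCA.
    apply: ler_wpM2l; first exact: sqr_ge0.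
    have f2 : 0 <= f k ^+ 2 by exact: sqr_ge0.
    rewrite /f' /shrink ltn_ord/=; case: ifP => _; last by lra.
    rewrite exprMn; apply: ler_wpM2r => //.
    have h4 := d4 k (ltn_ord k).
    have -> : (9 / 16 : R) = (3 / 4) ^+ 2 by field.
    by apply: lerXn2r; rewrite ?nnegrE; lra.
(* In [G i] coordinate [i] lies in its end layer, which the shrunk box of [G j] has lost. *)
have tG : trivIset `I_N G.
  move=> i j /= iN jN [x [Gi Gj]]; apply/eqP/negPn/negP => ij; move: Gi Gj.
  rewrite /G; case: ifP => // _ [_ [h1 _]]; case: ifP => // _ [h2 _].
  have := h2 i iN; rewrite /box_itv /f' /shrink iN ij/= in_itv/= => /andP[h3 h4].
  move: h1; rewrite /= ltNge => /negP; apply; rewrite ler_norml; apply/andP; split; lra.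
have mU : measurable (\big[setU/set0]_(k < N) G k) by apply: bigsetU_measurable.
have sumG : \sum_(i < N) pr P (G i) <= pr P (Q `&` E).
  rewrite -lee_fin -sumEFin -prE; last exact: measurableI.
  under eq_bigr do rewrite -prE//.
  rewrite -(measure_semi_additive_ord_I _ _ tG)//; apply: le_measure.
  - by rewrite inE.
  - by rewrite inE; exact: measurableI.
  - by rewrite -bigcup_mkord => x [i /= iN Gx]; exact: (Gsub i iN).
have Q0 := pr_box_gt0 P_prod N cf.
rewrite -(ler_pM2r Q0) !mulr_suml; apply: le_trans rareE; apply: le_trans sumG.
by apply: ler_sum => i _; exact: Glow.
Qed.

Hypothesis eps_small : 500 * (500 * eps) <= 1.

(** A larger total could be scaled down to exactly 1/4, where [block_small] gives 1/128 as a lower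
    bound for [eps]. *)
Lemma block (bb : nat -> nat -> R) (d : nat -> R) :
  (forall i, (i < N)%N -> 0 <= d i) ->
  (forall i, (i < N)%N -> 0 < d i ->
     caught (bb i) /\ 1 < (1 - d i) * (`|bb i i| * f i) + 3 / 10 * offmain i (bb i)) ->
  \sum_(i < N) d i <= 1 / 4.
Proof.
move=> d0 hb; rewrite leNgt; apply/negP; set S := \sum_(i < N) d i => hS.
have S0 : 0 < S by lra.
have e := eps_small.
pose t := (4 * S)^-1; have t0 : 0 <= t by rewrite invr_ge0; lra.
have tS : S * t = 1 / 4 by rewrite /t; field; rewrite gt_eqF.
have t1 : t <= 1 by rewrite -(ler_pM2l S0); lra.
have sE : \sum_(i < N) (d i * t) = 1 / 4 by rewrite -mulr_suml.
have := @block_small bb (fun i => d i * t); rewrite sE => H.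
suff : 1 / 4 / 32 <= eps by lra.
apply: H => //= [i iN|i iN]; first by rewrite mulr_ge0// d0.
have [->|dn] := eqVneq (d i) 0; first by rewrite mul0r ltxx.
move=> _; have d1 : 0 < d i by rewrite lt_neqAle eq_sym dn d0.
have [cb h] := hb i iN d1; split => //; apply: lt_le_trans h _.
apply: lerD => //; apply: ler_wpM2r; first by rewrite mulr_ge0//; case: (cf i) => /ltW.
have : d i * t <= d i * 1 by apply: ler_wpM2l => //; exact: ltW.
by lra.
Qed.

(** The rest of the row reaches 3/10 of its norm with a fixed probability, so this measures by how
    much the form can exceed 1 near an end of side [i]. *)
Definition excess (i : nat) (b : nat -> R) : R :=
  Num.max 0 (`|b i| * f i + 3 / 10 * offmain i b - 1).

(** For each main column only the row of largest excess is used, so [block] needs at most [N] layers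
    however many rows there are. The weights of the rows that share a main column add up to at most
    1. *)
Lemma sum_excess (J : nat) (b : nat -> nat -> R) (rel : pred nat) (mn : nat -> nat)
    (w : nat -> R) :
  (forall j, (j < J)%N -> rel j -> [/\ caught (b j), (mn j < N)%N,
     `|b j (mn j)| * f (mn j) <= 10 / 9 & 0 <= w j]) ->
  (forall i, (i < N)%N -> \sum_(j < J | rel j && (mn j == i)) w j <= 1) ->
  \sum_(j < J | rel j) w j * excess (mn j) (b j) <= 1.
Proof.
move=> hr hw; pose ex j := excess (mn j) (b j).
have ex0 j : 0 <= ex j by rewrite /ex /excess le_max lexx.
have /choice[g gP] : forall i : nat, exists o : option 'I_J,
    if o is Some j then [/\ rel j, mn j = i & forall k : 'I_J, rel k -> mn k = i -> ex k <= ex j]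
    else forall k : 'I_J, rel k -> mn k != i.
  move=> i; case: (pickP (fun j : 'I_J => rel j && (mn j == i))) => [j0 hj0|h].
    case: (@Order.TotalTheory.arg_maxP _ _ _ j0 (fun j : 'I_J => rel j && (mn j == i)) (fun j : 'I_J => ex j) hj0).
    move=> j /andP[rj /eqP mj] hmax; exists (Some j); split => // k rk mk.
    by apply: hmax; rewrite rk mk eqxx.
  by exists None => k rk; have := h k; rewrite rk/= => ->.
pose M i : R := if g i is Some j then ex j else 0.
have M0 i : 0 <= M i by rewrite /M; case: (g i).
pose bb i := if g i is Some j then b j else fun=> 0.
(* Since the main entry is at most 10/9, a layer of width [9 / 20 * M i] costs at most half of the
   excess. *)
have sM : \sum_(i < N) (9 / 20 * M i) <= 1 / 4.
  apply: (@block bb (fun i => 9 / 20 * M i)) => [i iN|i iN]/=; first by apply: mulr_ge0; [lra|exact: M0].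
  rewrite /M /bb; have := gP i; case: (g i) => [j [rj mj _]|_]; last by rewrite mulr0 ltxx.
  move=> h; have [cb _ m9 _] := hr j (ltn_ord j) rj; split => //.
  have e0 : 0 < ex j by lra.
  have : ex j = `|b j i| * f i + 3 / 10 * offmain i (b j) - 1.
    move: e0; rewrite /ex /excess mj => e0; rewrite max_r// leNgt; apply/negP => h0.
    by move: e0; rewrite max_l ?ltxx// ltW.
  rewrite mj in m9 *; set m := `|_| * _ in m9 * => ee.
  have : ex j * m <= ex j * (10 / 9) by apply: ler_wpM2l.
  by lra.
have {}sM : \sum_(i < N) M i <= 1 by move: sM; rewrite -mulr_sumr; lra.
apply: le_trans sM.
have step (j : 'I_J) : rel j ->
    w j * ex j <= \sum_(i < N) (if mn j == i then w j * M i else 0).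
  move=> rj; have [_ mN _ w0] := hr j (ltn_ord j) rj.
  rewrite (bigD1 (Ordinal mN))//= eqxx big1 ?addr0.
    apply: ler_wpM2l => //; rewrite /M; have := gP (mn j).
    by case: (g (mn j)) => [k [_ _ h]|/(_ j rj)]; [exact: h|rewrite eqxx].
  by move=> i; rewrite -val_eqE/= eq_sym => /negbTE ->.
apply: (@le_trans _ _ (\sum_(j < J | rel j) \sum_(i < N) (if mn j == i then w j * M i else 0))).
  by apply: ler_sum => j rj; exact: step.
rewrite exchange_big/=; apply: ler_sum => i _.
rewrite -big_mkcondr/= -mulr_suml -[leRHS]mul1r; apply: ler_wpM2r => //; exact: hw.
Qed.

End Block.

(** * Logarithmic potentials *)

Section Tangent.
Context {R : realType}.
Implicit Types (s x y z th : R).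

Lemma ln1D_le z : -1 < z -> ln (1 + z) <= z.
Proof. by move=> z1; apply: le_ln1Dx. Qed.

Lemma ln1D_le_sq z u : 0 < 1 + z -> 0 < 1 + u -> 1 + z <= (1 + u) ^+ 2 -> ln (1 + z) <= 2 * u.
Proof.
move=> z0 u0 h; apply: (@le_trans _ _ (ln ((1 + u) ^+ 2))).
  by rewrite ler_ln ?posrE// exprn_gt0.
rewrite lnXn// mulr2n; have : ln (1 + u) <= u by apply: ln1D_le; lra.
by lra.
Qed.

(** For [s = v j / (v j + t)] and [x = v i / v j] this is the difference [g i - g j] of the
    potentials [g i = ln (1 + v i / t)], and [- ln (1 - s)] is [g j]. *)
Definition lnstep s x : R := ln (1 + s * (x - 1)).

(** The distance of the concave function [lnstep s] below its tangent at [x = 1]. *)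
Definition lngap s x : R := s * (x - 1) - lnstep s x.

(** In terms of the potential this is [Num.max 0 (g i - Num.max (g j) (ln 2))], the part of the
    increase from [g j] to [g i] above the level [ln 2], which is [g M] when [t = v M]. *)
Definition lnover s x : R := Num.max 0 (lnstep s x - Num.max 0 (ln 2 + ln (1 - s))).

Lemma lnstep_arg s x : 0 < s < 1 -> 0 <= x -> 0 < 1 + s * (x - 1).
Proof. move=> /andP[s0 s1] x0; have : 0 <= s * x by rewrite mulr_ge0// ltW.
by move=> ?; lra. Qed.

Lemma lngap_ge0 s x : 0 < s < 1 -> 0 <= x -> 0 <= lngap s x.
Proof.
by move=> s01 x0; rewrite /lngap subr_ge0 ln1D_le//; have := lnstep_arg s01 x0; lra.
Qed.

Lemma lnover_ge0 s x : 0 <= lnover s x.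
Proof. by rewrite le_max lexx. Qed.

Lemma lnover_le s x : 0 < s < 1 -> 0 <= x -> lnover s x <= Num.max 0 (s * (x - 1)).
Proof.
move=> s01 x0; rewrite /lnover ge_max le_max lexx/= le_max; apply/orP; right.
have := lngap_ge0 s01 x0; rewrite /lngap => h.
have : 0 <= Num.max 0 (ln 2 + ln (1 - s)) by rewrite le_max lexx.
by lra.
Qed.

Lemma lnover_scale s x th : 0 < s < 1 -> 0 <= x -> 0 < th <= 1 ->
  lnstep s x <= lnstep s (th * x) - ln th.
Proof.
move=> s01 x0 /andP[t0 t1]; have tx0 : 0 <= th * x by rewrite mulr_ge0// ltW.
have a1 := lnstep_arg s01 x0; have a2 := lnstep_arg s01 tx0.
rewrite /lnstep lerBrDr -lnM ?posrE// ler_ln ?posrE ?mulr_gt0//.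
move/andP: s01 => [s0 s1]; have : 0 <= (1 - th) * (1 - s) by rewrite mulr_ge0; lra.
by lra.
Qed.

(** For such [s] a positive overshoot forces [z = s * (x - 1)] above 3/5. There
    [ln (1 + z) <= 9 / 10 * z], so the gap is at least a tenth of [z]. *)
Lemma lnover_gap s x : 0 < s < 1 / 5 -> 0 <= x -> lnover s x <= 10 * lngap s x.
Proof.
move=> /andP[s0 s5] x0; have s01 : 0 < s < 1 by lra.
have D0 := lngap_ge0 s01 x0; rewrite /lnover ge_max; apply/andP; split; first by lra.
have a0 := lnstep_arg s01 x0; move: D0; rewrite /lngap /lnstep.
set z := s * (x - 1) in a0 * => D0.
have mx : ln 2 + ln (1 - s) <= Num.max 0 (ln 2 + ln (1 - s)) by rewrite le_max lexx orbT.
have [z3|z3] := leP (3 / 5) z; last first.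
  have : ln (1 + z) <= ln 2 + ln (1 - s).
    by rewrite -lnM ?posrE ?ler_ln ?posrE; lra.
  by lra.
have h : ln (1 + z) <= 2 * (9 / 20 * z).
  apply: ln1D_le_sq; [lra|lra|].
  have : 0 <= (z - 3 / 5) * z by apply: mulr_ge0; lra.
  by lra.
have mx0 : 0 <= Num.max 0 (ln 2 + ln (1 - s)) by rewrite le_max lexx.
by lra.
Qed.

Lemma ln1B_le y : 0 <= y < 1 -> ln (1 - y) <= - y - y ^+ 2 / 4.
Proof.
move=> /andP[y0 y1]; have y2 : 0 <= y ^+ 2 by exact: sqr_ge0.
have yy : y ^+ 2 <= y by rewrite expr2 ler_piMl// ltW.
have h : ln (1 + - y) <= 2 * (- (y / 2) - y ^+ 2 / 8).
  apply: ln1D_le_sq; [lra|lra|].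
  have y3 : 0 <= y ^+ 3 by exact: exprn_ge0.
  have y4 : 0 <= y ^+ 4 by exact: exprn_ge0.
  by lra.
by lra.
Qed.

Lemma lngap_far s x : 1 / 5 <= s < 1 -> 0 <= x <= 1 / 2 -> 1 / 400 <= lngap s x.
Proof.
move=> /andP[s0 s1] /andP[x0 x1]; pose y := s * (1 - x).
have y1 : 1 / 10 <= y.
  have : 0 <= (s - 1 / 5) * (1 - x) by apply: mulr_ge0; lra.
  by rewrite /y; lra.
have y2 : y < 1.
  have : 0 <= s * x by apply: mulr_ge0; lra.
  by rewrite /y; lra.
have : ln (1 - y) <= - y - y ^+ 2 / 4 by apply: ln1B_le; lra.
have -> : lngap s x = - y - ln (1 - y).
  by rewrite /lngap /lnstep /y (_ : 1 + s * (x - 1) = 1 - s * (1 - x)); ring.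
have : (1 / 10) ^+ 2 <= y ^+ 2 by apply: lerXn2r; rewrite ?nnegrE; lra.
by lra.
Qed.

End Tangent.

(** * The logarithmic inequality for one row *)

Section Row.
Context {R : realType}.

Lemma main_scale (m q : R) : 0 <= m <= 10 / 9 -> 0 <= q <= 1 / 10 -> 1 < m ^+ 2 + q ^+ 2 ->
  m ^+ 2 + q ^+ 2 - 1 <= 11 / 5 * (m + 3 / 10 * q - 1).
Proof.
move=> /andP[m0 m9] /andP[q0 q1] h; pose u := m + 3 / 10 * q - 1.
have mE : m = 1 + u - 3 / 10 * q by rewrite /u; ring.
have qq : q ^+ 2 <= 1 / 10 * q by rewrite expr2; apply: ler_wpM2r.
have u0 : 0 <= u.
  rewrite leNgt; apply/negP => u0.
  have : 0 <= (1 - 3 / 10 * q - m) * (1 - 3 / 10 * q + m) by apply: mulr_ge0; lra.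
  by lra.
have u2 : u ^+ 2 <= 1 / 5 * u by rewrite expr2; apply: ler_wpM2r => //; rewrite /u; lra.
have uq : 0 <= u * q by apply: mulr_ge0.
rewrite -/u mE; lra.
Qed.

(** One half of a dichotomy: either the squared norm falls short of 1 by twice [q ^+ 2], or
    [1 - 1 / 5 * q <= m] and the excess is at least [q / 10]. *)
Lemma main_deficit (m q : R) : 0 <= m -> 0 <= q <= 1 / 10 -> m < 1 - 1 / 5 * q ->
  2 * q ^+ 2 <= 1 - m ^+ 2 - q ^+ 2.
Proof.
move=> m0 /andP[q0 q1] h.
have qq : q ^+ 2 <= 1 / 10 * q by rewrite expr2; apply: ler_wpM2r.
have : 0 <= (1 - 1 / 5 * q - m) * (1 - 1 / 5 * q + m) by apply: mulr_ge0; lra.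
by lra.
Qed.

(** The unit mass of a row is split into [p] for the first columns, [om] for the main entry, [W1]
    for the other entries and [nu] for what is missing. [Y], [K1] and [D1] are squared norm,
    overshoot and gap of the other entries, and [d] is the deficit of the squared norm. For
    [s < 1 / 5] the gaps pay for the overshoots; for larger [s] one has [phi >= 1 / 100], so [om] is
    close to 1 unless the right side is large. *)
Lemma row_scaled (s p om z e nu W1 Y K1 D1 phi d : R) :
  0 < s < 1 -> 0 <= p -> 0 <= om -> 0 <= z -> 0 <= e -> 0 <= nu -> 0 <= W1 -> 0 <= Y <= 1 / 100 ->
  0 <= D1 -> 0 <= d -> nu + p + om + W1 = 1 -> s ^+ 2 / 4 <= phi ->
  K1 <= s * Y -> (s < 1 / 5 -> K1 <= 10 * D1) -> (1 / 5 <= s -> W1 <= 400 * D1 + 2 * Y) ->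
  om * z <= 1 -> 2 * Y <= d \/ om * Y <= e ->
  K1 + om * lnover s z <= 6 * e + 4 * p + 2010 * (nu * phi + s * d + D1 + om * lngap s z).
Proof.
move=> s01 p0 om0 z0 e0 nu0 W10 /andP[Y0 Y1] D10 d0 one phis K1Y K1D W1D omz HY.
have /andP[s0 s1] := s01; have s0' := ltW s0.
have sd0 : 0 <= s * d by apply: mulr_ge0.
have Dz0 : 0 <= om * lngap s z by apply: mulr_ge0 => //; exact: lngap_ge0.
have s20 : 0 <= s ^+ 2 / 4 by rewrite divr_ge0 ?sqr_ge0.
have nphi : 0 <= nu * phi by apply: mulr_ge0 => //; exact: le_trans phis.
have [s5|s5] := ltP s (1 / 5).
  have h1 : om * lnover s z <= om * (10 * lngap s z).
    by apply: ler_wpM2l => //; apply: lnover_gap => //; rewrite s0 s5.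
  move: h1 (K1D s5) sd0 Dz0 nphi D10 e0 p0; clear; lra.
have phi1 : nu * (1 / 100) <= nu * phi.
  apply: ler_wpM2l => //; apply: le_trans phis.
  have h : (1 / 5) ^+ 2 <= s ^+ 2 by apply: lerXn2r; rewrite ?nnegrE ?s0'// divr_ge0.
  by move: h; clear; lra.
have K2 : om * lnover s z <= 1 - om.
  have h1 : om * lnover s z <= om * Num.max 0 (s * (z - 1)).
    by apply: ler_wpM2l => //; exact: lnover_le.
  apply: (le_trans h1); case: (leP 0 (s * (z - 1))) => h; last first.
    by rewrite mulr0; move: one nu0 p0 W10; clear; lra.
  have z1 : 0 <= z - 1 by rewrite -(pmulr_rge0 _ s0).
  have : 0 <= om * ((1 - s) * (z - 1)) by rewrite !mulr_ge0// subr_ge0 ltW.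
  by move: omz; clear; lra.
move: {W1D} (W1D s5) => W1D; set Dz := om * lngap s z in Dz0 *.
set o := om * lnover s z in K2 *; set np := nu * phi in nphi phi1 *.
have sY : K1 <= Y by apply: (le_trans K1Y); rewrite ler_piMl// ltW.
have om2 : 1 - om <= p + 100 * np + 400 * D1 + 2 * Y.
  by move: phi1 one W1D; clear; lra.
suff : Y <= 2 * e + p + 500 * np + 500 * D1 + 5 / 2 * (s * d).
  by move: sY om2 K2 sd0 Dz0 nphi D10 e0 p0; clear; lra.
case: HY => hY.
  have h : 1 / 5 * d <= s * d by apply: ler_wpM2r.
  by move: h hY sd0 nphi D10 e0 p0; clear; lra.
have [ho|ho] := leP (1 / 2) om.
  have h : 1 / 2 * Y <= om * Y by apply: ler_wpM2r.
  by move: h hY sd0 nphi D10 e0 p0; clear; lra.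
by move: ho om2 Y1 sd0 nphi D10 e0 p0; clear; lra.
Qed.

(** Reduces to [row_scaled] by shrinking the main ratio [X] until the squared norm of the row is at
    most 1. The logarithm of the factor is paid by the excess [e]. *)
Lemma row_with_main (s p om X e nu W1 Y K1 D1 phi T : R) :
  0 < s < 1 -> 0 <= p -> 0 <= om -> 0 <= X -> 0 <= e -> 0 <= nu -> 0 <= W1 -> 0 <= Y <= 1 / 100 ->
  0 <= D1 -> nu + p + om + W1 = 1 -> s ^+ 2 / 4 <= phi ->
  K1 <= s * Y -> (s < 1 / 5 -> K1 <= 10 * D1) -> (1 / 5 <= s -> W1 <= 400 * D1 + 2 * Y) ->
  Num.sqrt (om * X) <= 10 / 9 -> 0 < om * X ->
  om * Num.max 0 (Num.sqrt (om * X) + 3 / 10 * Num.sqrt Y - 1) <= e ->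
  T = nu * phi + s * (1 - p) - s * (om * X + Y) + D1 + om * lngap s X ->
  K1 + om * lnover s X <= 2010 * (4 * (e + p) + T).
Proof.
move=> s01 p0 om0 X0 e0 nu0 W10 /andP[Y0 Y1] D10 one phis K1Y K1D W1D.
set m := Num.sqrt (om * X); set q := Num.sqrt Y => m9 omX he TE.
have m2 : m ^+ 2 = om * X by rewrite sqr_sqrtr// ltW.
have q2 : q ^+ 2 = Y by rewrite sqr_sqrtr.
have m0 : 0 <= m by exact: sqrtr_ge0.
have q0 : 0 <= q by exact: sqrtr_ge0.
have q1 : q <= 1 / 10.
  rewrite leNgt; apply/negP => h.
  have : 0 < (q - 1 / 10) * (q + 1 / 10) by apply: mulr_gt0; lra.
  by lra.
have mp : 0 < m ^+ 2 by rewrite m2.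
have m9' : 0 <= m <= 10 / 9 by rewrite m0 m9.
have q1' : 0 <= q <= 1 / 10 by rewrite q0 q1.
have h0 : om * (m + 3 / 10 * q - 1) <= e.
  by apply: le_trans he; apply: ler_wpM2l => //; rewrite le_max lexx orbT.
(* The factor is [(1 - Y) / m ^+ 2] when the row is too long and 1 otherwise; [main_scale] bounds
   its logarithm by the excess. *)
have [th [/andP[t0 t1] d0 lnt dY]] : exists th : R, [/\ 0 < th <= 1, 0 <= 1 - Y - th * m ^+ 2,
    om * (- ln th) <= 3 * e & m ^+ 2 + Y <= 1 -> th = 1].
  have [h|h] := leP (m ^+ 2 + Y) 1.
    by exists 1; split; rewrite ?ltr01 ?lexx// ?ln1 ?oppr0 ?mulr0//; lra.
  have hY : 0 < 1 - Y by lra.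
  exists ((1 - Y) / m ^+ 2); split.
  - rewrite divr_gt0//= ler_pdivrMr// mul1r; lra.
  - by rewrite divfK ?gt_eqF// subrr.
  - have hh := main_scale m9' q1' (_ : 1 < m ^+ 2 + q ^+ 2); rewrite q2 in hh.
    have {}hh := hh h.
    rewrite -lnV ?posrE ?divr_gt0// invf_div.
    have -> : m ^+ 2 / (1 - Y) = 1 + (m ^+ 2 + Y - 1) / (1 - Y) by field; rewrite gt_eqF.
    have h1 : (m ^+ 2 + Y - 1) / (1 - Y) <= 3 * (m + 3 / 10 * q - 1).
      rewrite ler_pdivrMr//.
      have : 0 <= (1 / 100 - Y) * (m + 3 / 10 * q - 1) by apply: mulr_ge0; lra.
      by lra.
    have h2 : ln (1 + (m ^+ 2 + Y - 1) / (1 - Y)) <= (m ^+ 2 + Y - 1) / (1 - Y).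
      have h3 : 0 <= (m ^+ 2 + Y - 1) / (1 - Y) by apply: divr_ge0; lra.
      by apply: ln1D_le; lra.
    have : om * ln (1 + (m ^+ 2 + Y - 1) / (1 - Y)) <= om * (3 * (m + 3 / 10 * q - 1)).
      by apply: ler_wpM2l => //; exact: le_trans h1.
    by lra.
  - by move=> h'; lra.
pose z := th * X; have z0 : 0 <= z by apply: mulr_ge0 => //; exact: ltW.
have st := lnover_scale s01 X0 (_ : 0 < th <= 1); rewrite t0 t1 in st.
have {}st := st isT; rewrite -/z in st.
have lt0 : 0 <= - ln th by rewrite oppr_ge0 -ln1 ler_ln ?posrE.
have over : lnover s X <= lnover s z - ln th.
  rewrite {1}/lnover ge_max; apply/andP; split; first by have := lnover_ge0 s z; lra.
  have : lnstep s z - Num.max 0 (ln 2 + ln (1 - s)) <= lnover s z by rewrite /lnover le_max lexx orbT.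
  by lra.
have gap : om * lngap s z + s * (1 - th) * m ^+ 2 + om * ln th <= om * lngap s X.
  rewrite m2 (_ : s * (1 - th) * (om * X) = om * (s * (X - z))); last by rewrite /z; ring.
  rewrite -!mulrDr; apply: ler_wpM2l => //; rewrite /lngap; lra.
have over' : om * lnover s X <= om * lnover s z + 3 * e.
  have : om * lnover s X <= om * (lnover s z - ln th) by apply: ler_wpM2l.
  by lra.
have /andP[s0 s1] := s01.
have sp : 0 <= (1 - s) * p by apply: mulr_ge0; lra.
pose d := 1 - Y - th * m ^+ 2; rewrite -/d in d0.
pose T2 := nu * phi + s * d + D1 + om * lngap s z.
have TT : T2 <= T + p + 3 * e.
  rewrite TE /T2 -m2 (_ : s * d = s - s * Y - s * (th * m ^+ 2)); last by rewrite /d; ring.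
  by move: gap lnt sp; clear; lra.
apply: (@le_trans _ _ (6 * e + 4 * p + 2010 * T2 + 3 * e)).
  rewrite [in leRHS]addrAC -!addrA; move: over'; set o1 := om * _; set o2 := om * lnover s z.
  suff : K1 + o2 <= 6 * e + 4 * p + 2010 * T2 by clear; lra.
  apply: (@row_scaled s p om z e nu W1 Y K1 D1 phi d) => //; first by rewrite Y0 Y1.
    by rewrite (_ : om * z = th * m ^+ 2); [rewrite /d in d0; lra|rewrite m2 /z; ring].
  have [hm|hm] := ltP m (1 - 1 / 5 * q); [left|right].
    have := main_deficit m0 q1' hm; rewrite q2 => h.
    have th1 : th = 1 by apply: dY; lra.
    by rewrite /d th1; lra.
  apply: le_trans h0; apply: ler_wpM2l => //.
  have Yq : Y <= 1 / 10 * q by rewrite -q2 expr2; apply: ler_wpM2r.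
  by lra.
by move: TT e0 p0; clear; lra.
Qed.

Lemma row_bound (N : nat) (S : pred 'I_N) (w x : 'I_N -> R) (s p e : R) :
  (forall i, 0 <= w i) -> (forall i, 0 <= x i) -> 0 < s < 1 -> 0 <= p -> 0 <= e ->
  p + \sum_(i | S i) w i <= 1 ->
  (499 / 500 <= \sum_(i | S i) w i * x i ->
   exists i, let Y := \sum_(k | S k && (k != i)) w k * x k in
   [/\ S i, Y <= 1 / 100, Num.sqrt (w i * x i) <= 10 / 9 &
     w i * Num.max 0 (Num.sqrt (w i * x i) + 3 / 10 * Num.sqrt Y - 1) <= e]) ->
  \sum_(i | S i) w i * lnover s (x i) <=
  2010 * (4 * (e + p) + ((1 - p) * - ln (1 - s) - \sum_(i | S i) w i * (- ln (1 - s) + lnstep s (x i)))).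
Proof.
move=> w0 x0 s01 p0 e0 row main; have /andP[s0 s1] := s01.
pose W := \sum_(i | S i) w i; rewrite -/W in row.
pose rho := \sum_(i | S i) w i * x i; rewrite -/rho in main.
pose D := \sum_(i | S i) w i * lngap s (x i).
have D0 : 0 <= D by apply: sumr_ge0 => i _; apply: mulr_ge0 => //; exact: lngap_ge0.
have rho0 : 0 <= rho by apply: sumr_ge0 => i _; apply: mulr_ge0.
pose phi := - ln (1 - s) - s; pose nu := 1 - p - W.
have phis : s ^+ 2 / 4 <= phi by rewrite /phi; have := @ln1B_le _ s; rewrite ltW//= s1 => /(_ isT); lra.
(* Expanding at the tangent separates the squared norm [rho]; only [s * (1 - p) - s * rho] can be
   negative. *)
have TE : (1 - p) * - ln (1 - s) - \sum_(i | S i) w i * (- ln (1 - s) + lnstep s (x i)) =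
    nu * phi + s * (1 - p) - s * rho + D.
  have -> : \sum_(i | S i) w i * (- ln (1 - s) + lnstep s (x i)) =
      W * (- ln (1 - s) - s) + s * rho - D.
    rewrite /W /rho /D mulr_suml mulr_sumr -big_split/= -sumrB; apply: eq_bigr => i _.
    by rewrite /lngap; ring.
  by rewrite /nu /phi; ring.
rewrite TE; set T := nu * phi + _ - _ + _.
have over_le i : lnover s (x i) <= s * x i.
  apply: le_trans (lnover_le s01 (x0 i)) _; rewrite ge_max; apply/andP; split; last by lra.
  by apply: mulr_ge0 => //; exact: ltW.
(* A short row leaves at least [s / 500 - s * p] in [T]. This suffices because the overshoot is at
   most [s * rho] and 2010/500 is larger than 1. *)
have [h|h] := ltP rho (499 / 500).
  have : \sum_(i | S i) w i * lnover s (x i) <= s * rho.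
    rewrite /rho mulr_sumr; apply: ler_sum => i _; rewrite mulrCA; exact: ler_wpM2l.
  have s20 : 0 <= s ^+ 2 / 4 by apply: divr_ge0; [exact: sqr_ge0|lra].
  have : 0 <= nu * phi by apply: mulr_ge0; [rewrite /nu; lra|exact: le_trans phis].
  have : 0 <= s * (499 / 500 - rho) by apply: mulr_ge0; lra.
  have : 0 <= (1 - s) * p by apply: mulr_ge0; lra.
  by rewrite /T; lra.
have [i] := main h; set Y := \sum_(k | S k && _) _ => -[Si Y1 m9 he].
rewrite (bigD1 i)//= addrC.
have Y0 : 0 <= Y by apply: sumr_ge0 => k _; apply: mulr_ge0.
have rhoE : rho = w i * x i + Y by rewrite /rho (bigD1 i).
have WE : W = w i + \sum_(k | S k && (k != i)) w k by rewrite /W (bigD1 i).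
have DE : D = w i * lngap s (x i) + \sum_(k | S k && (k != i)) w k * lngap s (x k).
  by rewrite /D (bigD1 i).
apply: (@row_with_main s p (w i) (x i) e nu (\sum_(k | S k && (k != i)) w k) Y _
  (\sum_(k | S k && (k != i)) w k * lngap s (x k)) phi) => //.
- by rewrite /nu; lra.
- exact: sumr_ge0.
- by rewrite Y0 Y1.
- by apply: sumr_ge0 => k _; apply: mulr_ge0 => //; exact: lngap_ge0.
- by rewrite /nu WE; ring.
- rewrite /Y mulr_sumr; apply: ler_sum => k _; rewrite mulrCA; exact: ler_wpM2l.
- move=> s5; rewrite mulr_sumr; apply: ler_sum => k _; rewrite mulrCA; apply: ler_wpM2l => //.
  by apply: lnover_gap => //; rewrite s0.
- move=> s5; rewrite /Y !mulr_sumr -big_split/=; apply: ler_sum => k _.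
  rewrite mulrCA [2 * _]mulrCA -mulrDr -[leLHS]mulr1; apply: ler_wpM2l => //.
  have Dk := lngap_ge0 s01 (x0 k); have xk := x0 k.
  have [h2|h2] := leP (x k) (1 / 2); last by lra.
  have : 1 / 400 <= lngap s (x k) by apply: lngap_far; rewrite ?s5 ?s1 ?xk ?h2.
  by lra.
- by lra.
- by rewrite /T rhoE DE; ring.
Qed.

End Row.

(** * Summation by parts and the row inequality for the potential *)

Section Balance.
Context {R : realType}.
Implicit Types (v g : nat -> R) (w : nat -> nat -> R).

Definition defect w (M : nat) : R := \sum_(i < M) (1 - \sum_(j < M) w j i).

(** The layer [g k - g k.+1] counts the pairs with [maxn i j <= k], that is, the corner of size
    [k.+1]. *)
Lemma abel_defect w g M :
  \sum_(i < M) (g i - g M) - \sum_(i < M) \sum_(j < M) w j i * (g (maxn i j) - g M) =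
  \sum_(k < M) (g k - g k.+1) * defect w k.+1.
Proof.
elim: M => [|M IH]; first by rewrite !big_ord0 subr0.
rewrite [RHS]big_ord_recr/= -IH.
have -> : \sum_(i < M) (g i - g M) = \sum_(i < M.+1) (g i - g M).
  by rewrite [RHS]big_ord_recr/= subrr addr0.
have -> : \sum_(i < M) \sum_(j < M) w j i * (g (maxn i j) - g M) =
          \sum_(i < M.+1) \sum_(j < M.+1) w j i * (g (maxn i j) - g M).
  rewrite [RHS]big_ord_recr/= [X in _ = _ + X]big1 ?addr0; last first.
    by move=> j _; rewrite (maxn_idPl _) ?subrr ?mulr0// -ltnS.
  apply: eq_bigr => i _; rewrite [RHS]big_ord_recr/= (maxn_idPr _) ?subrr ?mulr0 ?addr0//.
  exact: ltnW.
rewrite /defect mulr_sumr -sumrB -sumrB -big_split/=; apply: eq_bigr => i _.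
rewrite mulrBr mulr1 [_ * \sum_(j < M.+1) w j i]mulr_sumr.
have -> : \sum_(j < M.+1) w j i * (g (maxn i j) - g M.+1) =
    \sum_(j < M.+1) w j i * (g (maxn i j) - g M) + \sum_(j < M.+1) (g M - g M.+1) * w j i.
  by rewrite -big_split/=; apply: eq_bigr => j _; ring.
ring.
Qed.

(** The terms below [M0] are nonnegative and are dropped; the others telescope. *)
Lemma abel_lower w g M0 M k : (forall i j, 0 <= w j i) ->
  (forall i J, \sum_(j < J) w j i <= 1) -> (forall i, g i.+1 <= g i) ->
  0 <= k -> (forall m, (M0 <= m)%N -> k <= defect w m) ->
  k * (g (minn M0 M) - g M) <= \sum_(l < M) (g l - g l.+1) * defect w l.+1.
Proof.
move=> w0 wc gm k0 hk; elim: M => [|M IH]; first by rewrite minn0 subrr mulr0 big_ord0.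
rewrite big_ord_recr/=; have gM : 0 <= g M - g M.+1 by rewrite subr_ge0.
have p0 : 0 <= defect w M.+1 by apply: sumr_ge0 => i _; rewrite subr_ge0.
have [h|h] := leqP M0 M.
  rewrite (minn_idPl (leq_trans h (leqnSn M))); rewrite (minn_idPl h) in IH.
  have : (g M - g M.+1) * k <= (g M - g M.+1) * defect w M.+1.
    by apply: ler_wpM2l => //; apply: hk; exact: leq_trans h _.
  by move: IH; clear; lra.
rewrite (minn_idPr h) subrr mulr0; apply: addr_ge0; last exact: mulr_ge0.
by apply: sumr_ge0 => l _; apply: mulr_ge0; rewrite ?subr_ge0//; apply: sumr_ge0 => i _; rewrite subr_ge0.
Qed.

Lemma ln_quot_le (x y t : R) : 0 < x -> 0 < y -> 0 < t -> y <= x ->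
  ln (1 + x / t) - ln (1 + y / t) <= ln (x / y).
Proof.
move=> x0 y0 t0 yx; have xt : 0 < x / t by rewrite divr_gt0.
have yt : 0 < y / t by rewrite divr_gt0.
have p1 : 0 < 1 + x / t by rewrite addr_gt0.
have p2 : 0 < 1 + y / t by rewrite addr_gt0.
have p3 : 0 < x / y by rewrite divr_gt0.
have p4 : 0 < x / y * (1 + y / t) by exact: mulr_gt0.
rewrite lerBlDr -lnM ?posrE// ler_ln ?posrE//.
have -> : x / y * (1 + y / t) = x / y + x / t by field; rewrite !gt_eqF.
by rewrite lerD2r ler_pdivlMr// mul1r.
Qed.


Lemma potential_row (x y t : R) : 0 < x -> 0 < y -> 0 < t ->
  [/\ 0 < y / (y + t) < 1, - ln (1 - y / (y + t)) = ln (1 + y / t) &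
      ln (1 + y / t) + lnstep (y / (y + t)) (x / y) = ln (1 + x / t)].
Proof.
move=> x0 y0 t0; have yt : 0 < y + t by rewrite addr_gt0.
have e1 : 1 - y / (y + t) = (1 + y / t)^-1.
  by field; rewrite !gt_eqF// ?addr_gt0// [X in _ < X]addrC.
have p1 : 0 < 1 + y / t by rewrite addr_gt0// divr_gt0.
have p2 : 0 < 1 + x / t by rewrite addr_gt0// divr_gt0.
split.
- by rewrite divr_gt0//= ltr_pdivrMr// mul1r ltrDl.
- by rewrite e1 lnV ?opprK// posrE.
- rewrite /lnstep.
  have -> : 1 + y / (y + t) * (x / y - 1) = (1 + x / t) / (1 + y / t).
    by field; rewrite !gt_eqF// ?addr_gt0// [X in _ < X]addrC.
  by rewrite ln_div ?posrE// addrC subrK.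
Qed.

(** Only the columns from [n] on are considered: there the box has full sides, so the squared entry
    of the row is [w j i * (v i / v j)]. *)
Definition row_main w v (n N : nat) (e : nat -> R) (j : nat) : Prop :=
  499 / 500 <= \sum_(i < N | (n <= i)%N) w j i * (v i / v j) ->
  exists i : 'I_N, let Y := \sum_(k < N | (n <= k)%N && (k != i)) w j k * (v k / v j) in
  [/\ (n <= i)%N, Y <= 1 / 100, Num.sqrt (w j i * (v i / v j)) <= 10 / 9 &
     w j i * Num.max 0 (Num.sqrt (w j i * (v i / v j)) + 3 / 10 * Num.sqrt Y - 1) <= e j].

Lemma row_potential w v n N (e : nat -> R) j (t : R) g : (n <= N)%N ->
  (forall i, 0 < v i) -> (forall i j, 0 <= w j i) -> 0 < t -> 0 <= e j ->
  \sum_(i < N) w j i <= 1 -> row_main w v n N e j ->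
  (forall i, g i = ln (1 + v i / t)) ->
  \sum_(i < N) w j i * Num.max 0 (g i - Num.max (g j) (ln 2)) <=
  2010 * (g j - \sum_(i < N) w j i * g i) + 8040 * (e j + \sum_(i < n) w j i) +
  2011 * \sum_(i < n) w j i * Num.max 0 (g i - g j).
Proof.
move=> nN v0 w0 t0 e0 row hm gE.
have g0 i : 0 <= g i by rewrite gE ln_ge0// lerDl divr_ge0// ltW.
have low (F : nat -> R) : \sum_(i < N | ~~ (n <= i)%N) F i = \sum_(i < n) F i.
  rewrite (big_ord_widen N F nN); apply: eq_bigl => i; by rewrite -ltnNge.
have split_ (F : nat -> R) : \sum_(i < N) F i = \sum_(i < n) F i + \sum_(i < N | (n <= i)%N) F i.
  by rewrite (bigID (fun i : 'I_N => (n <= i)%N))/= addrC low.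
have [s01 sg _] := potential_row (v0 j) (v0 j) t0.
set s := v j / (v j + t) in s01 sg.
have p0 : 0 <= \sum_(i < n) w j i by exact: sumr_ge0.
have := @row_bound _ N (fun i => (n <= i)%N) (fun i => w j i) (fun i => v i / v j) s
  (\sum_(i < n) w j i) (e j) (fun i => w0 i j) (fun i => ltW (divr_gt0 (v0 i) (v0 j))) s01 p0 e0.
rewrite -split_ => /(_ row hm); rewrite sg -gE.
have -> : \sum_(i < N | (n <= i)%N) w j i * (g j + lnstep s (v i / v j)) =
    \sum_(i < N | (n <= i)%N) w j i * g i.
  by apply: eq_bigr => i _; have [_ _ e1] := potential_row (v0 i) (v0 j) t0; rewrite -!gE in e1; rewrite e1.
have over i : lnover s (v i / v j) = Num.max 0 (g i - Num.max (g j) (ln 2)).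
  have [_ _ e1] := potential_row (v0 i) (v0 j) t0; rewrite -!gE in e1.
  have -> : lnover s (v i / v j) = Num.max 0 (g i - g j - Num.max 0 (ln 2 - g j)).
    rewrite /lnover (_ : lnstep s _ = g i - g j); last by rewrite -e1 addrC addKr.
    by rewrite -[ln (1 - s)]opprK sg -gE.
  congr Num.max; have [h|h] := leP (g j) (ln 2).
    by rewrite max_r ?subr_ge0//; ring.
  by rewrite max_l ?subr0// subr_le0 ltW.
under eq_bigr do rewrite over.
rewrite (split_ (fun i => w j i * Num.max 0 (g i - Num.max (g j) (ln 2)))).
rewrite (split_ (fun i => w j i * g i)).
have h1 : \sum_(i < n) w j i * Num.max 0 (g i - Num.max (g j) (ln 2)) <=
    \sum_(i < n) w j i * Num.max 0 (g i - g j).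
  apply: ler_sum => i _; apply: ler_wpM2l => //; rewrite ge_max !le_max lexx/=.
  by apply/orP; right; rewrite lerB// le_max lexx.
have h2 : \sum_(i < n) w j i * g i <=
    (\sum_(i < n) w j i) * g j + \sum_(i < n) w j i * Num.max 0 (g i - g j).
  rewrite mulr_suml -big_split/=; apply: ler_sum => i _; rewrite -mulrDr.
  by apply: ler_wpM2l => //; rewrite -lerBlDl le_max lexx orbT.
move: h1 h2.
set X1 := \sum_(i < n) _; set X2 := \sum_(i < n) w j i * Num.max 0 (g i - g j).
set X3 := \sum_(i < N | _) _ * Num.max _ _; set X4 := \sum_(i < n) w j i.
set X5 := \sum_(i < n) w j i * g i; set X6 := \sum_(i < N | _) w j i * g i.
by clear; set G := g j; lra.
Qed.

End Balance.

(** * Upper and lower bounds for the total overshoot *)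

Section Small.
Context {R : realType}.
Variables (v : nat -> R) (w : nat -> nat -> R) (n : nat).
Hypothesis v0 : forall i, 0 < v i.
Hypothesis vm : forall i j, (i <= j)%N -> v j <= v i.
Hypothesis v_tail : forall e : R, 0 < e -> exists N0, forall N J, (N0 <= N)%N ->
  \sum_(N <= j < J) v j <= e.
Hypothesis w0 : forall i j, 0 <= w j i.
Hypothesis wc : forall i J, \sum_(j < J) w j i <= 1.
Hypothesis wl : forall i (e : R), 0 < e -> exists J0, forall J, (J0 <= J)%N ->
  1 - e <= \sum_(j < J) w j i.
Hypothesis wr : forall j N, \sum_(i < N) w j i <= 1.

Section Scale.
Variables (t : R) (g : nat -> R).
Hypothesis t0 : 0 < t.
Hypothesis gE : forall i, g i = ln (1 + v i / t).

Lemma g_ge0 i : 0 <= g i.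
Proof. by rewrite gE ln_ge0// lerDl divr_ge0// ltW. Qed.

Lemma g_mono i j : (i <= j)%N -> g j <= g i.
Proof.
move=> ij; rewrite !gE ler_ln ?posrE ?addr_gt0 ?divr_gt0// lerD2l.
by rewrite ler_pM2r ?invr_gt0// vm.
Qed.

Lemma g_le i : g i <= v i / t.
Proof.
have vt : 0 < v i / t by rewrite divr_gt0.
by rewrite gE; apply: ln1D_le; lra.
Qed.

Lemma far_column i J J0 (e : R) : (forall J, (J0 <= J)%N -> 1 - e <= \sum_(j < J) w j i) ->
  \sum_(j < J) (if (J0 <= j)%N then w j i else 0) <= e.
Proof.
move=> h; have := wc i (maxn J J0); have := h J0 (leqnn _).
set S := \sum_(j < J) _; have hS : S <= \sum_(j < maxn J J0) (if (J0 <= j)%N then w j i else 0).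
  rewrite /S (big_ord_widen _ (fun j => if (J0 <= j)%N then w j i else 0) (leq_maxl J J0)).
  by rewrite [leRHS](bigID (fun j : 'I__ => (j < J)%N))/= lerDl sumr_ge0// => j _; case: ifP.
have -> : \sum_(j < maxn J J0) w j i =
    \sum_(j < J0) w j i + \sum_(j < maxn J J0) (if (J0 <= j)%N then w j i else 0).
  rewrite (big_ord_widen _ (fun j => w j i) (leq_maxr J J0)) (big_mkcond (fun j : 'I__ => (j < J0)%N)).
  by rewrite -big_split/=; apply: eq_bigr => j _; rewrite ltnNge; case: leqP; rewrite ?addr0 ?add0r.
by move: hS; lra.
Qed.

(** In the rows below [J0] the increase is at most [ln (v 0 / v J0)], whatever [t] is; the rows from
    [J0] on have weight at most [e], and the increase is at most [g 0]. *)
Lemma near_column i J J0 (e : R) : (forall J, (J0 <= J)%N -> 1 - e <= \sum_(j < J) w j i) ->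
  \sum_(j < J) w j i * Num.max 0 (g i - g j) <= ln (v 0 / v J0) + e * g 0.
Proof.
move=> h; set C0 := ln _.
have C00 : 0 <= C0 by rewrite ln_ge0// ler_pdivlMr// mul1r vm.
apply: (@le_trans _ _ (\sum_(j < J) (w j i * C0 + (if (J0 <= j)%N then w j i else 0) * g 0))).
  apply: ler_sum => j _; case: leqP => hj.
    rewrite -mulrDr; apply: ler_wpM2l => //; rewrite ge_max; apply/andP; split.
      by rewrite addr_ge0// g_ge0.
    have := g_mono (leq0n i); have := g_ge0 j; move: C00; lra.
  rewrite mul0r addr0; apply: ler_wpM2l => //; rewrite ge_max C00/=.
  have [hv|hv] := leP (v j) (v i).
    rewrite !gE; apply: le_trans (ln_quot_le (v0 i) (v0 j) t0 hv) _.
    rewrite ler_ln ?posrE ?divr_gt0//; apply: ler_pM; rewrite ?invr_ge0 ?(ltW (v0 _))//.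
      exact: vm.
    by rewrite lef_pV2 ?posrE//; apply: vm; exact: ltnW.
  have ij : (j <= i)%N by rewrite leqNgt; apply/negP => /ltnW /vm; rewrite leNgt hv.
  by have := g_mono ij; move: C00; lra.
rewrite big_split/= -!mulr_suml lerD//.
  by rewrite -[leRHS]mul1r; apply: ler_wpM2r => //; exact: wc.
by apply: ler_wpM2r; [exact: g_ge0|exact: far_column].
Qed.

Lemma potential_upper M J0 (eta : R) :
  (forall i J, (i < n)%N -> (J0 <= J)%N -> 1 - eta <= \sum_(j < J) w j i) ->
  (forall N J, (n <= N)%N -> exists e : nat -> R, [/\ forall j, 0 <= e j,
     \sum_(j < J) e j <= 1 & forall j, (j < J)%N -> row_main w v n N e j]) ->
  exists N J, [/\ (M <= N)%N, (M <= J)%N,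
    \sum_(i < N) g i * (1 - \sum_(j < J) w j i) <= 1 &
    \sum_(j < J) \sum_(i < N) w j i * Num.max 0 (g i - Num.max (g j) (ln 2)) <=
    4020 + 8040 * (1 + n%:R) + 2011 * (n%:R * (ln (v 0 / v J0) + eta * g 0))].
Proof.
move=> hJ0 key; have [N0 hN0] := v_tail t0.
(* Beyond [N0] the sum of [v j] is at most [t], hence that of [g j] at most 1. *)
pose N := maxn M (maxn n N0).
have e0 : 0 < ((N%:R + 1) * (g 0 + 1))^-1.
  by rewrite invr_gt0 mulr_gt0// ltr_wpDl// ?g_ge0.
have [J1 J1P] : exists J1, forall i J, (i < N)%N -> (J1 <= J)%N ->
    1 - ((N%:R + 1) * (g 0 + 1))^-1 <= \sum_(j < J) w j i.
  have /choice[h hP] := fun i => wl i e0.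
  exists (\max_(i < N) h i) => i J iN hJ; apply: hP; apply: leq_trans hJ.
  exact: (leq_bigmax (Ordinal iN)).
(* [J] is taken after [N], so that the first [N] columns have nearly all their mass in the first [J]
   rows. *)
pose J := maxn N J1.
have nN : (n <= N)%N by rewrite /N !leq_max leqnn orbT.
have small : \sum_(i < N) g i * (1 - \sum_(j < J) w j i) <= 1.
  apply: (@le_trans _ _ (\sum_(i < N) (N%:R + 1)^-1)).
    apply: ler_sum => i _.
    have : 1 - \sum_(j < J) w j i <= ((N%:R + 1) * (g 0 + 1))^-1.
      by have := J1P i J (ltn_ord i) (leq_maxr _ _); lra.
    have p : 0 <= 1 - \sum_(j < J) w j i by rewrite subr_ge0.
    have gg : g i <= g 0 + 1 by have := g_mono (leq0n i); lra.
    move=> h; apply: le_trans (ler_pM (g_ge0 i) p gg h) _.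
    by rewrite invfM mulrCA divff ?mulr1// gt_eqF// ltr_wpDl// g_ge0.
  rewrite sumr_const card_ord (_ : (N%:R + 1)^-1 *+ N = N%:R / (N%:R + 1)); last by rewrite mulr_natl.
  by rewrite ler_pdivrMr ?ltr_wpDl// mul1r lerDl.
exists N, J; split => //; [by rewrite /N leq_max leqnn|by rewrite /J /N !leq_max leqnn|].
have [e [e_ge0 e_le rows]] := key N J nN.
apply: (@le_trans _ _ (\sum_(j < J) (2010 * (g j - \sum_(i < N) w j i * g i) +
   8040 * (e j + \sum_(i < n) w j i) + 2011 * \sum_(i < n) w j i * Num.max 0 (g i - g j)))).
  by apply: ler_sum => j _; apply: (row_potential nN v0 w0 t0) => //; exact: rows.
have -> : \sum_(j < J) (2010 * (g j - \sum_(i < N) w j i * g i) +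
   8040 * (e j + \sum_(i < n) w j i) + 2011 * \sum_(i < n) w j i * Num.max 0 (g i - g j)) =
  2010 * (\sum_(j < J) g j - \sum_(i < N) \sum_(j < J) w j i * g i) +
  8040 * (\sum_(j < J) e j + \sum_(i < n) \sum_(j < J) w j i) +
  2011 * \sum_(i < n) \sum_(j < J) w j i * Num.max 0 (g i - g j).
  rewrite ![\sum_(i < _) \sum_(j < J) _]exchange_big/= -sumrB -big_split/=.
  by rewrite !mulr_sumr -!big_split/=; apply: eq_bigr => j _; rewrite !mulr_sumr.
(* The two potential sums cancel up to 1 for the rows from [N] on and 1 for the missing mass of the
   columns. *)
have h1 : \sum_(j < J) g j - \sum_(i < N) \sum_(j < J) w j i * g i <= 2.
  have -> : \sum_(j < J) g j = \sum_(j < N) g j + \sum_(N <= j < J) g j.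
    by rewrite -!(big_mkord xpredT) -big_cat_nat//= leq_maxl.
  have : \sum_(N <= j < J) g j <= 1.
    apply: (@le_trans _ _ (\sum_(N <= j < J) v j / t)).
      by apply: ler_sum => j _; exact: g_le.
    rewrite -mulr_suml ler_pdivrMr// mul1r; apply: hN0.
    by rewrite /N !leq_max leqnn !orbT.
  have : \sum_(i < N) g i * (1 - \sum_(j < J) w j i) =
      \sum_(i < N) g i - \sum_(i < N) \sum_(j < J) w j i * g i.
    by rewrite -sumrB; apply: eq_bigr => i _; rewrite mulrBr mulr1 -mulr_suml mulrC.
  by move: small; lra.
have h2 : \sum_(i < n) \sum_(j < J) w j i <= n%:R.
  rewrite -[leRHS]mulr1 mulr_natl -[in leRHS](card_ord n) -sumr_const; apply: ler_sum => i _; exact: wc.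
have h3 : \sum_(i < n) \sum_(j < J) w j i * Num.max 0 (g i - g j) <=
    n%:R * (ln (v 0 / v J0) + eta * g 0).
  rewrite mulr_natl -[in leRHS](card_ord n) -sumr_const; apply: ler_sum => i _.
  by apply: near_column => K; exact: hJ0.
by move: h1 h2 h3 e_le; lra.
Qed.

(** With [t = v M] one has [g M = ln 2], so the truncation replaces [g j] by [g M] in the rows
    [j >= M]. The overshoot then dominates the left side of [abel_defect], up to the missing column
    mass. *)
Lemma potential_lower M0 M N J (k : R) : 0 <= k -> (forall m, (M0 <= m)%N -> k <= defect w m) ->
  t = v M -> (M <= N)%N -> (M <= J)%N ->
  \sum_(i < N) g i * (1 - \sum_(j < J) w j i) <= 1 ->
  k * (g (minn M0 M) - g M) - 1 <=
  \sum_(j < J) \sum_(i < N) w j i * Num.max 0 (g i - Num.max (g j) (ln 2)).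
Proof.
move=> k0 hk tE MN MJ small.
have gM : g M = ln 2 by rewrite gE tE divff ?gt_eqF//; congr ln; ring.
have := abel_lower M w0 wc (fun i => g_mono (leqnSn i)) k0 hk.
rewrite -abel_defect => h.
have ge0 i j : 0 <= w j i * Num.max 0 (g i - Num.max (g j) (ln 2)).
  by apply: mulr_ge0 => //; rewrite le_max lexx.
apply: (@le_trans _ _ (\sum_(i < M) \sum_(j < J) w j i * Num.max 0 (g i - Num.max (g j) (ln 2)))); last first.
  rewrite exchange_big/=; apply: ler_sum => j _.
  rewrite (big_ord_widen _ (fun i => w j i * Num.max 0 (g i - Num.max (g j) (ln 2))) MN).
  by rewrite [leRHS](bigID (fun i : 'I_N => (i < M)%N))/= lerDl sumr_ge0.
have col (i : 'I_M) : (g i - g M) * (\sum_(j < J) w j i) - \sum_(j < M) w j i * (g (maxn i j) - g M) <=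
    \sum_(j < J) w j i * Num.max 0 (g i - Num.max (g j) (ln 2)).
  have giM : g M <= g i by apply: g_mono; exact: ltnW.
  rewrite (big_ord_widen _ (fun j => w j i * (g (maxn i j) - g M)) MJ) [X in _ - X]big_mkcond/=.
  rewrite mulr_sumr -sumrB; apply: ler_sum => j _; case: ifPn => jM.
    rewrite mulrC -mulrBr; apply: ler_wpM2l => //.
    have gj : ln 2 <= g j by rewrite -gM; apply: g_mono; exact: ltnW.
    rewrite (max_l gj) le_max; have [ij|ij] := leqP i j.
      by apply/orP; right; lra.
    by apply/orP; left; lra.
  rewrite subr0 mulrC; apply: ler_wpM2l => //.
  have gj : g j <= ln 2 by rewrite -gM; apply: g_mono; rewrite leqNgt.
  by rewrite (max_r gj) gM le_max lexx orbT.
apply: le_trans (ler_sum _ (fun i _ => col i)).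
rewrite sumrB; apply: le_trans (lerB h (lexx 1)) _.
rewrite -addrA [_ - 1]addrC addrA lerB//.
have : \sum_(i < M) (g i - g M) - \sum_(i < M) (g i - g M) * (\sum_(j < J) w j i) <= 1.
  rewrite -sumrB; apply: le_trans small.
  rewrite (big_ord_widen _ (fun i => (g i - g M) - (g i - g M) * \sum_(j < J) w j i) MN).
  rewrite [leRHS](bigID (fun i : 'I_N => (i < M)%N))/=.
  rewrite -[leLHS]addr0; apply: lerD; last first.
    by apply: sumr_ge0 => i _; apply: mulr_ge0; [exact: g_ge0|rewrite subr_ge0; exact: wc].
  apply: ler_sum => i _; rewrite -[X in X - _]mulr1 -mulrBr; apply: ler_wpM2r.
    by rewrite subr_ge0; exact: wc.
  by rewrite lerBlDr lerDl; exact: g_ge0.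
by lra.
Qed.

End Scale.

(** If the defect stayed above [k], the lower bound would grow like [k * g 0] as [t] tends to 0, and
    the upper bound at most like [k / 2 * g 0]. *)
Lemma defect_small :
  (forall N J, (n <= N)%N -> exists e : nat -> R, [/\ forall j, 0 <= e j,
     \sum_(j < J) e j <= 1 & forall j, (j < J)%N -> row_main w v n N e j]) ->
  forall (k : R) M0, 0 < k -> exists2 M, (M0 <= M)%N & defect w M <= k.
Proof.
move=> key k M0 k0; apply: contrapT => hno.
have hk m : (M0 <= m)%N -> k <= defect w m.
  by move=> hm; rewrite leNgt; apply/negP => h; apply: hno; exists m => //; exact: ltW.
pose c : R := 4022 * (n%:R + 1).
have n1 : 0 < (n%:R + 1 : R) by rewrite ltr_wpDl.
have c0 : 0 < c by apply: mulr_gt0; [rewrite ltr0n|exact: n1].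
(* Chosen so that [2011 * n%:R * eta <= k / 2]. *)
pose eta := k / c; have eta0 : 0 < eta by rewrite divr_gt0.
have [J0 J0P] : exists J0, forall i J, (i < n)%N -> (J0 <= J)%N -> 1 - eta <= \sum_(j < J) w j i.
  have /choice[h hP] := fun i => wl i eta0.
  exists (\max_(i < n) h i) => i J iN hJ; apply: hP; apply: leq_trans hJ.
  exact: (leq_bigmax (Ordinal iN)).
(* [A] collects the terms that do not depend on [t]; [M] will be so large that [g 0 >= X]. *)
pose A := 4020 + 8040 * (1 + n%:R) + 2011 * (n%:R * ln (v 0 / v J0)) + 1 +
  k * (ln (v 0 / v M0) + ln 2).
pose X := 2 / k * (A + 1).
have [N1 N1P] := v_tail (mulr_gt0 (v0 0) (expR_gt0 (- X))).
pose M := maxn M0 N1; pose t := v M; have t0 : 0 < t := v0 M.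
pose g i := ln (1 + v i / t); have gE i : g i = ln (1 + v i / t) by [].
have XL : X <= g 0.
  have vM : t <= v 0 * expR (- X).
    by have := N1P M M.+1 (leq_maxr _ _); rewrite big_nat1.
  rewrite gE -[X]expRK ler_ln ?posrE ?expR_gt0 ?addr_gt0 ?divr_gt0//.
  apply: (@le_trans _ _ (v 0 / t)); last by rewrite lerDr.
  by rewrite ler_pdivlMr// -ler_pdivlMl ?expR_gt0// -expRN mulrC.
have [N [J [MN MJ small up]]] := potential_upper t0 gE M J0P key.
have lo := potential_lower t0 gE (ltW k0) hk erefl MN MJ small.
have := le_trans lo up; rewrite (minn_idPl (leq_maxl _ _)).
have gM : g M = ln 2 by rewrite gE /t divff ?gt_eqF//; congr ln; ring.
have gM0 : g 0 - ln (v 0 / v M0) <= g M0.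
  by rewrite lerBlDr -lerBlDl !gE; exact: ln_quot_le (v0 0) (v0 M0) t0 (vm (leq0n M0)).
rewrite gM; have kg : k * (g 0 - ln (v 0 / v M0)) <= k * g M0 by apply: ler_wpM2l => //; exact: ltW.
have g00 : 0 <= g 0 by exact: g_ge0.
have ne : 2011 * (n%:R * (eta * g 0)) <= k / 2 * g 0.
  rewrite (_ : 2011 * (n%:R * (eta * g 0)) = 2011 * n%:R * (k / (4022 * (n%:R + 1))) * g 0); last by rewrite /eta /c; ring.
  apply: ler_wpM2r; first exact: g00.
  have n0 : 0 <= (n%:R : R) by exact: ler0n.
  have -> : 2011 * n%:R * (k / (4022 * (n%:R + 1))) = (n%:R / (n%:R + 1)) * (k / 2).
    by field; rewrite gt_eqF.
  rewrite -[leRHS]mul1r; apply: ler_wpM2r; first by rewrite divr_ge0// ltW.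
  by rewrite ler_pdivrMr ?ltr_wpDl// mul1r lerDl.
have : k / 2 * X <= k / 2 * g 0 by apply: ler_wpM2l => //; rewrite divr_ge0// ltW.
have -> : k / 2 * X = A + 1 by rewrite /X; field; rewrite gt_eqF.
rewrite /A; lra.
Qed.

End Small.

(** * Linear structure of a congruence *)

Section Sums.
Context {R : realType}.
Implicit Types (f g : nat -> R).

Definition sums f (l : R) := series f @ \oo --> l.

Lemma sums_ext f g l : f =1 g -> sums f l -> sums g l.
Proof. by move=> /funext ->. Qed.

Lemma sumsD f g l m : sums f l -> sums g m -> sums (fun j => f j + g j) (l + m).
Proof.
move=> hf hg; rewrite /sums (_ : series _ = series f \+ series g); first exact: cvgD.
by apply/funext => n; rewrite !seriesEord/= big_split.
Qed.

Lemma sumsZ (c : R) f l : sums f l -> sums (fun j => c * f j) (c * l).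
Proof.
move=> hf; rewrite /sums (_ : series _ = (fun n => c * series f n)); first exact: (cvgM (cvg_cst c) hf).
by apply/funext => n; rewrite !seriesEord/= mulr_sumr.
Qed.

Arguments sumsZ c {f l} _.

Lemma sumsB f g l m : sums f l -> sums g m -> sums (fun j => f j - g j) (l - m).
Proof.
move=> hf hg; have := sumsD hf (sumsZ (-1) hg); rewrite mulN1r.
by apply: sums_ext => j; rewrite mulN1r.
Qed.

Lemma sums_sum N (F : nat -> nat -> R) (l : nat -> R) :
  (forall i, (i < N)%N -> sums (F i) (l i)) ->
  sums (fun j => \sum_(i < N) F i j) (\sum_(i < N) l i).
Proof.
elim: N => [_|N IH h].
  rewrite big_ord0; apply: (@sums_ext (fun j => 0 * 0)); first by move=> j; rewrite big_ord0 mul0r.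
  rewrite /sums (_ : series _ = cst 0); first exact: cvg_cst.
  by apply/funext => n; rewrite seriesEord/= big1// => i _; rewrite mul0r.
rewrite big_ord_recr/=; apply: (@sums_ext (fun j => \sum_(i < N) F i j + F N j)).
  by move=> j; rewrite big_ord_recr.
by apply: sumsD; [apply: IH => i iN; apply: h; exact: leqW|exact: h].
Qed.

Lemma sums_unique f l m : sums f l -> sums f m -> l = m.
Proof. by move=> h1 h2; apply: (@cvg_unique _ (@Rhausdorff R)) h1 h2. Qed.

Lemma sums_ge f l n : (forall j, 0 <= f j) -> sums f l -> \sum_(j < n) f j <= l.
Proof.
move=> f0 h; have := @nondecreasing_cvgn_le R (series f).
move/(_ (nondecreasing_series (fun j _ _ => f0 j))) => H.
have := H (cvgP _ h) n; rewrite (cvg_lim _ h)//.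
by rewrite seriesEord.
Qed.

Lemma sums_term_le f l j : (forall j, 0 <= f j) -> sums f l -> f j <= l.
Proof.
move=> f0 /(sums_ge j.+1 f0); rewrite big_ord_recr/=; apply: le_trans.
by rewrite lerDr; apply: sumr_ge0 => i _.
Qed.

Lemma sums_finite f N : (forall j, (N <= j)%N -> f j = 0) -> sums f (\sum_(j < N) f j).
Proof.
move=> h; apply: cvg_near_cst; exists N => // n /= Nn; rewrite seriesEord/=.
rewrite (big_ord_widen _ f Nn) [in LHS](bigID (fun j : 'I_n => (j < N)%N))/=.
by rewrite [X in _ + X]big1 ?addr0// => j; rewrite -leqNgt => /h.
Qed.

Lemma sums_near_one f l (e : R) : sums f l -> 0 < e ->
  exists J0, forall J, (J0 <= J)%N -> l - e <= \sum_(j < J) f j.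
Proof.
move=> h e0; have /cvgrPdist_le/(_ e e0)[J0 _ J0P] := h.
exists J0 => J hJ; have := J0P J hJ; rewrite /= seriesEord/= ler_norml => /andP[_].
by lra.
Qed.

Variable u : nat -> nat -> R.
Hypothesis u_orth : forall i k, sums (fun j => u j i * u j k) (i == k)%:R.

Lemma sums_comb N (c : nat -> R) :
  sums (fun j => (\sum_(i < N) u j i * c i) ^+ 2) (\sum_(i < N) c i ^+ 2).
Proof.
apply: (@sums_ext (fun j => \sum_(i < N) \sum_(k < N) (c i * c k) * (u j i * u j k))).
  move=> j; rewrite expr2 mulr_suml; apply: eq_bigr => i _.
  by rewrite mulr_sumr; apply: eq_bigr => k _; ring.
rewrite (_ : \sum_(i < N) c i ^+ 2 = \sum_(i < N) \sum_(k < N) (c i * c k) * (i == k :> nat)%:R).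
  apply: (@sums_sum N (fun i j => \sum_(k < N) c i * c k * (u j i * u j k))
    (fun i => \sum_(k < N) c i * c k * (i == k :> nat)%:R)) => i _.
  apply: (@sums_sum N (fun k j => c i * c k * (u j i * u j k))
    (fun k => c i * c k * (i == k :> nat)%:R)) => k _.
  by apply: sumsZ; exact: u_orth.
apply: eq_bigr => i _; rewrite (bigD1 i)//= eqxx mulr1 big1 ?addr0// => k ki.
by rewrite (_ : (i == k :> nat) = false) ?mulr0//; apply/negbTE; rewrite eq_sym.
Qed.

(** With [S] the sum in question, [S ^+ 2] is the [j]-th term of a nonnegative series with sum [S],
    so [S ^+ 2 <= S]. *)
Lemma bessel j N : \sum_(i < N) u j i ^+ 2 <= 1.
Proof.
set S := \sum_(i < N) _; have S0 : 0 <= S by apply: sumr_ge0 => i _; exact: sqr_ge0.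
have h : (\sum_(i < N) u j i * u j i) ^+ 2 <= S.
  have hs : sums (fun m => (\sum_(i < N) u m i * u j i) ^+ 2) S by exact: sums_comb.
  pose F m := (\sum_(i < N) u m i * u j i) ^+ 2.
  have F0 m : 0 <= F m by exact: sqr_ge0.
  exact: (@sums_term_le F S j F0 hs).
rewrite (_ : \sum_(i < N) u j i * u j i = S) in h; last exact: eq_bigr.
rewrite leNgt; apply/negP => S1.
have : S * 1 < S * S by rewrite ltr_pM2l//; lra.
by rewrite -expr2 mulr1 ltNge h.
Qed.

(** The case of equality in Bessel's inequality: the squared distance from [y] to the combination of
    columns is 0. *)
Lemma expansion N (y xi : nat -> R) : sums (fun j => y j ^+ 2) (\sum_(i < N) xi i ^+ 2) ->
  (forall i, (i < N)%N -> sums (fun j => y j * u j i) (xi i)) ->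
  forall j, y j = \sum_(i < N) u j i * xi i.
Proof.
move=> y2 yu j; apply/eqP; rewrite -subr_eq0 -sqrf_eq0 eq_le sqr_ge0 andbT.
have h : sums (fun j => (y j - \sum_(i < N) u j i * xi i) ^+ 2) 0.
  have := sumsD (sumsB y2 (sumsZ 2 (@sums_sum N (fun i j => xi i * (y j * u j i))
    (fun i => xi i * xi i) (fun i iN => sumsZ (xi i) (yu i iN))))) (@sums_comb N xi).
  rewrite (_ : \sum_(i < N) xi i ^+ 2 - _ + _ = 0) => [|]; last first.
    by rewrite (eq_bigr (fun i : 'I_N => xi i ^+ 2)) => [|//]; ring.
  apply: sums_ext => k.
  rewrite (_ : \sum_(i < N) xi i * (y k * u k i) = y k * \sum_(i < N) u k i * xi i); first by ring.
  by rewrite mulr_sumr; apply: eq_bigr => i _; ring.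
pose F m := (y m - \sum_(i < N) u m i * xi i) ^+ 2.
have F0 m : 0 <= F m by exact: sqr_ge0.
exact: (@sums_term_le F 0 j F0 h).
Qed.

End Sums.
Arguments sumsZ {R} c {f l} _.

(** * Inner products under a congruence *)

Section Congruence.
Context {R : realType}.
Local Notation W := (Romega R).
Variable a : nat -> R.
Hypothesis a_gt0 : forall i, 0 < a i.
Hypothesis a_sum : cvgn (series (fun i : nat => a i ^+ 2)).

Lemma sums_dist (x y : W) : @hilbert_cube R x -> @hilbert_cube R y ->
  sums (fun j => a j ^+ 2 * (x j - y j) ^+ 2) (dist_a a x y ^+ 2).
Proof.
move=> Kx Ky; have h0 j : 0 <= a j ^+ 2 * (x j - y j) ^+ 2 by rewrite mulr_ge0 ?sqr_ge0.
have c : cvgn (series (fun j => a j ^+ 2 * (x j - y j) ^+ 2)).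
  apply: series_le_cvg a_sum => // j; first exact: sqr_ge0.
  rewrite -[leRHS]mulr1; apply: ler_wpM2l; first exact: sqr_ge0.
  have := Kx j; have := Ky j; rewrite !in_itv/= => /andP[y0 y1] /andP[x0 x1].
  by rewrite -real_normK ?num_real// expr_le1// ler_norml; apply/andP; split; lra.
have l0 : 0 <= limn (series (fun j => a j ^+ 2 * (x j - y j) ^+ 2)).
  by have := sums_ge 0 h0 c; rewrite big_ord0.
by rewrite /dist_a sqr_sqrtr.
Qed.

Variables (B : set W) (sigma : W -> W).
Hypothesis cong : congruence a B sigma.

(** Inner products of differences are combinations of squared distances between the four points,
    which a congruence preserves. *)
Lemma polarize (x y x' y' : W) :
  @hilbert_cube R x -> @hilbert_cube R y -> @hilbert_cube R x' -> @hilbert_cube R y' ->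
  sums (fun j => a j ^+ 2 * ((x j - y j) * (x' j - y' j)))
    (1 / 2 * (dist_a a x y' ^+ 2 + dist_a a y x' ^+ 2 - dist_a a x x' ^+ 2 - dist_a a y y' ^+ 2)).
Proof.
move=> Kx Ky Kx' Ky'.
have := sumsZ (1 / 2) (sumsB (sumsB (sumsD (sums_dist Kx Ky') (sums_dist Ky Kx'))
  (sums_dist Kx Kx')) (sums_dist Ky Ky')).
by apply: sums_ext => j; field.
Qed.

Lemma congruence_inner (x y x' y' : W) (l : R) : B x -> B y -> B x' -> B y' ->
  sums (fun j => a j ^+ 2 * ((x j - y j) * (x' j - y' j))) l ->
  sums (fun j => a j ^+ 2 * ((sigma x j - sigma y j) * (sigma x' j - sigma y' j))) l.
Proof.
have [BK sK sd] := cong; move=> Bx By Bx' By' h.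
have K z : B z -> @hilbert_cube R (sigma z) by move=> Bz; apply: sK; exists z.
rewrite (sums_unique h (polarize (BK _ Bx) (BK _ By) (BK _ Bx') (BK _ By'))).
rewrite -(sd x y')// -(sd y x')// -(sd x x')// -(sd y y')//.
by apply: polarize; exact: K.
Qed.

Variables p p' : nat -> W.
Hypothesis Bp : forall i, B (p i).
Hypothesis Bp' : forall i, B (p' i).
Hypothesis p_off : forall i k, k != i -> p i k = p' i k.
Hypothesis p_on : forall i, p i i != p' i i.

Definition column (j i : nat) : R :=
  a j * (sigma (p i) j - sigma (p' i) j) / (a i * (p i i - p' i i)).

Lemma an0 i : a i != 0. Proof. by rewrite gt_eqF. Qed.
Lemma pn0 i : p i i - p' i i != 0. Proof. by rewrite subr_eq0. Qed.

Lemma column_inner x y i : B x -> B y ->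
  sums (fun j => a j * (sigma x j - sigma y j) * column j i) (a i * (x i - y i)).
Proof.
move=> Bx By.
have h : sums (fun j => a j ^+ 2 * ((x j - y j) * (p i j - p' i j)))
    (a i ^+ 2 * ((x i - y i) * (p i i - p' i i))).
  pose f j := a j ^+ 2 * ((x j - y j) * (p i j - p' i j)).
  have -> : a i ^+ 2 * ((x i - y i) * (p i i - p' i i)) = \sum_(j < i.+1) f j.
    rewrite big_ord_recr/= big1 ?add0r// => j _.
    by rewrite /f p_off ?subrr ?mulr0// ltn_eqF.
  by apply: sums_finite => j ij; rewrite /f p_off ?subrr ?mulr0// gtn_eqF.
have := sumsZ (a i * (p i i - p' i i))^-1 (congruence_inner Bx By (Bp i) (Bp' i) h).
rewrite (_ : _ * (a i ^+ 2 * _) = a i * (x i - y i)); last by field; rewrite an0 pn0.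
by apply: sums_ext => j; rewrite /column; field; rewrite an0 pn0.
Qed.

Lemma column_orth i k : sums (fun j => column j i * column j k) (i == k)%:R.
Proof.
have := sumsZ (a i * (p i i - p' i i))^-1 (@column_inner _ _ k (Bp i) (Bp' i)).
have -> : (a i * (p i i - p' i i))^-1 * (a k * (p i k - p' i k)) = (i == k)%:R.
  case: (eqVneq i k) => [<-|ik]; first by rewrite mulVf// mulf_neq0 ?an0 ?pn0.
  have -> : p i k = p' i k by apply: p_off; rewrite eq_sym.
  by rewrite subrr !mulr0.
by apply: sums_ext => j; rewrite /column; field; rewrite !an0 !pn0.
Qed.

(** The weighted difference of the images has the same norm as [x - y] and inner product
    [a i * (x i - y i)] with column [i], so [expansion] applies. *)
Lemma congruence_linear x y N : B x -> B y -> (forall i, (N <= i)%N -> x i = y i) ->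
  forall j, a j * (sigma x j - sigma y j) = \sum_(i < N) column j i * (a i * (x i - y i)).
Proof.
move=> Bx By xy; apply: (@expansion _ _ column_orth N (fun j => a j * (sigma x j - sigma y j))
  (fun i => a i * (x i - y i))) => [|i _]; last exact: (@column_inner x y i Bx By).
apply: (@sums_ext _ (fun j => a j ^+ 2 * ((sigma x j - sigma y j) * (sigma x j - sigma y j)))).
  by move=> j; ring.
rewrite (_ : \sum_(i < N) _ = \sum_(i < N) a i ^+ 2 * ((x i - y i) * (x i - y i))); last first.
  by apply: eq_bigr => i _; ring.
apply: congruence_inner => //.
apply: (@sums_finite _ (fun j => a j ^+ 2 * ((x j - y j) * (x j - y j)))) => j Nj.
by rewrite xy// subrr mul0r mulr0.
Qed.

End Congruence.

(** * Reflections and localization *)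

Section Affine.
Context {R : realType}.
Local Notation lam := (@lebesgue_measure R).

Definition affine (al be : R) (s : measurableTypeR R) : measurableTypeR R := al * s + be.

Lemma measurable_affine al be : measurable_fun setT (affine al be).
Proof.
by apply: measurable_funD; [apply: measurable_funM|] => //.
Qed.

Lemma measurable_affine_preimage al be (A : set R) : measurable A -> measurable (affine al be @^-1` A).
Proof. by move=> mA; rewrite -[X in measurable X]setTI; exact: (measurable_affine al be measurableT mA). Qed.

Lemma lebesgue_affine (al be : R) (A : set R) : al != 0 -> measurable A ->
  (lam A = `|al|%:E * lam (affine al be @^-1` A))%E.
Proof.
move=> al0 mA.
pose m0 : {measure set (measurableTypeR R) -> \bar R} :=
  mscale (NngNum (normr_ge0 al)) (pushforward lam (affine al be)).
pose m := m0 (measurable_affine al be).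
change (lam A = m A); apply: lebesgue_measure_unique mA => _ [[x y] _ <-]/=.
rewrite /m /m0 /mscale/= /pushforward.
have [ap|an|ae] := ltgtP al 0; last by rewrite ae eqxx in al0.
- rewrite (_ : _ @^-1` _ = `[(y - be) / al, (x - be) / al[%classic); last first.
    apply/seteqP; split => s /=; rewrite /affine !in_itv/= ler_ndivrMr// ltr_ndivlMr//;
    by rewrite lerBrDr ltrBlDr ![s * al]mulrC andbC.
  rewrite !lebesgue_measure_itv/= !lte_fin ltr_nM2r ?invr_lt0// ltrD2r.
  case: ifP => _; last by rewrite mule0.
  by rewrite -!EFinB -EFinM ltr0_norm//; congr EFin; field.
- rewrite (_ : _ @^-1` _ = `](x - be) / al, (y - be) / al]%classic); last first.
    apply/seteqP; split => s /=; rewrite /affine !in_itv/= ltr_pdivrMr// ler_pdivlMr//;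
    by rewrite lerBrDr ltrBlDr ![s * al]mulrC.
  rewrite !lebesgue_measure_itv/= !lte_fin ltr_pM2r ?invr_gt0// ltrD2r.
  case: ifP => _; last by rewrite mule0.
  by rewrite -!EFinB -EFinM gtr0_norm//; congr EFin; field.
Qed.

Lemma integral_affine (al be : R) (f : measurableTypeR R -> \bar R) : al != 0 ->
  measurable_fun setT f -> (forall x, 0 <= f x)%E ->
  (\int[lam]_s f s = `|al|%:E * \int[lam]_s f (al * s + be)%R)%E.
Proof.
move=> al0 mf f0.
pose m0 : {measure set (measurableTypeR R) -> \bar R} :=
  mscale (NngNum (normr_ge0 al)) (pushforward lam (affine al be)).
pose m := m0 (measurable_affine al be).
transitivity (\int[m]_s f s)%E.
  by apply: eq_measure_integral => A mA _; exact: lebesgue_affine.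
rewrite /m /m0 ge0_integral_mscale//=; congr (_ * _)%E.
have := @ge0_integral_pushforward _ _ _ _ _ _ (measurable_affine al be) lam setT f measurableT mf.
by rewrite preimage_setT => ->.
Qed.

End Affine.

(** * Reflection of a box through its centre *)

Section Flip.
Context {R : realType}.
Local Notation W := (Romega R).
Local Notation lam := (@lebesgue_measure R).
Variable P : probability W R.
Hypothesis P_prod : is_product_lebesgue P.
Variables (N : nat) (c f : nat -> R).
Hypothesis cf : subunit c f.
Local Notation Q := (box N c f).

(** Only [N] coordinates are reflected, so that [x] and [flip x] differ in finitely many coordinates
    and [congruence_linear] applies. *)
Definition flip (x : W) : W := fun k => if (k < N)%N then 2 * c k - x k else x k.

Lemma flip_rectangle n (A : nat -> set R) : flip @^-1` rectangle n A =
  rectangle n (fun k => if (k < N)%N then affine (-1) (2 * c k) @^-1` A k else A k).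
Proof.
apply/seteqP; split => x /= h k kn; have := h k kn; rewrite /flip; case: ifP => // _;
by rewrite /affine/= mulN1r addrC.
Qed.

Lemma measurable_flip : measurable_fun setT flip.
Proof.
apply: (measurability _ (@measurable_rectangles R)).
move=> _ [_ [n [A mA ->]] <-]; rewrite setTI flip_rectangle.
apply: rectangle_measurable => k; case: ifP => // _.
exact: measurable_affine_preimage.
Qed.

Lemma rectangleI n m (A C : nat -> set R) : rectangle n A `&` rectangle m C =
  rectangle (maxn n m) (fun i => (if (i < n)%N then A i else setT) `&` (if (i < m)%N then C i else setT)).
Proof.
apply/seteqP; split => [x [h1 h2] k|x h].
  by rewrite leq_max => _; split; [case: ifP => // /h1|case: ifP => // /h2].
split=> k kn; have := h k; rewrite leq_max kn ?orbT => /(_ isT)[]; first by [].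
by [].
Qed.

(** Stated inside [Q] because the reflection maps each side of the box to itself but need not
    preserve [0, 1]. *)
Lemma flip_preserving (X : set W) : measurable X -> pr P (Q `&` flip @^-1` X) = pr P (Q `&` X).
Proof.
move=> mX; have mQ : measurable Q by exact: measurable_box.
pose m1 : {measure set W -> \bar R} := mrestr P mQ.
have mf (Y : set W) : measurable Y -> measurable (flip @^-1` Y).
  by move=> mY; rewrite -[X in measurable X]setTI; exact: (measurable_flip measurableT mY).
rewrite /pr; congr fine; rewrite ![Q `&` _]setIC.
pose m0 : {measure set W -> \bar R} := pushforward m1 flip.
pose m2 := m0 measurable_flip.
have E : forall Y, measurable Y -> m2 Y = m1 Y; last exact: (E X mX).
apply: measure_unique_rectangles => [|n A mA].
  change (P ((flip @^-1` setT) `&` Q) < +oo)%E; rewrite preimage_setT setTI.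
  exact: le_lt_trans (probability_le1 P mQ) (ltry _).
change (P ((flip @^-1` rectangle n A) `&` Q) = P (rectangle n A `&` Q)); rewrite flip_rectangle.
rewrite /box !rectangleI !probability_rectangle//; last 2 first.
- move=> k; apply: measurableI; case: ifP => // _; exact: measurable_box_itv.
- move=> k; apply: measurableI; case: ifP => // _; last exact: measurable_box_itv.
  case: ifP => // _; exact: measurable_affine_preimage.
apply: eq_bigr => k _.
have [kN|kN] := ltnP k N; last by [].
have [kn|kn] := ltnP k n; last by [].
rewrite -!setIA [box_itv c f k `&` _]setIidl; last exact: box_itv_sub.
rewrite [RHS](@lebesgue_affine _ (-1) (2 * c k)) ?oppr_eq0 ?oner_eq0//; last first.
  by apply: measurableI => //; exact: measurable_box_itv.
rewrite normrN1 mul1e preimage_setI; congr (lam (_ `&` _)).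
by apply/seteqP; split => s; rewrite /box_itv /affine /= !in_itv/= => /andP[h1 h2];
  apply/andP; split; lra.
Qed.

End Flip.

(** * A dyadic box almost filled by a closed set *)

Section Localization.
Context {R : realType}.
Local Notation T := {ptws nat -> R}.
Local Notation W := (Romega R).
Local Notation lam := (@lebesgue_measure R).
Variable P : probability W R.
Hypothesis P_prod : is_product_lebesgue P.

Lemma pr_hyperplane i (s : R) : P [set x : W | x i = s] = 0%E.
Proof.
rewrite (_ : [set _ | _] = rectangle i.+1 (fun k => if k == i then [set s] else setT)).
  rewrite probability_rectangle//; last by move=> k; case: ifP.
  rewrite (bigD1 ord_max)//= eqxx (_ : lam _ = 0%E) ?mul0e//.
  apply/eqP; rewrite eq_le measure_ge0 andbT -(lebesgue_measure_set1 s).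
  by apply: le_measure => [| |? []//]; rewrite inE; [exact: measurableI|exact: measurable_set1].
apply/seteqP; split => x /=; first by move=> xi k _; case: eqP => // ->.
by move=> /(_ i (ltnSn i)); rewrite eqxx.
Qed.

Lemma measurable_hyperplane i (s : R) : measurable [set x : W | x i = s].
Proof.
rewrite (_ : [set _ | _] = (fun x : W => x i) @^-1` [set s]) //.
rewrite -[X in measurable X]setTI; exact: (measurable_coord i measurableT (measurable_set1 s)).
Qed.

Lemma pr_subset0 (X : set W) : measurable X -> X `<=` set0 -> pr P X = 0.
Proof. by move=> mX; rewrite subset0 => ->; rewrite /pr measure0. Qed.

Lemma prDI (X Y : set W) : measurable X -> measurable Y -> pr P X = pr P (X `&` Y) + pr P (X `&` ~` Y).
Proof.
move=> mX mY; apply/EFin_inj; rewrite EFinD -!prE//; last 2 first.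
- by apply: measurableI => //; exact: measurableC.
- exact: measurableI.
rewrite -measureU//; last 3 first.
- exact: measurableI.
- by apply: measurableI => //; exact: measurableC.
- by rewrite setIACA setICr setI0.
by rewrite -setIUr setUCr setIT.
Qed.

Definition halve (i : nat) (f : nat -> R) (k : nat) : R := if k == i then f i / 2 else f k.
Definition lower_half i (c f : nat -> R) k : R := if k == i then c i - f i / 2 else c k.
Definition upper_half i (c f : nat -> R) k : R := if k == i then c i + f i / 2 else c k.

Lemma halves_subunit i c f : subunit c f ->
  subunit (lower_half i c f) (halve i f) /\ subunit (upper_half i c f) (halve i f).
Proof.
move=> cf; have [f0 f1 f2] := cf i.
by split=> k; rewrite /lower_half /upper_half /halve; case: eqP => _; try exact: cf; split; lra.
Qed.

Lemma bisect_le N i c f (X : set W) : measurable X ->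
  pr P (box N c f `&` X) <=
  pr P (box N (lower_half i c f) (halve i f) `&` X) + pr P (box N (upper_half i c f) (halve i f) `&` X).
Proof.
move=> mX; apply: le_trans (prU _ _ _); [|by apply: measurableI => //; exact: measurable_box..].
apply: pr_le.
- by apply: measurableI => //; exact: measurable_box.
- by apply: measurableU; apply: measurableI => //; exact: measurable_box.
move=> x [Qx Xx]; have [h|h] := leP (x i) (c i); [left|right]; split => // k kN; have := Qx k kN;
  rewrite /box_itv /lower_half /upper_half /halve /= !in_itv/=; case: eqP => [->|//] /andP[h1 h2];
  apply/andP; split; lra.
Qed.

(** The closed halves overlap in a hyperplane, which has measure 0. *)
Lemma bisect_ge N i c f (X : set W) : subunit c f -> (i < N)%N -> measurable X ->
  pr P (box N (lower_half i c f) (halve i f) `&` X) + pr P (box N (upper_half i c f) (halve i f) `&` X) <=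
  pr P (box N c f `&` X).
Proof.
move=> cf iN mX; have [f0 _ _] := cf i.
set L := box N (lower_half i c f) _ `&` X; set U := box N (upper_half i c f) _ `&` X.
have mL : measurable L by apply: measurableI => //; exact: measurable_box.
have mU : measurable U by apply: measurableI => //; exact: measurable_box.
pose H : set W := [set x | x i = c i]; have mH : measurable H by exact: measurable_hyperplane.
have mUH : measurable (U `&` ~` H) by apply: measurableI => //; exact: measurableC.
have -> : pr P U = pr P (U `&` ~` H).
  rewrite (prDI mU mH) (_ : pr P (U `&` H) = 0) ?add0r//; apply/eqP; rewrite eq_le pr_ge0 andbT.
  have -> : 0 = pr P H by rewrite /pr pr_hyperplane.
  by apply: pr_le => //; exact: measurableI.
have -> : pr P L + pr P (U `&` ~` H) = pr P (L `|` (U `&` ~` H)).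
  apply/EFin_inj; rewrite EFinD -!prE//; last exact: measurableU.
  rewrite measureU//; rewrite -subset0 => x [[Lx _] [[Ux _] Hx]].
  have := Lx i iN; have := Ux i iN; rewrite /box_itv /lower_half /upper_half /halve eqxx /= !in_itv/=.
  by move=> /andP[h1 h2] /andP[h3 h4]; apply: Hx; rewrite /H /=; lra.
apply: pr_le; [exact: measurableU|by apply: measurableI => //; exact: measurable_box|].
move=> x [[Lx Xx]|[[Ux Xx] _]]; split => // k kN; [have := Lx k kN|have := Ux k kN];
  rewrite /box_itv /lower_half /upper_half /halve /= !in_itv/=; case: eqP => [->|//] /andP[h1 h2];
  apply/andP; split; lra.
Qed.

Definition halving_list (k s : nat) : seq nat := flatten [seq nseq s i | i <- iota 0 k].

Lemma count_halving_list k s i : (i < k)%N -> (s <= count_mem i (halving_list k s))%N.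
Proof.
move=> ik; rewrite /halving_list count_flatten -map_comp.
have : i \in iota 0 k by rewrite mem_iota.
elim: (iota 0 k) => //= j l IH; rewrite inE => /predU1P[<-|/IH h].
  by rewrite count_nseq/= eqxx mul1n leq_addr.
by apply: leq_trans h _; rewrite leq_addl.
Qed.

Lemma halving_list_lt k s : all (fun i => (i < k)%N) (halving_list k s).
Proof.
apply/allP => j /flattenP[_ /mapP[i ik ->]]; rewrite mem_nseq => /andP[_ /eqP ->].
by move: ik; rewrite mem_iota.
Qed.

Variable B : set T.
Hypothesis B_closed : closed B.
Hypothesis B_cube : (B : set W) `<=` @hilbert_cube R.
Hypothesis B_pos : 0 < pr P (B : set W).

Let mB : measurable (B : set W). Proof. exact: closed_measurable. Qed.

Definition thicken (k : nat) : set W :=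
  [set x | exists2 y, B y & near_upto k k.+1%:R^-1 x y].

Lemma measurable_thicken k : measurable (thicken k).
Proof. by apply: open_measurable; exact: near_upto_open. Qed.

Definition centered (N : nat) (c f : nat -> R) :=
  forall i, (N <= i)%N -> c i = 1 / 2 /\ f i = 1 / 2.

Lemma pr_thicken_lim : (P \o thicken) n @[n --> \oo] --> P (B : set W).
Proof.
have BE : (B : set W) = \bigcap_n thicken n by exact: closed_bigcap_near_upto.
rewrite [in X in _ --> X]BE; apply: nonincreasing_cvg_mu.
- by apply: le_lt_trans (probability_le1 P (measurable_thicken 0)) (ltry _).
- exact: measurable_thicken.
- by rewrite -BE.
- apply/nonincreasing_seqP => n; rewrite subsetEset => x [y By h]; exists y => // i iN.
  apply: lt_le_trans (h i (leqW iN)) _.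
  by rewrite lef_pV2 ?posrE// ler_nat.
Qed.

(** Once the list is used up, the sides below [k] are shorter than [k.+1%:R^-1], so a cell that
    meets [B] lies in [thicken k]. The other cells contribute nothing on the left. *)
Lemma bisection (e : R) k l c f : 0 <= e <= 1 ->
  (forall N c f, subunit c f -> centered N c f ->
     pr P (box N c f `&` B) <= (1 - e) * pr P (box N c f)) ->
  subunit c f -> centered k c f -> all (fun i => (i < k)%N) l ->
  (forall i, (i < k)%N -> 2 * (f i * (1 / 2) ^+ count_mem i l) < k.+1%:R^-1) ->
  pr P (box k c f `&` B) <= (1 - e) * pr P (box k c f `&` thicken k).
Proof.
move=> /andP[e0 e1] H; elim: l c f => [|i l IH] c f cf cn.
  move=> _ small; have mQ : measurable (box k c f) by exact: measurable_box.
  have [[y [Qy By]]|none] := pselect (exists y, box k c f y /\ B y).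
    rewrite (_ : box k c f `&` thicken k = box k c f); first exact: H.
    apply/setIidPl => x Qx; exists y => // i ik; have := small i ik; rewrite /= expr0 mulr1.
    apply: le_lt_trans; have := Qx i ik; have := Qy i ik; rewrite /box_itv /= !in_itv/=.
    by move=> /andP[h1 h2] /andP[h3 h4]; rewrite ler_norml; apply/andP; split; lra.
  rewrite pr_subset0; first by rewrite mulr_ge0 ?pr_ge0// subr_ge0.
    exact: measurableI.
  by move=> x [Qx Bx]; apply: none; exists x.
move=> /= /andP[ik lk] small; have [cf1 cf2] := halves_subunit i cf.
have cn1 : centered k (lower_half i c f) (halve i f).
  move=> j kj; rewrite /lower_half /halve; have [ji|_] := eqVneq j i; last exact: cn.
  by move: kj; rewrite ji leqNgt ik.
have cn2 : centered k (upper_half i c f) (halve i f).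
  move=> j kj; rewrite /upper_half /halve; have [ji|_] := eqVneq j i; last exact: cn.
  by move: kj; rewrite ji leqNgt ik.
have small' j : (j < k)%N -> 2 * (halve i f j * (1 / 2) ^+ count_mem j l) < k.+1%:R^-1.
  move=> jk; have := small j jk; rewrite /halve [i == j]eq_sym; case: eqP => [->|_]/=.
    by rewrite add1n exprS => h; rewrite (_ : f i / 2 * _ = f i * (1 / 2 * (1 / 2) ^+ count_mem i l)); [exact: h|field].
  by rewrite add0n.
apply: le_trans (bisect_le k i c f mB) _.
apply: le_trans (lerD (IH _ _ cf1 cn1 lk small') (IH _ _ cf2 cn2 lk small')) _.
rewrite -mulrDr; apply: ler_wpM2l; first by rewrite subr_ge0.
exact: (bisect_ge cf ik (measurable_thicken k)).
Qed.

(** If [B] filled at most the proportion [1 - e] of every box, then its measure would be at most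
    [1 - e] times that of each [thicken k], and these measures tend to that of [B]. *)
Lemma localization (e : R) : 0 < e < 1 -> exists N c f,
  [/\ subunit c f, centered N c f & pr P (box N c f `&` ~` B) <= e * pr P (box N c f)].
Proof.
move=> /andP[e0 e1]; apply: contrapT => hno.
have H N c f : subunit c f -> centered N c f ->
    pr P (box N c f `&` B) <= (1 - e) * pr P (box N c f).
  move=> cf cn; have mQ : measurable (box N c f) by exact: measurable_box.
  have /negP : ~ (pr P (box N c f `&` ~` B) <= e * pr P (box N c f)).
    by move=> h; apply: hno; exists N, c, f.
  rewrite -ltNge => h; have := prDI mQ mB; lra.
have e01 : 0 <= e <= 1 by rewrite !ltW.
have key k : pr P B <= (1 - e) * pr P (thicken k).
  have [s sP] : exists s : nat, (1 / 2 : R) ^+ s < k.+1%:R^-1.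
    have h2 : `|1 / 2 : R| < 1 by rewrite ger0_norm//; lra.
    have k0 : 0 < (k.+1%:R^-1 : R) by rewrite invr_gt0.
    have /cvgrPdist_lt/(_ _ k0)[s _ sP] := cvg_expr h2.
    exists s; have := sP s (leqnn s); rewrite /= sub0r normrN.
    by apply: le_lt_trans; exact: ler_norm.
  pose h : nat -> R := fun=> 1 / 2.
  have cf : subunit h h by move=> i; rewrite /h; split; lra.
  have BQ : box k h h `&` B = B.
    apply/setIidPr => x Bx i _; have := B_cube Bx i; rewrite /box_itv /h /= !in_itv/=.
    by move=> /andP[h1 h2]; apply/andP; split; lra.
  rewrite -{1}BQ; apply: le_trans (@bisection e k (halving_list k s) h h e01 H cf _ (halving_list_lt k s) _) _ => //.
    move=> i ik; apply: le_lt_trans sP; rewrite mulrA (_ : 2 * h i = 1) ?mul1r; last by rewrite /h; field.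
    by apply: ler_wiXn2l; [lra|lra|exact: count_halving_list].
  apply: ler_wpM2l; first by rewrite subr_ge0 ltW.
  apply: pr_le; [|exact: measurable_thicken|exact: subIsetr].
  by apply: measurableI; [exact: measurable_box|exact: measurable_thicken].
have lim := pr_thicken_lim.
have : ((pr P B / (1 - e))%:E <= P (B : set W))%E.
  rewrite -(cvg_lim _ lim)//; apply: lime_ge; first by apply/cvg_ex; eexists; exact: lim.
  apply: nearW => k /=; rewrite prE ?lee_fin ?ler_pdivrMr ?subr_gt0//; last exact: measurable_thicken.
  by rewrite mulrC; exact: key.
rewrite prE// lee_fin ler_pdivrMr ?subr_gt0// => h.
have : 0 < e * pr P B by rewrite mulr_gt0.
by have := B_pos; lra.
Qed.

End Localization.

(** * Smallness of the defect *)

Section Link.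
Context {R : realType}.
Local Notation T := {ptws nat -> R}.
Local Notation W := (Romega R).
Local Notation lam := (@lebesgue_measure R).
Variable P : probability W R.
Hypothesis P_prod : is_product_lebesgue P.
Variable a : nat -> R.
Hypothesis a_gt0 : forall i, 0 < a i.
Hypothesis a_sum : cvgn (series (fun i : nat => a i ^+ 2)).
Hypothesis a_mono : forall i j, (i <= j)%N -> a j <= a i.
Variables (B : set T) (sigma : W -> W).
Hypothesis B_closed : closed B.
Hypothesis cong : congruence a (B : set W) sigma.
Hypothesis B_pos : 0 < pr P (B : set W).

Let mB : measurable (B : set W). Proof. exact: closed_measurable. Qed.

Lemma square_tail (e : R) : 0 < e -> exists N0, forall N J, (N0 <= N)%N ->
  \sum_(N <= j < J) a j ^+ 2 <= e.
Proof.
move=> e0; have h : sums (fun j => a j ^+ 2) (limn (series (fun j => a j ^+ 2))) by [].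
have [N0 N0P] := sums_near_one h e0; exists N0 => N J NN.
have [NJ|NJ] := leqP N J; last by rewrite big_geq ?ltW// ltnW.
have := N0P N NN; have := sums_ge J (fun j => sqr_ge0 (a j)) h.
move=> h1 h2; rewrite -(big_mkord xpredT (fun j => a j ^+ 2)) (@big_cat_nat _ _ _ N)//= big_mkord in h1.
by move: h1 h2; set X := \sum_(j < N) _; set Y := \sum_(N <= j < J) _; lra.
Qed.

(** Otherwise each line parallel to axis [i] would meet [B] in at most one point, and [B] would be
    null by Fubini's theorem. *)
Lemma coordinate_pair i : exists xx : W * W,
  [/\ B xx.1, B xx.2, forall k, k != i -> xx.1 k = xx.2 k & xx.1 i != xx.2 i].
Proof.
apply: contrapT => hno; suff : pr P B = 0 by move=> h; move: B_pos; rewrite h ltxx.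
have mI : measurable_fun setT (fun x : W => (\1_(B : set W) x)%:E : \bar R).
  by apply/measurable_EFinP; exact: measurable_indic.
have I0 x : (0 <= (\1_(B : set W) x : R)%:E)%E by rewrite lee_fin.
have -> : pr P B = fine (\int[P]_x (\1_(B : set W) x)%:E)%E.
  by rewrite integral_indic// setIT.
rewrite (integral_resample P_prod i mI I0) integral0_eq// => x _.
have [[s sB]|none] := pselect (exists s, B (upd x i s)); last first.
  apply: integral0_eq => s _; rewrite indicE memNset//.
  by move=> h; apply: none; exists s.
apply/eqP; rewrite eq_le integral_ge0 ?andbT//.
have mu : measurable_fun setT (fun r : measurableTypeR R => (\1_(B : set W) (upd x i r))%:E : \bar R).
  exact: (measurableT_comp mI (measurable_upd_r i x)).
have m01 : measurable (`[0, 1]%classic : set (measurableTypeR R)) by exact: measurable_itv.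
apply: (@le_trans _ _ (\int[lam]_(r in `[0%R, 1%R]) (\1_[set s] r)%:E)%E); last first.
  rewrite integral_indic// -(lebesgue_measure_set1 s).
  by apply: le_measure; rewrite ?inE; [exact: measurableI|exact: measurable_set1|exact: subIsetl].
apply: ge0_le_integral => //.
- exact: measurable_funTS mu.
- by apply/measurable_EFinP; exact: measurable_indic.
move=> r _; rewrite lee_fin !indicE.
have [rB|rB] := pselect (B (upd x i r)); last by rewrite memNset.
rewrite [r \in _]mem_set ?mem_set//=; apply/eqP/negPn/negP => rs; apply: hno.
exists (upd x i r, upd x i s); split => //= [k ki|].
  by rewrite !updE (negbTE ki).
by rewrite !updE eqxx.
Qed.

Section Columns.
Variables p p' : nat -> W.
Hypothesis Bp : forall i, B (p i).
Hypothesis Bp' : forall i, B (p' i).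
Hypothesis p_off : forall i k, k != i -> p i k = p' i k.
Hypothesis p_on : forall i, p i i != p' i i.
Local Notation u := (column a sigma p p').

Variables (n : nat) (c f : nat -> R) (e : R).
Hypothesis cf : subunit c f.
Hypothesis cn : centered n c f.
Hypothesis e_eps : 500 * (500 * (2 * e)) <= 1.
Variable K : R.
Hypothesis K_def : K = 500 * 500 * 500.
Hypothesis K_eps : K * (2 * e) <= 1 / 500.
Hypothesis Q_dense : pr P (box n c f `&` ~` B) <= e * pr P (box n c f).

Definition rowform (j i : nat) : R := 2 * (u j i * (a i / a j)).

Definition exception (N : nat) : set W := ~` B `|` flip N c @^-1` (~` B).

Let mCB : measurable (~` B : set W). Proof. exact: measurableC. Qed.

Let measurable_flipped N : measurable (flip N c @^-1` (~` B : set W)).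
Proof. by rewrite -[X in measurable X]setTI; exact: (measurable_flip N c measurableT mCB). Qed.

Lemma measurable_exception N : measurable (exception N).
Proof. by apply: measurableU. Qed.

Lemma pr_box_wide N : (n <= N)%N -> pr P (box N c f) = pr P (box n c f).
Proof.
move=> nN; rewrite !pr_box// (big_ord_widen N (fun i => 2 * f i) nN).
rewrite (bigID (fun i : 'I_N => (i < n)%N))/= [X in _ * X]big1 ?mulr1// => i.
by rewrite -leqNgt => /cn[_ ->]; field.
Qed.

Lemma rare_exception N : (n <= N)%N ->
  pr P (box N c f `&` exception N) <= (2 * e) * pr P (box N c f).
Proof.
move=> nN; have mQ : measurable (box N c f) by exact: measurable_box.
have h : pr P (box N c f `&` ~` B) <= e * pr P (box N c f).
  rewrite pr_box_wide//; apply: le_trans Q_dense; apply: pr_le.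
  - exact: measurableI.
  - by apply: measurableI => //; exact: measurable_box.
  - by move=> x [Qx Bx]; split => // k kn; apply: Qx; exact: leq_trans kn nN.
rewrite /exception setIUr; apply: le_trans (prU _ _ _) _; [exact: measurableI..|].
by rewrite (flip_preserving P_prod N cf mCB)//; lra.
Qed.

(** If [x] and its reflection are both in [B], the form is the difference of the [j]-th coordinates
    of two points of the cube. The factor 2 in [rowform] comes from [x - flip x = 2 (x - c)]. *)
Lemma rowform_caught N j : (n <= N)%N -> caught N c f (exception N) (rowform j).
Proof.
move=> nN x Qx h; apply: contrapT => /not_orP[/contrapT Bx /contrapT Bx'].
have [_ sK _] := cong.
have xx' i : (N <= i)%N -> x i = flip N c x i by move=> Ni; rewrite /flip ltnNge Ni.
have lin := congruence_linear a_gt0 a_sum cong Bp Bp' p_off p_on Bx Bx' xx' j.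
have E : lform N (rowform j) c x = sigma x j - sigma (flip N c x) j.
  have aj : a j != 0 by rewrite gt_eqF.
  apply: (mulfI aj); rewrite lin /lform mulr_sumr; apply: eq_bigr => i _.
  by rewrite /rowform /flip ltn_ord; field.
have := sK (sigma x) (imageP _ Bx) j; have := sK _ (imageP sigma Bx') j.
rewrite !in_itv/= => /andP[h1 h2] /andP[h3 h4]; move: h.
by rewrite E ltNge => /negP; apply; rewrite ler_norml; apply/andP; split; lra.
Qed.

Local Notation w := (fun j i => u j i ^+ 2).
Local Notation v := (fun i => a i ^+ 2).

Lemma rowform_sq j i : (n <= i)%N ->
  (rowform j i * f i) ^+ 2 = w j i * (v i / v j).
Proof.
move=> /cn[_ ->]; rewrite /rowform; field; by rewrite gt_eqF.
Qed.

Lemma row_structure N J : (n <= N)%N -> exists e' : nat -> R, [/\ forall j, 0 <= e' j,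
  \sum_(j < J) e' j <= 1 & forall j, (j < J)%N -> row_main w v n N e' j].
Proof.
move=> nN; have rare := rare_exception nN; have cau j : caught N c f (exception N) (rowform j) by exact: rowform_caught.
have mE := measurable_exception N.
pose rel j := 499 / 500 <= \sum_(i < N | (n <= i)%N) w j i * (v i / v j).
have f0 i : 0 <= f i by case: (cf i) => /ltW.
have tail_le j (Q : pred 'I_N) (b : nat -> R) : (forall i : 'I_N, Q i -> (n <= i)%N /\ b i = rowform j i) ->
    \sum_(i < N | Q i) w j i * (v i / v j) <= seminorm2 f b N.
  move=> hQ; rewrite /seminorm2 [leRHS](bigID Q)/=.
  rewrite -[leLHS]addr0; apply: lerD; last by apply: sumr_ge0 => i _; exact: sqr_ge0.
  by apply: ler_sum => i /hQ[ni ->]; rewrite rowform_sq.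
have /choice[mn mnP] : forall j, exists i, rel j -> [/\ (i < N)%N,
    seminorm2 f (wipe i (rowform j)) N <= 1 / 100, 9 / 10 <= `|rowform j i| * f i &
    `|rowform j i| * f i <= 10 / 9].
  move=> j; have [rj|nrj] := boolP (rel j); last by exists 0%N.
  have [|i ?] := main_column P_prod cf mE e_eps K_def K_eps rare (cau j); last by exists i.
  by apply: le_trans rj _; apply: tail_le.
(* With the main column below [n], all the columns from [n] on would belong to the rest, whose
   squared norm is at most 1/100. *)
have main_ge j : rel j -> (n <= mn j)%N.
  move=> rj; have [iN Y1 _ _] := mnP j rj; rewrite leqNgt; apply/negP => mj.
  have : \sum_(i < N | (n <= i)%N) w j i * (v i / v j) <= seminorm2 f (wipe (mn j) (rowform j)) N.
    apply: tail_le => i ni; split => //; rewrite /wipe; case: eqP => // ij.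
    by move: mj; rewrite -ij ltnNge ni.
  by move: rj; rewrite /rel; lra.
have ex0 j i : 0 <= excess N f i (rowform j) by rewrite /excess le_max lexx.
pose e' j := if rel j then w j (mn j) * excess N f (mn j) (rowform j) else 0.
exists e'; split.
- by move=> j; rewrite /e'; case: ifP => // _; rewrite mulr_ge0 ?sqr_ge0.
- rewrite /e' -big_mkcond/=.
  apply: (sum_excess P_prod cf mE rare e_eps (w := fun j => w j (mn j))) => [j _ rj|i iN].
    by have [h1 _ _ h2] := mnP j rj; split => //; rewrite sqr_ge0.
  have orth : sums (fun j => u j i * u j i) (i == i)%:R.
    exact: (column_orth a_gt0 a_sum cong Bp Bp' p_off p_on).
  rewrite eqxx in orth.
  apply: le_trans (sums_ge J _ (sums_ext _ orth)); last 2 first.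
  - by move=> j; exact: (sqr_ge0 (u j i)).
  - by move=> j; rewrite expr2.
  rewrite big_mkcond/=; apply: ler_sum => j _.
  by case: ifP => [/andP[_ /eqP ->]|_]//; exact: sqr_ge0.
move=> j jJ rj; have [iN Y1 m9 m10] := mnP j rj.
have ni := main_ge j rj; exists (Ordinal iN) => /=.
set Y := \sum_(k < N | _) _.
have YL : Y <= seminorm2 f (wipe (mn j) (rowform j)) N.
  apply: tail_le => k /andP[nk ki]; split => //; rewrite /wipe ifN//.
have sq : Num.sqrt (w j (mn j) * (v (mn j) / v j)) = `|rowform j (mn j)| * f (mn j).
  by rewrite -rowform_sq// sqrtr_sqr normrM (ger0_norm (f0 _)).
split => //; first exact: le_trans YL Y1.
  by rewrite sq.
rewrite sq /e' ifT//; apply: ler_wpM2l; first exact: sqr_ge0.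
rewrite /excess ge_max !le_max lexx/=; apply/orP; right.
by rewrite lerD2r lerD2l ler_wpM2l// ler_wsqrtr.
Qed.

Lemma columns_defect_small (k : R) M0 : 0 < k -> exists2 M, (M0 <= M)%N & defect w M <= k.
Proof.
move: k M0; have orth i : sums (fun j => w j i) 1.
  have : sums (fun j => u j i * u j i) (i == i)%:R.
    exact: (column_orth a_gt0 a_sum cong Bp Bp' p_off p_on).
  by rewrite eqxx; apply: sums_ext => j; rewrite expr2.
apply: (@defect_small _ v w n) => //.
- by move=> i; rewrite exprn_gt0.
- by move=> i j ij; apply: lerXn2r; rewrite ?nnegrE; [exact: ltW|exact: ltW|exact: a_mono].
- exact: square_tail.
- by move=> i j; exact: sqr_ge0.
- by move=> i J; apply: (sums_ge J) (orth i) => j; exact: sqr_ge0.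
- by move=> i e0 e00; exact: (sums_near_one (orth i) e00).
- by move=> j N; exact: (bessel (column_orth a_gt0 a_sum cong Bp Bp' p_off p_on)).
- by move=> N J; exact: row_structure.
Qed.

End Columns.

Lemma columns_defect : exists p p' : nat -> W,
  [/\ forall i, B (p i), forall i, B (p' i), forall i k, k != i -> p i k = p' i k,
      forall i, p i i != p' i i &
      forall (k : R) M0, 0 < k -> exists2 M, (M0 <= M)%N &
        defect (fun j i => column a sigma p p' j i ^+ 2) M <= k].
Proof.
have /choice[xx xxP] := coordinate_pair.
pose p i := (xx i).1; pose p' i := (xx i).2; exists p, p'.
have Bp i : B (p i) by have [] := xxP i.
have Bp' i : B (p' i) by have [] := xxP i.
have p_off i k : k != i -> p i k = p' i k by have [_ _ h _] := xxP i; exact: h.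
have p_on i : p i i != p' i i by have [] := xxP i.
split => // k M0 k0.
have [BK _ _] := cong.
have [K KE] : exists K : R, K = 500 * 500 * 500 by eexists.
have K0 : 0 < K by rewrite KE; apply: mulr_gt0; [apply: mulr_gt0|]; exact: ltr0Sn.
have KK : 500 * 500 <= K by rewrite KE; lra.
(* This makes [K * (2 * e)] equal to the margin 1/500 of the sixth moment; the factor 2 accounts for
   the reflection. *)
have [e eE] : exists e : R, e = (K * 2)^-1 / 500 by eexists.
have p500 : 0 < (500 : R) by exact: ltr0Sn.
have e0 : 0 < e by rewrite eE; apply: divr_gt0 => //; rewrite invr_gt0; exact: mulr_gt0.
have Ke : K * (2 * e) = 1 / 500.
  by rewrite eE; field; rewrite !gt_eqF.
have e1 : 500 * (500 * (2 * e)) <= 1 / 500.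
  by rewrite -Ke !mulrA; apply: ler_wpM2r; [exact: ltW|rewrite ler_pM2r].
have [n [c [f [cf cn dense]]]] : exists n c f, [/\ subunit c f, centered n c f &
    pr P (box n c f `&` ~` B) <= e * pr P (box n c f)].
  by apply: (localization P_prod B_closed BK B_pos); apply/andP; split; [exact: e0|lra].
have e2 : 500 * (500 * (2 * e)) <= 1 by lra.
have Ke' : K * (2 * e) <= 1 / 500 by rewrite Ke.
have H := columns_defect_small Bp Bp' p_off p_on cf cn e2 KE Ke' dense.
exact: H.
Qed.

End Link.

(** * Determinants and volume *)

Section Iterated.
Context {R : realType}.
Local Notation W := (Romega R).
Local Notation lam := (@lebesgue_measure R).
Implicit Types (g h : W -> \bar R).

Definition coord_integral i g (x : W) : \bar R := (\int[lam]_s g (upd x i s))%E.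

(** The integral over all of R^M, not only over the unit cube, since linear maps leave the cube; the
    coordinates from [M] on are parameters. *)
Fixpoint Jint (M : nat) g : W -> \bar R :=
  if M is m.+1 then coord_integral m (Jint m g) else g.

Definition nnmeasurable g := measurable_fun setT g /\ forall x, (0 <= g x)%E.

Lemma nnmeasurable_coord_integral i g : nnmeasurable g -> nnmeasurable (coord_integral i g).
Proof.
move=> [mg g0]; split; last by move=> x; apply: integral_ge0.
by apply: (measurable_integral_upd i measurableT).
Qed.

Lemma nnmeasurable_Jint M g : nnmeasurable g -> nnmeasurable (Jint M g).
Proof. by move=> hg; elim: M => //= M; exact: nnmeasurable_coord_integral. Qed.

Lemma measurable_slice i g x : nnmeasurable g ->
  measurable_fun setT (fun s : measurableTypeR R => g (upd x i s)).
Proof. by move=> [mg _]; exact: (measurableT_comp mg (measurable_upd_r i x)). Qed.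

Lemma Jint_le M g h x : nnmeasurable g -> nnmeasurable h ->
  (forall y, (forall i, (M <= i)%N -> y i = x i) -> (g y <= h y)%E) -> (Jint M g x <= Jint M h x)%E.
Proof.
move=> hg hh; elim: M x => [|M IH] x le_gh /=; first exact: le_gh.
have hg' := nnmeasurable_Jint M hg; have hh' := nnmeasurable_Jint M hh.
apply: ge0_le_integral => //.
- by move=> s _; case: hg'.
- exact: measurable_slice.
- exact: measurable_slice.
move=> s _; apply: IH => y hy; apply: le_gh => i Mi; rewrite hy ?(ltnW Mi)// updE.
by rewrite gtn_eqF.
Qed.

Lemma Jint_eq M g h x : nnmeasurable g -> nnmeasurable h ->
  (forall y, (forall i, (M <= i)%N -> y i = x i) -> g y = h y) -> Jint M g x = Jint M h x.
Proof.
by move=> hg hh e; apply/eqP; rewrite eq_le !Jint_le// => y /e ->.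
Qed.

Lemma Jint0 M g x : nnmeasurable g ->
  (forall y, (forall i, (M <= i)%N -> y i = x i) -> g y = 0%E) -> Jint M g x = 0%E.
Proof.
move=> hg h; have h0 : nnmeasurable (fun=> 0%E : \bar R) by split => //; exact: measurable_cst.
rewrite (Jint_eq hg h0 h); elim: M x {h} => //= M IH x.
by apply: integral0_eq => s _; exact: IH.
Qed.

Lemma updC (x : W) i k s t : i != k -> upd (upd x i s) k t = upd (upd x k t) i s.
Proof.
move=> ik; apply/funext => l; rewrite !updE; case: eqP => [->|//].
by rewrite eq_sym (negbTE ik).
Qed.

Lemma coord_integralC i k g : nnmeasurable g ->
  coord_integral i (coord_integral k g) = coord_integral k (coord_integral i g).
Proof.
move=> [mg g0]; have [->//|ik] := eqVneq i k.
apply/funext => x; rewrite /coord_integral.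
pose G (st : measurableTypeR R * measurableTypeR R) := g (upd (upd x i st.1) k st.2).
have mG : measurable_fun setT G.
  apply: (measurableT_comp mg).
  have m1 : measurable_fun setT (fun st : measurableTypeR R * measurableTypeR R => upd x i st.1).
    exact: (measurableT_comp (measurable_upd_r i x) measurable_fst).
  exact: (measurableT_comp (measurable_updp k) (measurable_fun_pair m1 measurable_snd)).
transitivity (\int[lam]_t \int[lam]_s G (s, t))%E.
  by rewrite -(@fubini_tonelli _ _ _ _ _ lam lam G)// => st; exact: g0.
by apply: eq_integral => t _; apply: eq_integral => s _; rewrite /G /= updC.
Qed.

Lemma Jint_coord_integral M i g : nnmeasurable g -> Jint M (coord_integral i g) = coord_integral i (Jint M g).
Proof.
move=> hg; elim: M => //= M ->; rewrite coord_integralC//; exact: nnmeasurable_Jint.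
Qed.

Definition scales M (phi : W -> W) (k : R) := [/\ measurable_fun setT phi, 0 < k &
  forall g, nnmeasurable g -> forall x, (k%:E * Jint M (g \o phi) x = Jint M g x)%E].

Lemma nnmeasurable_comp g (phi : W -> W) : measurable_fun setT phi -> nnmeasurable g -> nnmeasurable (g \o phi).
Proof. by move=> mp [mg g0]; split => [|x]; [exact: (measurableT_comp mg mp)|exact: g0]. Qed.

Lemma scales_comp M phi psi k l : scales M phi k -> scales M psi l -> scales M (phi \o psi) (k * l).
Proof.
move=> [mp k0 hp] [mq l0 hq]; split; [exact: (measurableT_comp mp mq)|exact: mulr_gt0|].
move=> g hg x; rewrite EFinM -muleA -(hp g hg); congr (_ * _)%E.
exact: (hq (g \o phi) (nnmeasurable_comp mp hg)).
Qed.

Lemma scales_id M : scales M id 1.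
Proof. by split; [exact: measurable_id|exact: ltr01|move=> g _ x; rewrite mul1e]. Qed.

Lemma Jint_scale M g k x : nnmeasurable g -> 0 <= k ->
  (k%:E * Jint M g x = Jint M (fun y => k%:E * g y) x)%E.
Proof.
move=> hg k0; elim: M x => //= M IH x; rewrite /coord_integral -ge0_integralZl_EFin//.
- by apply: eq_integral => s _; exact: IH.
- by move=> s _; case: (nnmeasurable_Jint M hg).
- exact: (measurable_slice M x (nnmeasurable_Jint M hg)).
Qed.

(** By Tonelli's theorem the integration over coordinate [i] can be moved to the innermost place. *)
Lemma Jint_coord_eq M i g h k : nnmeasurable g -> nnmeasurable h -> (i < M)%N -> 0 <= k ->
  (forall x, k%:E * coord_integral i g x = coord_integral i h x)%E ->
  forall x, (k%:E * Jint M g x = Jint M h x)%E.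
Proof.
move=> hg hh iM k0 e; elim: M iM => // M IH; rewrite ltnS leq_eqVlt => /predU1P[iM|iM] x.
  rewrite /= -iM -!Jint_coord_integral//.
  have hgi := nnmeasurable_coord_integral i hg.
  rewrite -(_ : (fun x => k%:E * coord_integral i g x)%E = coord_integral i h); last exact/funext.
  exact: Jint_scale.
rewrite /= /coord_integral -ge0_integralZl_EFin//.
- by apply: eq_integral => s _; exact: IH.
- by move=> s _; case: (nnmeasurable_Jint M hg).
- exact: (measurable_slice M x (nnmeasurable_Jint M hg)).
Qed.

Definition elementary i (al : R) (be : W -> R) (x : W) : W := upd x i (al * x i + be x).

Lemma measurable_elementary i al be : measurable_fun setT be -> measurable_fun setT (elementary i al be).
Proof.
move=> mb; have m1 : measurable_fun setT (fun x : W => (al * x i + be x : measurableTypeR R)).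
  apply: measurable_funD => //; apply: measurable_funM; [exact: measurable_cst|exact: measurable_coord].
exact: (measurableT_comp (measurable_updp i) (measurable_fun_pair (@measurable_id _ W setT) m1)).
Qed.

Lemma scales_elementary M i al be : (i < M)%N -> al != 0 -> measurable_fun setT be ->
  (forall x s, be (upd x i s) = be x) -> scales M (elementary i al be) `|al|.
Proof.
move=> iM al0 mb bi; have me := measurable_elementary i al mb.
split => //; first by rewrite normr_gt0.
move=> g hg; apply: (@Jint_coord_eq M i) => //; first exact: nnmeasurable_comp.
move=> x; have g0 (s : R) : (0 <= g (upd x i s))%E by case: hg.
rewrite /coord_integral; transitivity (`|al|%:E * \int[lam]_s g (upd x i (al * s + be x)%R))%E; last first.
  by apply/esym; exact: (@integral_affine _ al (be x) (fun s => g (upd x i s)) al0 (measurable_slice i x hg) g0).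
congr (_ * _)%E; apply: eq_integral => s _.
by rewrite /elementary/= upd_upd updE eqxx bi.
Qed.

End Iterated.

(** * Determinant of a small perturbation of the identity *)

Section Det.
Context {R : realType}.

Definition qform n (H : 'M[R]_n) (x : 'cV[R]_n) : R := (x^T *m H *m x) 0 0.

Definition psd n (H : 'M[R]_n) := H^T = H /\ forall x, 0 <= qform H x.

Lemma qformE n (H : 'M[R]_n) x : qform H x = \sum_i \sum_j x i 0 * H i j * x j 0.
Proof.
rewrite /qform mxE exchange_big/=; apply: eq_bigr => j _.
by rewrite mxE mulr_suml; apply: eq_bigr => i _; rewrite mxE.
Qed.

Lemma discriminant (p q r : R) : (forall s, 0 <= s ^+ 2 * p + 2 * s * q + r) -> 0 <= p -> q ^+ 2 <= p * r.
Proof.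
move=> h p0; have [p_0|pn] := eqVneq p 0.
  rewrite p_0 mul0r; have [->|qn] := eqVneq q 0; first by rewrite expr0n.
  exfalso; have := h (- (r + 1) / (2 * q)).
  have -> : 2 * (- (r + 1) / (2 * q)) * q = - (r + 1) by field.
  by rewrite p_0 mulr0; lra.
have pp : 0 < p by rewrite lt_neqAle eq_sym pn.
have := h (- q / p); have -> : (- q / p) ^+ 2 * p + 2 * (- q / p) * q + r = (p * r - q ^+ 2) / p by field.
by rewrite pmulr_lge0 ?invr_gt0// subr_ge0.
Qed.

Lemma det_schur n (al : R) (r : 'rV[R]_n) (c : 'cV[R]_n) (D : 'M[R]_n) : al != 0 ->
  \det (block_mx al%:M r c D) = al * \det (D - al^-1 *: (c *m r)).
Proof.
move=> al0; have -> : block_mx al%:M r c D =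
    block_mx 1%:M 0 (al^-1 *: c) 1%:M *m block_mx al%:M r 0 (D - al^-1 *: (c *m r)).
  rewrite mulmx_block !mul1mx !mul0mx !addr0 -!scalemxAl.
  by rewrite mul_mx_scalar scalerA mulVf// scale1r addrC subrK.
by rewrite det_mulmx det_lblock det_ublock !det1 !mul1r det_scalar1.
Qed.

(** Induction by Schur complements: [1 - H] reduces to [1 - H1] with the factor [1 - eta]. As
    [h i 0 ^+ 2 <= eta * H0 i i], one gets [(1 - eta) * \tr H1 <= \tr H0], which is what the
    induction needs. *)
Lemma det_one_minus n (H : 'M[R]_n) : psd H -> \tr H < 1 -> 1 - \tr H <= \det (1%:M - H).
Proof.
elim: n H => [|n IH]; first by move=> H _ _; rewrite det_mx00 /mxtrace big_ord0 subr0.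
rewrite -[n.+1]/(1 + n)%N => H [symH posH].
have [eta etaE] : exists eta : R, ulsubmx H = eta%:M.
  by exists (ulsubmx H 0 0); exact: mx11_scalar.
have [h hE] : exists h, h = dlsubmx H by eexists.
have [H0 H0E] : exists H0, H0 = drsubmx H by eexists.
have hT : ursubmx H = h^T by rewrite hE trmx_dlsub symH.
have HE : H = block_mx eta%:M h^T h H0 by rewrite -etaE -hT hE H0E submxK.
have symH0 : H0^T = H0 by rewrite H0E trmx_drsub symH.
have qE s (x : 'cV[R]_n) : qform H (col_mx s%:M x) =
    s ^+ 2 * eta + 2 * s * (h^T *m x) 0 0 + qform H0 x.
  have xh : (x^T *m h) 0 0 = (h^T *m x) 0 0.
    by rewrite !mxE; apply: eq_bigr => k _; rewrite !mxE mulrC.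
  have E1 : (s%:M *m eta%:M *m s%:M : 'M[R]_1) 0 0 = s ^+ 2 * eta.
    by rewrite -!scalar_mxM mxE eqxx mulr1n; ring.
  have E2 : (x^T *m h *m s%:M) 0 0 = s * (h^T *m x) 0 0 by rewrite mul_mx_scalar mxE xh.
  have E3 : (s%:M *m h^T *m x) 0 0 = s * (h^T *m x) 0 0 by rewrite -mulmxA mul_scalar_mx mxE.
  rewrite /qform HE tr_col_mx tr_scalar_mx mul_row_block mul_row_col !mulmxDl.
  by rewrite mxE [X in X + _]mxE [X in _ + X]mxE E1 E2 E3; ring.
have pos0 x : 0 <= qform H0 x.
  by have := posH (col_mx 0%:M x); rewrite qE expr0n/= mul0r mulr0 mul0r !add0r.
have eta0 : 0 <= eta.
  have := posH (col_mx 1%:M 0); rewrite qE mulmx0 !mxE mulr0 addr0 expr1n mul1r.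
  by rewrite qformE big1 ?addr0// => i _; rewrite big1// => j _; rewrite !mxE mul0r mul0r.
have trE : \tr H = eta + \tr H0.
  rewrite HE mxtrace_block; congr (_ + _); by rewrite mxtrace_scalar.
have hi i : h i 0 ^+ 2 <= eta * H0 i i.
  apply: discriminant => // s; have := posH (col_mx s%:M (delta_mx i 0)); rewrite qE.
  congr (0 <= _ + _ + _).
    congr (_ * _); rewrite -colE; by rewrite !mxE.
  by rewrite /qform trmx_delta -rowE -colE !mxE.
have H00 i : 0 <= H0 i i.
  by have := pos0 (delta_mx i 0); rewrite /qform trmx_delta -rowE -colE !mxE.
have t0 : 0 <= \tr H0 by apply: sumr_ge0.
rewrite trE => tr1; have e1 : 0 < 1 - eta by lra.
have -> : \det (1%:M - H) = (1 - eta) * \det (1%:M - (H0 + (1 - eta)^-1 *: (h *m h^T))).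
  rewrite HE (scalar_mx_block 1 n 1%R) opp_block_mx add_block_mx.
  rewrite (_ : 1%:M - eta%:M = (1 - eta)%:M); last by rewrite raddfB.
  rewrite !add0r det_schur ?gt_eqF// mulmxN mulNmx opprK; congr (_ * \det _).
  by rewrite opprD addrA.
pose H1 := H0 + (1 - eta)^-1 *: (h *m h^T).
have tr1E : \tr H1 = \tr H0 + (1 - eta)^-1 * \sum_i h i 0 ^+ 2.
  rewrite /H1 mxtraceD mxtraceZ; congr (_ + _ * _); apply: eq_bigr => i _.
  by rewrite mxE big_ord1 mxE expr2.
have sh : \sum_i h i 0 ^+ 2 <= eta * \tr H0.
  by rewrite /mxtrace mulr_sumr; apply: ler_sum => i _; exact: hi.
have tr1le : (1 - eta) * \tr H1 <= \tr H0.
  by rewrite tr1E mulrDr mulVKf ?gt_eqF//; lra.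
have tr11 : \tr H1 < 1 by rewrite -(ltr_pM2l e1) mulr1; lra.
have psd1 : psd H1.
  split; first by rewrite /H1 raddfD/= linearZ/= trmx_mul trmxK symH0.
  move=> x; have -> : qform H1 x = qform H0 x + (1 - eta)^-1 * ((h^T *m x) 0 0) ^+ 2.
    rewrite /qform /H1 mulmxDr mulmxDl mxE; congr (_ + _).
    rewrite -scalemxAr -scalemxAl mxE; congr (_ * _).
    rewrite (_ : x^T *m (h *m h^T) *m x = (x^T *m h) *m (h^T *m x)); last by rewrite !mulmxA.
    rewrite mxE big_ord1 expr2; congr (_ * _).
    by rewrite !mxE; apply: eq_bigr => k _; rewrite !mxE mulrC.
  by rewrite addr_ge0// mulr_ge0 ?sqr_ge0// invr_ge0 ltW.
have := IH H1 psd1 tr11; rewrite -/H1 => hd.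
have : (1 - eta) * (1 - \tr H1) <= (1 - eta) * \det (1%:M - H1) by rewrite ler_pM2l.
lra.
Qed.

End Det.

(** * Change of variables for linear maps *)

Section LinearMaps.
Import fingroup.fingroup fingroup.perm GRing.Theory.
Context {R : realType}.
Local Notation W := (Romega R).

Definition act M (A : 'M[R]_M) (x : W) : W := fun j =>
  if insub j is Some j' then \sum_(i < M) A j' i * x i else x j.

Lemma act_in M (A : 'M[R]_M) x (j : 'I_M) : act A x j = \sum_(i < M) A j i * x i.
Proof. by rewrite /act valK. Qed.

Lemma act_out M (A : 'M[R]_M) x j : (M <= j)%N -> act A x j = x j.
Proof. by move=> Mj; rewrite /act insubF// ltnNge Mj. Qed.

Lemma eq_coords M (x y : W) : (forall j : 'I_M, x j = y j) ->
  (forall j, (M <= j)%N -> x j = y j) -> x = y.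
Proof.
by move=> h1 h2; apply/funext => j; have [jM|/h2//] := ltnP j M; exact: (h1 (Ordinal jM)).
Qed.

Lemma act_mul M (A C : 'M[R]_M) : act (A *m C) = act A \o act C.
Proof.
apply/funext => x; apply: (@eq_coords M) => j; last by move=> Mj; rewrite /= !act_out.
rewrite /= !act_in; under [RHS]eq_bigr do rewrite act_in mulr_sumr.
rewrite exchange_big/=; apply: eq_bigr => i _; rewrite mxE mulr_suml.
by apply: eq_bigr => k _; rewrite mulrA.
Qed.

(** A stage of the computation of [act A] in place: the coordinates in [S] are already new, the
    others still old. Adding one coordinate is an elementary map if its row reads nothing from
    [S]. *)
Definition part M (A : 'M[R]_M) (S : pred nat) (x : W) : W := fun j => if S j then act A x j else x j.

Lemma eq_part M (A : 'M[R]_M) (S S' : pred nat) : (forall j, (j < M)%N -> S j = S' j) -> part A S = part A S'.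
Proof.
move=> h; apply/funext => x; apply/funext => j; rewrite /part.
have [jM|Mj] := ltnP j M; first by rewrite h.
by rewrite act_out// !if_same.
Qed.

Lemma partT M (A : 'M[R]_M) : part A xpredT = act A.
Proof. by []. Qed.

Lemma part0 M (A : 'M[R]_M) : part A xpred0 = id.
Proof. by []. Qed.

Lemma part_step M (A : 'M[R]_M) (S : pred nat) (k : 'I_M) : ~~ S k -> (forall i : 'I_M, S i -> A k i = 0) ->
  part A (fun j => (j == k) || S j) =
  elementary k (A k k) (fun x => \sum_(i < M | i != k) A k i * x i) \o part A S.
Proof.
move=> Sk A0; apply/funext => x; apply/funext => j; rewrite /= /elementary updE /part.
have [->|jk] := eqVneq j k; last by [].
rewrite /= (negbTE Sk) act_in (bigD1 k)//=; congr (_ + _); apply: eq_bigr => i _.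
by case: ifP => // /A0 ->; rewrite !mul0r.
Qed.

Lemma scales_part M (A : 'M[R]_M) (S : pred nat) (k : 'I_M) c : ~~ S k -> (forall i : 'I_M, S i -> A k i = 0) ->
  A k k != 0 -> scales M (part A S) c ->
  scales M (part A (fun j => (j == k) || S j)) (`|A k k| * c).
Proof.
move=> Sk A0 Akk hS; rewrite part_step//; apply: scales_comp => //; apply: scales_elementary => //.
  rewrite (_ : (fun x : W => _) = (fun x : W => \sum_(i < M) (if i != k then A k i * x i else 0))); last first.
    by apply/funext => x; rewrite big_mkcond.
  apply: measurable_sum => i; case: (i != k); last exact: measurable_cst.
  by apply: measurable_funM; [exact: measurable_cst|exact: measurable_coord].
by move=> x s; apply: eq_bigr => i ik; rewrite updE ifN.
Qed.

(** The rows are computed from the first one on, since row [k] reads only coordinates from [k]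
    on. *)
Lemma scales_upper m (A : 'M[R]_m.+1) : (forall i j : 'I_m.+1, (j < i)%N -> A i j = 0) ->
  (forall i, A i i != 0) -> scales m.+1 (act A) (\prod_i `|A i i|).
Proof.
move=> up d0.
have H k : (k <= m.+1)%N ->
    scales m.+1 (part A (fun j => (j < k)%N)) (\prod_(i < k) `|A (inord i) (inord i)|).
  elim: k => [_|k IH km].
    rewrite big_ord0 (@eq_part _ _ _ xpred0)// part0; exact: scales_id.
  rewrite big_ord_recr/= mulrC.
  rewrite (@eq_part _ _ _ (fun j => (j == @inord m k) || (j < k)%N)); last first.
    by move=> j _; rewrite inordK// ltnS leq_eqVlt.
  apply: scales_part; rewrite ?inordK ?ltnn//; last exact: IH (ltnW km).
  by move=> i ik; apply: up; rewrite inordK.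
rewrite (_ : \prod_i `|A i i| = \prod_(i < m.+1) `|A (inord i) (inord i)|); last first.
  by apply: eq_bigr => i _; rewrite inord_val.
by have := H m.+1 (leqnn _); rewrite (@eq_part _ _ _ xpredT) => [|j ->].
Qed.

(** The rows are computed from the last one back. *)
Lemma scales_lower m (A : 'M[R]_m.+1) : (forall i j : 'I_m.+1, (i <= j)%N -> A i j = (i == j)%:R) ->
  scales m.+1 (act A) 1.
Proof.
move=> low.
have H k : (k <= m.+1)%N -> scales m.+1 (part A (fun j => (m.+1 - k <= j)%N)) 1.
  elim: k => [_|k IH km].
    rewrite (@eq_part _ _ _ xpred0); first exact: scales_id.
    by move=> j jm; rewrite subn0 leqNgt jm.
  have lt : (m.+1 - k.+1 < m.+1)%N by lia.
  rewrite (@eq_part _ _ _ (fun j => (j == Ordinal lt) || (m.+1 - k <= j)%N)); last first.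
    by move=> j _ /=; apply/idP/orP => [h|[/eqP ->|h]]; [case: (eqVneq j (m.+1 - k.+1)%N) => ?; [left|right]; lia|lia|lia].
  have d1 : A (Ordinal lt) (Ordinal lt) = 1 by rewrite low// eqxx.
  have -> : 1 = `|A (Ordinal lt) (Ordinal lt)| * 1 by rewrite d1 normr1 mulr1.
  apply: scales_part; last exact: IH (ltnW km).
  - by rewrite /=; lia.
  - move=> i hi; have ne : (Ordinal lt == i) = false.
      by apply/negbTE; rewrite -val_eqE/=; move: hi; clear -km; lia.
    have le : (Ordinal lt <= i)%N by move: hi; clear -km; rewrite /=; lia.
    by rewrite (low _ _ le) ne.
  - by rewrite d1 oner_neq0.
have := H m.+1 (leqnn _); rewrite (@eq_part _ _ _ xpredT) ?partT// => j _.
by rewrite subnn.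
Qed.

Definition permute_coords M (s : 'S_M) (x : W) : W := fun j =>
  if insub j is Some j' then x (s j') else x j.

Lemma permute_in M (s : 'S_M) x (j : 'I_M) : permute_coords s x j = x (s j).
Proof. by rewrite /permute_coords valK. Qed.

Lemma permute_out M (s : 'S_M) x j : (M <= j)%N -> permute_coords s x j = x j.
Proof. by move=> Mj; rewrite /permute_coords insubF// ltnNge Mj. Qed.

(** Three shears and a reflection: (x, y), (x + y, y), (x + y, -x), (y, -x), (y, x). *)
Lemma scales_swap M (i k : 'I_M) : i != k -> scales M (permute_coords (tperm i k)) 1.
Proof.
move=> ik; have ik' : (k == i :> nat) = false by apply/negbTE; rewrite eq_sym.
have ik2 : (i == k :> nat) = false by apply/negbTE.
pose E1 := elementary i 1 (fun x : W => x k).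
pose E2 := elementary k 1 (fun x : W => - x i).
pose E4 := elementary k (-1) (fun=> (0 : R)).
have -> : permute_coords (tperm i k) = E4 \o (E1 \o (E2 \o E1)).
  apply/funext => x; apply: (@eq_coords M) => j; last first.
    move=> Mj; rewrite permute_out// /= /E4 /E1 /E2 /elementary !updE.
    by rewrite !gtn_eqF// (leq_trans _ Mj).
  rewrite permute_in /= /E4 /E1 /E2 /elementary !updE !eqxx ik' ik2.
  case: tpermP => [->|->|ji jk].
  - rewrite ik2 eqxx; ring.
  - rewrite eqxx; ring.
  - have ji' : (j == i :> nat) = false by apply/negbTE/eqP => /val_inj/ji.
    have jk' : (j == k :> nat) = false by apply/negbTE/eqP => /val_inj/jk.
    by rewrite ji' jk'.
have m1 : measurable_fun setT (fun x : W => - x i).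
  by apply: measurableT_comp => //; exact: measurable_coord.
have e1 : scales M E1 `|1|.
  apply: scales_elementary; [exact: ltn_ord|exact: oner_neq0|exact: measurable_coord|].
  by move=> x s; rewrite updE ik'.
have e2 : scales M E2 `|1|.
  apply: scales_elementary; [exact: ltn_ord|exact: oner_neq0|exact: m1|].
  by move=> x s; rewrite updE ik2.
have e4 : scales M E4 `|- 1|.
  apply: scales_elementary; [exact: ltn_ord|by rewrite oppr_eq0 oner_neq0|exact: measurable_cst|by []].
have := scales_comp e4 (scales_comp e1 (scales_comp e2 e1)).
by rewrite normrN normr1 !mulr1.
Qed.

Lemma scales_permute M (s : 'S_M) : scales M (permute_coords s) 1.
Proof.
have [ts -> dts] := prod_tpermP s; elim: ts dts => [_|[i k] ts IH] /=.
  rewrite big_nil (_ : permute_coords 1%g = id); first exact: scales_id.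
  by apply/funext => x; apply: (@eq_coords M) => j; [rewrite permute_in perm1|move=> ?; rewrite permute_out].
move=> /andP[ik dts]; rewrite big_cons -[1]mulr1.
rewrite (_ : permute_coords _ = permute_coords (tperm i k) \o permute_coords (\prod_(t <- ts) tperm t.1 t.2)%g).
  by apply: scales_comp; [exact: scales_swap|exact: IH].
apply/funext => x; apply: (@eq_coords M) => j; last by move=> Mj; rewrite /= !permute_out.
by rewrite /= !permute_in permM.
Qed.

Lemma scales_act m (A : 'M[R]_m.+1) : \det A != 0 -> scales m.+1 (act A) `|\det A|.
Proof.
have := cormen_lup_correct A; have := @cormen_lup_upper _ _ A; have := @cormen_lup_lower _ _ A.
have := cormen_lup_detL A; have := cormen_lup_perm A.
case: (cormen_lup A) => [[P L] U] /= /is_perm_mxP[s ->] dL low up PA dA.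
have {}PA : perm_mx s *m A = L *m U by exact: PA.
have upT : is_trig_mx U^T by apply/is_trig_mxP => i j ij; rewrite mxE up.
have dU : \det U = \prod_i U i i.
  by rewrite -det_tr det_trig//; apply: eq_bigr => i _; rewrite mxE.
have detA : `|\det A| = \prod_i `|U i i|.
  have : \det (perm_mx s *m A) = \det (L *m U) by rewrite PA.
  rewrite !det_mulmx dL mul1r det_perm => /(congr1 (fun z : R => `|z|)).
  by rewrite normrM normrX normrN1 expr1n mul1r dU normr_prod.
have U0 i : U i i != 0.
  move: dA; rewrite -normr_gt0 detA => h; apply/eqP => Ui.
  by move: h; rewrite (bigD1 i)//= Ui normr0 mul0r ltxx.
have -> : act A = permute_coords s^-1%g \o (act L \o act U).
  rewrite -act_mul -PA; apply/funext => x; apply: (@eq_coords m.+1) => j; last first.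
    by move=> Mj; rewrite /= permute_out// !act_out.
  rewrite /= permute_in !act_in; apply: eq_bigr => i _.
  by rewrite -row_permE mxE permKV.
rewrite detA -[\prod_i _]mul1r -[\prod_i _]mul1r.
apply: scales_comp; first exact: scales_permute.
by apply: scales_comp; [exact: scales_lower|exact: scales_upper].
Qed.

End LinearMaps.

(** * Volume of the image through finite corners *)

Section Volume.
Context {R : realType}.
Local Notation T := {ptws nat -> R}.
Local Notation W := (Romega R).
Local Notation lam := (@lebesgue_measure R).
Variable P : probability W R.
Hypothesis P_prod : is_product_lebesgue P.

Definition ind (X : set W) (x : W) : \bar R := (\1_X x)%:E.

Lemma nnmeasurable_ind X : measurable X -> nnmeasurable (ind X).
Proof.
move=> mX; split; last by move=> x; rewrite lee_fin.
by apply/measurable_EFinP; exact: measurable_indic.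
Qed.

Lemma ind_out X x : ~ X x -> ind X x = 0%E.
Proof. by move=> h; rewrite /ind indicE memNset. Qed.

Lemma ind_in X x : X x -> ind X x = 1%E.
Proof. by move=> h; rewrite /ind indicE mem_set. Qed.

(** Since [X] lies over the unit cube in these coordinates, integrating over the line or over [0, 1]
    is the same, and [integral_resample] applies to each coordinate. *)
Lemma pr_Jint M (X : set W) : measurable X ->
  (forall z, X z -> forall i, (i < M)%N -> z i \in `[0, 1]) ->
  (\int[P]_x Jint M (ind X) x = (pr P X)%:E)%E.
Proof.
move=> mX; have nX := nnmeasurable_ind mX; elim: M => [_|M IH h] /=.
  by rewrite integral_indic// setIT; exact: prE.
have [mJ J0] := nnmeasurable_Jint M nX.
rewrite -IH; last by move=> z Xz i iM; exact: h (ltnW iM).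
rewrite (integral_resample P_prod M mJ J0); apply: eq_integral => x _.
rewrite /coord_integral [RHS]integral_mkcond; apply: eq_integral => s _.
rewrite patchE; case: ifPn => // /negP sn; apply: Jint0 => // y hy; apply: ind_out => Xy.
apply: sn; apply/mem_set; have := h y Xy M (ltnSn M).
by rewrite hy// updE eqxx.
Qed.

Lemma Jint_local M k (g : W -> \bar R) x x' : nnmeasurable g ->
  (forall y y', (forall i, (i < M)%N -> y i = y' i) -> g y = g y') ->
  (forall i, (k <= i)%N -> (i < M)%N -> x i = x' i) -> Jint k g x = Jint k g x'.
Proof.
move=> hg hM; elim: k x x' => [|k IH] x x' e /=; first by apply: hM => i; exact: e.
apply: eq_integral => s _; apply: IH => i ki iM; rewrite !updE; case: eqP => // /eqP ik.
by apply: e => //; rewrite ltn_neqAle eq_sym ik ki.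
Qed.

Lemma heavy_slice M (X : set W) (m : R) : measurable X ->
  (forall z, X z -> forall i, (i < M)%N -> z i \in `[0, 1]) -> 0 <= m -> m < pr P X ->
  exists x, (m%:E < Jint M (ind X) x)%E.
Proof.
move=> mX X01 m0 mP; apply: contrapT => hno.
have nJ := nnmeasurable_Jint M (nnmeasurable_ind mX).
have : (\int[P]_x Jint M (ind X) x <= \int[P]_x (cst m%:E) x)%E.
  apply: ge0_le_integral => //; first by move=> x _; case: nJ.
  - by case: nJ.
  - by move=> x _; rewrite leNgt; apply/negP => h; apply: hno; exists x.
rewrite pr_Jint// integral_cst// [X in (_ * X)%E](_ : _ = 1%E) ?mule1; last exact: probability_setT.
by rewrite lee_fin leNgt mP.
Qed.

Definition translate M (k : nat -> R) (x : W) : W := fun j => if (j < M)%N then x j + k j else x j.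

Lemma scales_translate M k : scales M (translate M k) 1.
Proof.
have H l : (l <= M)%N -> scales M (translate l k) 1.
  elim: l => [_|l IH lM]; first by rewrite (_ : translate 0 k = id); [exact: scales_id|exact/funext].
  have -> : translate l.+1 k = elementary l 1 (fun=> k l) \o translate l k.
    apply/funext => x; apply/funext => j; rewrite /elementary /= updE /translate ltnS leq_eqVlt.
    by case: eqP => [->|//]; rewrite ltnn mul1r.
  have mk : measurable_fun setT (fun _ : W => k l) by exact: measurable_cst.
  have := scales_comp (scales_elementary lM (oner_neq0 R) mk (fun _ _ => erefl)) (IH (ltnW lM)).
  by rewrite normr1 mulr1.
exact: H.
Qed.

Variable a : nat -> R.
Hypothesis a_gt0 : forall i, 0 < a i.
Hypothesis a_sum : cvgn (series (fun i : nat => a i ^+ 2)).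
Variables (B : set T) (sigma : W -> W).
Hypothesis mB : measurable (B : set W).
Hypothesis cong : congruence a (B : set W) sigma.
Hypothesis S_closed : closed (sigma @` B : set T).
Variables p p' : nat -> W.
Hypothesis Bp : forall i, B (p i).
Hypothesis Bp' : forall i, B (p' i).
Hypothesis p_off : forall i k, k != i -> p i k = p' i k.
Hypothesis p_on : forall i, p i i != p' i i.
Local Notation u := (column a sigma p p').

Definition umx M : 'M[R]_M := \matrix_(j, i) u j i.

(** [1 - u^T u] is positive semidefinite because cutting off rows of an isometry can only shorten
    vectors, and its trace is the defect. So the square of the determinant is at least [1 - k],
    which passes to its absolute value. *)
Lemma det_umx M (k : R) : k < 1 -> defect (fun j i => u j i ^+ 2) M <= k -> 1 - k <= `|\det (umx M)|.
Proof.
move=> k1 dk; pose H := 1%:M - (umx M)^T *m umx M.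
have trH : \tr H = defect (fun j i => u j i ^+ 2) M.
  apply: eq_bigr => i _; rewrite !mxE eqxx; congr (_ - _); apply: eq_bigr => j _.
  by rewrite !mxE expr2.
have psdH : psd H.
  split; first by rewrite /H linearB/= trmx1 trmx_mul trmxK.
  move=> x; have -> : qform H x = \sum_i x i 0 ^+ 2 - \sum_j ((umx M *m x) j 0) ^+ 2.
    have e (n : nat) (y : 'cV[R]_n) : (y^T *m y) 0 0 = \sum_i y i 0 ^+ 2.
      by rewrite mxE; apply: eq_bigr => i _; rewrite mxE expr2.
    rewrite -!e /qform /H mulmxBr mulmxBl mulmx1 [in LHS]mxE; congr (_ + _).
    by rewrite mxE trmx_mul !mulmxA.
  pose c i := if insub i is Some i' then x i' 0 else 0.
  have cE (i : 'I_M) : c i = x i 0 by rewrite /c valK.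
  rewrite subr_ge0; have orth : forall i k, sums (fun j => u j i * u j k) (i == k)%:R.
    by move=> i l; exact: (column_orth a_gt0 a_sum cong Bp Bp' p_off p_on).
  have hs : sums (fun j => (\sum_(i < M) u j i * c i) ^+ 2) (\sum_(i < M) c i ^+ 2) by exact: sums_comb.
  have F0 j : 0 <= (\sum_(i < M) u j i * c i) ^+ 2 by exact: sqr_ge0.
  have := @sums_ge _ _ _ M F0 hs; congr (_ <= _).
    apply: eq_bigr => j _; rewrite mxE; congr (_ ^+ 2).
    by apply: eq_bigr => i _; rewrite mxE cE.
  by apply: eq_bigr => i _; rewrite cE.
have := det_one_minus psdH; rewrite trH => /(_ (le_lt_trans dk k1)).
rewrite (_ : 1%:M - H = (umx M)^T *m umx M); last by rewrite /H opprB addrC subrK.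
rewrite det_mulmx det_tr => h.
have h2 : 1 - k <= `|\det (umx M)| ^+ 2 by rewrite real_normK ?num_real// expr2; lra.
rewrite leNgt; apply/negP => hlt; have n0 := normr_ge0 (\det (umx M)).
have [d0 | d0] := leP 0 (defect (fun j i => u j i ^+ 2) M).
  have : `|\det (umx M)| ^+ 2 <= `|\det (umx M)| * 1.
    by rewrite expr2; apply: ler_wpM2l => //; lra.
  by lra.
move: d0; rewrite ltNge => /negP; apply; apply: sumr_ge0 => i _; rewrite subr_ge0.
have hs : sums (fun j => u j i * u j i) (i == i :> nat)%:R.
  exact: (column_orth a_gt0 a_sum cong Bp Bp' p_off p_on).
rewrite eqxx in hs; have F0 j : 0 <= u j i * u j i by rewrite -expr2 sqr_ge0.
by apply: le_trans (@sums_ge _ _ _ M F0 hs); apply: ler_sum => j _; rewrite expr2.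
Qed.

Definition rmx M : 'M[R]_M := \matrix_(j, i) (u j i * (a i / a j)).

Lemma det_rmx M : \det (rmx M) = \det (umx M).
Proof.
have -> : rmx M = diag_mx (\row_i (a i)^-1) *m umx M *m diag_mx (\row_i a i).
  apply/matrixP => j i; rewrite mul_mx_diag mxE [in RHS]mul_diag_mx !mxE; field; by rewrite gt_eqF.
rewrite !det_mulmx !det_diag mulrAC -big_split/= big1 ?mul1r// => i _.
by rewrite !mxE mulVf// gt_eqF.
Qed.

(** A cylinder over the first [M] coordinates; the later coordinates of [sigma y], which vary along
    a slice of [B], are thereby ignored. *)
Definition shadow M : set W := thicken (sigma @` B) M `&` rectangle M (fun=> `[0, 1]%classic).

Lemma measurable_shadow M : measurable (shadow M).
Proof.
apply: measurableI; first exact: measurable_thicken.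
by apply: rectangle_measurable => i; exact: measurable_itv.
Qed.

Lemma shadow_local M y y' : (forall i, (i < M)%N -> y i = y' i) -> ind (shadow M) y = ind (shadow M) y'.
Proof.
move=> e; rewrite /ind !indicE; congr (_%:R%:E); congr nat_of_bool; apply/idP/idP => /set_mem[[z Sz h1] h2];
  apply/mem_set; split.
- by exists z => // i iM; rewrite -e//; exact: h1.
- by move=> i iM; rewrite -e//; exact: h2.
- by exists z => // i iM; rewrite e//; exact: h1.
- by move=> i iM; rewrite e//; exact: h2.
Qed.

(** Some tail [x] has a slice of [B] of volume above [l]. On this slice the first [M] coordinates of
    [sigma] are an affine map with linear part [rmx M], and it sends the slice into the shadow. *)
Lemma shadow_volume m (l : R) : 0 <= l -> l < pr P B -> \det (umx m.+1) != 0 ->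
  `|\det (umx m.+1)| * l <= pr P (shadow m.+1).
Proof.
set M := m.+1 => l0 lB dn0; have [BK sK _] := cong.
have B01 z : B z -> forall i, (i < M)%N -> z i \in `[0, 1] by move=> Bz i _; exact: BK.
have [x hx] := heavy_slice mB B01 l0 lB.
have nB := nnmeasurable_ind mB.
have [y0 [By0 y0x]] : exists y0, B y0 /\ forall i, (M <= i)%N -> y0 i = x i.
  apply: contrapT => hno; move: hx; rewrite Jint0//; last first.
    by move=> y yx; apply: ind_out => By; apply: hno; exists y.
  by rewrite lte_fin ltNge l0.
(* The translation that makes [phi] agree with [sigma] at [y0] in the first [M] coordinates. *)
pose k j := sigma y0 j - \sum_(i < M) (u j i * (a i / a j)) * y0 i.
pose phi := translate M k \o act (rmx M).
have dr0 : \det (rmx M) != 0 by rewrite det_rmx.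
have := scales_comp (scales_translate M k) (scales_act dr0); rewrite mul1r det_rmx -/phi => -[mphi d0 hphi].
have nD := nnmeasurable_ind (measurable_shadow M).
have phiE y j : B y -> (forall i, (M <= i)%N -> y i = x i) -> (j < M)%N -> phi y j = sigma y j.
  move=> By yx jM; have yy0 i : (M <= i)%N -> y i = y0 i by move=> Mi; rewrite yx// y0x.
  have lin := congruence_linear a_gt0 a_sum cong Bp Bp' p_off p_on By By0 yy0 j.
  rewrite /phi /= /translate jM (act_in (rmx M) y (Ordinal jM)) /k.
  have aj : a j != 0 by rewrite gt_eqF.
  apply: (mulfI aj); apply/eqP; rewrite -subr_eq0.
  have -> : a j * (\sum_(i < M) rmx M (Ordinal jM) i * y i +
      (sigma y0 j - \sum_(i < M) u j i * (a i / a j) * y0 i)) - a j * sigma y j =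
    a j * (\sum_(i < M) rmx M (Ordinal jM) i * y i - \sum_(i < M) u j i * (a i / a j) * y0 i) -
    a j * (sigma y j - sigma y0 j) by ring.
  rewrite lin -sumrB mulr_sumr subr_eq0; apply/eqP; apply: eq_bigr => i _.
  by rewrite mxE/=; field.
have le1 : (Jint M (ind B) x <= Jint M (ind (shadow M) \o phi) x)%E.
  apply: Jint_le => //; first exact: nnmeasurable_comp.
  move=> y yx; have [By|By] := pselect (B y); last by rewrite ind_out//; case: nD => _; exact.
  rewrite ind_in//= ind_in//; split.
    exists (sigma y); first by exists y.
    by move=> i iM; rewrite phiE// subrr normr0 invr_gt0.
  by move=> i iM; rewrite phiE//=; exact: (sK _ (imageP sigma By)).
have cst_ x' : Jint M (ind (shadow M)) x' = Jint M (ind (shadow M)) x.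
  apply: (Jint_local (M := M)) => // [y y' e|i Mi iM]; first exact: shadow_local.
  by move: iM; rewrite ltnNge Mi.
have : (\int[P]_x' Jint M (ind (shadow M)) x' = (pr P (shadow M))%:E)%E.
  apply: pr_Jint; first exact: measurable_shadow.
  by move=> z [_ h] i iM; exact: h.
rewrite (_ : (fun x' => _) = cst (Jint M (ind (shadow M)) x)); last by apply/funext => x'; exact: cst_.
rewrite integral_cst// [X in (_ * X)%E](_ : _ = 1%E) ?mule1; last exact: probability_setT.
move=> E; have E' : Jint M (ind (shadow M)) x = (pr P (shadow M))%:E by exact: E.
have H := hphi _ nD x; rewrite -lee_fin -E' -H EFinM; apply: lee_wpmul2l; first by rewrite lee_fin.
exact: le_trans (ltW hx) le1.
Qed.

(** The shadows lie in thickenings of the closed image, whose measures tend to the measure of the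
    image. *)
Lemma volume_le : (forall (k : R) M0, 0 < k -> exists2 M, (M0 <= M)%N & defect (fun j i => u j i ^+ 2) M <= k) ->
  pr P B <= pr P (sigma @` B).
Proof.
move=> small; have mS : measurable (sigma @` B : set W) by exact: closed_measurable.
have key (k l : R) M0 : 0 < k < 1 -> 0 <= l -> l < pr P B ->
    (1 - k) * l <= pr P (thicken (sigma @` B) M0).
  move=> /andP[k0 k1] l0 lB; have [M MM dM] := small k (maxn M0 1) k0.
  have := det_umx k1 dM; move: MM dM; case: M => [|m] MM dM; first by lia.
  move=> hd; have dn : \det (umx m.+1) != 0.
    by apply: contraTneq hd => ->; rewrite normr0 -ltNge; lra.
  apply: (@le_trans _ _ (`|\det (umx m.+1)| * l)); first exact: ler_wpM2r.
  apply: (le_trans (shadow_volume l0 lB dn)); apply: pr_le; [exact: measurable_shadow|exact: measurable_thicken|].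
  move=> z [[y Sy h] _]; exists y => // i iM0.
  apply: lt_le_trans (h i _) _; first by apply: leq_trans iM0 _; lia.
  by rewrite lef_pV2 ?posrE// ler_nat; lia.
have key2 (k l : R) : 0 < k < 1 -> 0 <= l -> l < pr P B -> (1 - k) * l <= pr P (sigma @` B).
  move=> k01 l0 lB; rewrite -lee_fin -prE//.
  have lim := @pr_thicken_lim _ P _ S_closed; rewrite -(cvg_lim _ lim)//.
  apply: lime_ge; first by apply/cvg_ex; eexists; exact: lim.
  by apply: nearW => n /=; rewrite prE ?lee_fin; [exact: key|exact: measurable_thicken].
rewrite leNgt; apply/negP => h; have s0 := pr_ge0 P (sigma @` B).
set s := pr P (sigma @` B) in h s0 key2; set b := pr P B in h key2.
have b0 : 0 < b by lra.
(* Small enough that [(1 - k) * ((b + s) / 2)] still exceeds [s] when [s < b]. *)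
pose k := (b - s) / (4 * b); have kb : k * (4 * b) = b - s by rewrite /k; field; rewrite gt_eqF.
have k0 : 0 < k by rewrite divr_gt0//; lra.
have k1 : k < 1 by rewrite ltr_pdivrMr; lra.
have := @key2 k ((b + s) / 2); rewrite k0 k1 => /(_ isT) hk.
have {}hk : (1 - k) * ((b + s) / 2) <= s by apply: hk; lra.
have : k * s <= k * b by rewrite ler_pM2l//; exact: ltW.
lra.
Qed.

End Volume.

(** * Images of Borel sets *)

Section Image.
Context {R : realType}.
Local Notation T := {ptws nat -> R}.
Local Notation W := (Romega R).
Local Notation K := (@hilbert_cube R).
Variable a : nat -> R.
Hypothesis a_gt0 : forall i, 0 < a i.
Hypothesis a_sum : cvgn (series (fun i : nat => a i ^+ 2)).
Local Notation d2 x y := (dist_a a x y ^+ 2).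

Lemma dist_sq_le (z z' w : W) N (S : R) : sums (fun i => a i ^+ 2) S ->
  K z -> K z' -> K w -> near_upto N N.+1%:R^-1 z z' ->
  d2 z w - d2 z' w <= 2 * (S - \sum_(i < N) a i ^+ 2) + 2 * (N.+1%:R^-1 * S).
Proof.
move=> hS Kz Kz' Kw zz'.
set e := N.+1%:R^-1 in zz' *; have e0 : 0 <= e by rewrite /e invr_ge0.
have SN : \sum_(i < N) a i ^+ 2 <= S by apply: (sums_ge N _ hS) => j; exact: sqr_ge0.
have hD := sumsB (sums_dist a_sum Kz Kw) (sums_dist a_sum Kz' Kw).
have hC := sums_finite (f := fun j => if (j < N)%N then 2 * (1 - e) * a j ^+ 2 else 0) (N := N).
have {hC} := hC (fun j Nj => ifN _ _ (negbT (leq_gtF Nj))).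
rewrite (eq_bigr (fun j : 'I_N => 2 * (1 - e) * a j ^+ 2)) => [|j _]; last by rewrite ltn_ord.
rewrite -mulr_sumr => hC.
have hB := sumsB (sumsB (sumsZ 2 hS) hC) hD.
have H0 : forall j, 0 <= 2 * a j ^+ 2 - (if (j < N)%N then 2 * (1 - e) * a j ^+ 2 else 0) -
    (a j ^+ 2 * (z j - w j) ^+ 2 - a j ^+ 2 * (z' j - w j) ^+ 2).
  move=> j; have := Kz j; have := Kz' j; have := Kw j; rewrite !in_itv/=.
  move=> /andP[w0 w1] /andP[z'0 z'1] /andP[z0 z1].
  have a2 : 0 <= a j ^+ 2 by exact: sqr_ge0.
  have E : (z j - w j) ^+ 2 - (z' j - w j) ^+ 2 = (z j - z' j) * (z j + z' j - 2 * w j) by ring.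
  have B2 : `|z j + z' j - 2 * w j| <= 2 by rewrite ler_norml; apply/andP; split; lra.
  have bound t : `|z j - z' j| <= t -> 0 <= 2 * t * a j ^+ 2 - (a j ^+ 2 * (z j - w j) ^+ 2 - a j ^+ 2 * (z' j - w j) ^+ 2).
    move=> ht; rewrite -mulrBr E mulrC -mulrBr mulr_ge0// subr_ge0.
    apply: le_trans (ler_norm _) _; rewrite normrM mulrC.
    by apply: ler_pM.
  case: ifPn => jN.
    have := bound e (ltW (zz' j jN)); lra.
  rewrite subr0; have := bound 1; rewrite mulr1; apply.
  by rewrite ler_norml; apply/andP; split; lra.
have := sums_ge 0 H0 hB; rewrite big_ord0.
have : e * \sum_(i < N) a i ^+ 2 <= e * S by rewrite ler_wpM2l.
by lra.
Qed.

(** Uniform continuity of the squared distance for the product topology: the tail of the sum of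
    [a i ^+ 2] controls the late coordinates. *)
Lemma dist_sq_modulus (e : R) : 0 < e -> exists N, forall z z' w : W, K z -> K z' -> K w ->
  near_upto N N.+1%:R^-1 z z' -> `|d2 z w - d2 z' w| <= e.
Proof.
move=> e0; have [S hS] : exists S, sums (fun i => a i ^+ 2) S by exists (limn (series (fun i => a i ^+ 2))).
have S0 : 0 <= S by have := sums_ge 0 (fun j => sqr_ge0 (a j)) hS; rewrite big_ord0.
have e4 : 0 < e / 4 by rewrite divr_gt0.
have [N0 N0P] := sums_near_one hS e4.
pose N1 := Num.bound (4 * S / e).
pose N := maxn N0 N1.
have bnd : 2 * (S - \sum_(i < N) a i ^+ 2) + 2 * (N.+1%:R^-1 * S) <= e.
  have /(_ N (leq_maxl _ _)) := N0P.
  have : N.+1%:R^-1 * S <= e / 4.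
    rewrite mulrC ler_pdivrMr ?ltr0n//.
    have h1 : 4 * S / e < N1%:R by apply: archi_boundP; apply: divr_ge0; [apply: mulr_ge0|exact: ltW].
    have h2 : N1%:R <= N.+1%:R :> R by rewrite ler_nat ltnW// ltnS leq_maxr.
    have := lt_le_trans h1 h2; rewrite ltr_pdivrMr// => h3.
    by move: h3; set n := (N.+1)%:R => ?; lra.
  by move: (N.+1%:R^-1 * S) (\sum_(j < N) a j ^+ 2) => t X; lra.
exists N => z z' w Kz Kz' Kw zz'.
have z'z : near_upto N N.+1%:R^-1 z' z by move=> i iN; rewrite distrC; exact: zz'.
have h1 := dist_sq_le hS Kz Kz' Kw zz'; have h2 := dist_sq_le hS Kz' Kz Kw z'z.
rewrite ler_norml; apply/andP; split.
  by rewrite lerNl opprB; exact: le_trans h2 bnd.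
exact: le_trans h1 bnd.
Qed.

Lemma dist_sq_coord (x y : W) i : K x -> K y -> a i ^+ 2 * (x i - y i) ^+ 2 <= d2 x y.
Proof.
move=> Kx Ky; apply: (@sums_term_le _ (fun j => a j ^+ 2 * (x j - y j) ^+ 2)).
  by move=> j; rewrite mulr_ge0 ?sqr_ge0.
exact: sums_dist.
Qed.

Lemma dist_sq_eq0 (x y : W) : K x -> K y -> (forall e, 0 < e -> d2 x y <= e) -> x = y.
Proof.
move=> Kx Ky h; apply/funext => i; apply/eqP; rewrite -subr_eq0 -sqrf_eq0 eq_le sqr_ge0 andbT.
have a2 : 0 < a i ^+ 2 by rewrite exprn_gt0.
rewrite leNgt; apply/negP => p; have := h (a i ^+ 2 * (x i - y i) ^+ 2 / 2).
have q : 0 < a i ^+ 2 * (x i - y i) ^+ 2 by rewrite mulr_gt0.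
by move=> /(_ (divr_gt0 q (ltr0Sn _ 1))); have := dist_sq_coord i Kx Ky; lra.
Qed.

Lemma dist_sq_refl (x : W) : K x -> d2 x x = 0.
Proof.
move=> Kx; apply: (sums_unique (sums_dist a_sum Kx Kx)).
apply: (@sums_ext _ (fun=> 0)); first by move=> j; rewrite subrr expr0n mulr0.
by have := @sums_finite _ (fun=> 0 : R) 0 (fun _ _ => erefl); rewrite big_ord0.
Qed.

Variables (B : set W) (sigma : W -> W).
Hypothesis cong : congruence a B sigma.

Let BK x : B x -> K x. Proof. by have [h _ _] := cong; exact: h. Qed.
Let sK x : B x -> K (sigma x). Proof. by have [_ h _] := cong => Bx; apply: h; exists x. Qed.

Definition limit_of (x : W) := forall n, exists2 b, B b & near_upto n n.+1%:R^-1 x b.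

(** Extends [sigma] to limit points of [B] through the distances to [B]. These conditions pass to
    limits and keep the relation injective, so closed sets have closed images even when [B] is only
    Borel. *)
Definition graph (x y : W) := [/\ K x, limit_of x, K y & forall b, B b -> d2 y (sigma b) = d2 x b].

Definition image_graph (A : set W) : set W := [set y | exists2 x, A x & graph x y].

Lemma graph_sigma x : B x -> graph x (sigma x).
Proof.
move=> Bx; split; [exact: BK| |exact: sK|].
  by move=> n; exists x => // i _; rewrite subrr normr0 invr_gt0.
by move=> b Bb; have [_ _ sd] := cong; rewrite sd.
Qed.

Lemma graph_fun x y : B x -> graph x y -> y = sigma x.
Proof.
move=> Bx [Kx _ Ky h]; apply: dist_sq_eq0 => //; first exact: sK.
by move=> e e0; rewrite h// dist_sq_refl ?BK//; exact: ltW.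
Qed.

Lemma image_graphE (A : set W) : A `<=` B -> image_graph A = sigma @` A.
Proof.
move=> AB; apply/seteqP; split => [y [x Ax g]|_ [x Ax <-]].
  by exists x => //; rewrite -(graph_fun (AB _ Ax) g).
by exists x => //; apply: graph_sigma; exact: AB.
Qed.

(** A point of [B] close to [x] is equally far from [x'], as both distances equal its distance
    measured from [y] in the image. *)
Lemma graph_inj x x' y : graph x y -> graph x' y -> x = x'.
Proof.
move=> [Kx lx _ h] [Kx' _ _ h'].
apply: dist_sq_eq0 => // e e0; have e9 : 0 < e / 9 by rewrite divr_gt0.
have [N NP] := dist_sq_modulus e9; have [b Bb xb] := lx N.
have Kb := BK Bb.
have h1 : d2 x b <= e / 9.
  by have := NP x b b Kx Kb Kb xb; rewrite dist_sq_refl// subr0; apply: le_trans; exact: ler_norm.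
have h2 : d2 x' b <= e / 9 by rewrite -h'// h.
(* [d2 x x'] is at most [2 (d2 x b + d2 x' b)] termwise. *)
have hs := sumsB (sumsZ 2 (sumsD (sums_dist a_sum Kx Kb) (sums_dist a_sum Kx' Kb)))
  (sums_dist a_sum Kx Kx').
have H0 : forall j, 0 <= 2 * (a j ^+ 2 * (x j - b j) ^+ 2 + a j ^+ 2 * (x' j - b j) ^+ 2) -
    a j ^+ 2 * (x j - x' j) ^+ 2.
  move=> j; rewrite (_ : _ - _ = a j ^+ 2 * ((x j - b j) + (x' j - b j)) ^+ 2); last by ring.
  by rewrite mulr_ge0 ?sqr_ge0.
by have := sums_ge 0 H0 hs; rewrite big_ord0; lra.
Qed.

Lemma near_upto_le (n m : nat) (x y : W) : (n <= m)%N -> near_upto m m.+1%:R^-1 x y -> near_upto n n.+1%:R^-1 x y.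
Proof.
move=> nm h i iN; apply: lt_le_trans (h i (leq_trans iN nm)) _.
by rewrite lef_pV2 ?posrE// ler_nat.
Qed.

Lemma closed_near (A : set T) (x : T) : closed A ->
  (forall n, exists2 y, A y & near_upto n n.+1%:R^-1 x y) -> A x.
Proof. by move=> cA h; rewrite (closed_bigcap_near_upto cA) => n _; exact: h. Qed.

Lemma closed_cube : closed (K : set T).
Proof. by apply: compact_closed; [exact: hausdorff_ptws|exact: cube_compact]. Qed.

(** Preimages of a sequence that converges to [y0] have a cluster point in the compact cube, and the
    distance conditions pass to this point. *)
Lemma closed_image_graph (A : set T) : closed A -> closed (image_graph A : set T).
Proof.
move=> cA y0 hy.
have near_y n : exists yx : W * W, [/\ A yx.2, graph yx.2 yx.1 & near_upto n n.+1%:R^-1 y0 yx.1].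
  have oU : open [set z : T | exists2 y, [set y0] y & near_upto n n.+1%:R^-1 z y].
    exact: (@near_upto_open R [set y0] n n.+1%:R^-1).
  have : nbhs (y0 : T) [set z : T | exists2 y, [set y0] y & near_upto n n.+1%:R^-1 z y].
    by apply: open_nbhs_nbhs; split => //; exists y0 => // i _; rewrite subrr normr0 invr_gt0.
  move=> /hy[z [[x Ax g] [_ -> zy]]]; exists (z, x); split => // i iN.
  by rewrite distrC; exact: zy.
have /choice[yx yxP] := near_y.
pose X n : T := (yx n).2; pose Y n : T := (yx n).1.
have XK n : K (X n) by have [_ [] ] := yxP n.
have [x [Kx clx]] : (K : set T) `&` cluster (X @ \oo) !=set0.
  by apply: cube_compact; exists 0%N => // n _; exact: XK.
have near_x n : exists2 m, (n <= m)%N & near_upto n n.+1%:R^-1 x (X m).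
  have oU : open [set z : T | exists2 y, [set x] y & near_upto n n.+1%:R^-1 z y].
    exact: (@near_upto_open R [set x] n n.+1%:R^-1).
  have nU : nbhs (x : T) [set z : T | exists2 y, [set x] y & near_upto n n.+1%:R^-1 z y].
    by apply: open_nbhs_nbhs; split => //; exists x => // i _; rewrite subrr normr0 invr_gt0.
  have fU : (X @ \oo) [set z | exists2 m, (n <= m)%N & z = X m].
    by exists n => // m /= nm; exists m.
  have [z [[m nm ->] [_ -> zx]]] := clx _ _ fU nU.
  by exists m => // i iN; rewrite distrC; exact: zx.
have Ax : A x.
  apply: closed_near => // n; have [m _ h] := near_x n; exists (X m) => //.
  by have [] := yxP m.
have Ky0 : K y0.
  apply: closed_near; first exact: closed_cube.
  move=> n; exists (Y n); first by have [_ [] ] := yxP n.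
  by have [] := yxP n.
exists x => //; split => // [n|b Bb].
  (* Two errors of 1/(2n + 2) add up to the allowed 1/(n + 1). *)
  have [m nm h] := near_x (n.*2.+1)%N.
  have [_ [_ lx _ _] _] := yxP m; have [b Bb xb] := lx (n.*2.+1)%N.
  exists b => // i iN; have in2 : (i < n.*2.+1)%N by lia.
  have := ler_distD (X m i) (x i) (b i); have := h i in2; have := xb i in2.
  have : n.*2.+2%:R^-1 + n.*2.+2%:R^-1 = n.+1%:R^-1 :> R.
    by rewrite -doubleS -muln2 natrM; field; rewrite nat1r pnatr_eq0.
  rewrite /X; move: (n.*2.+2%:R^-1 : R) (n.+1%:R^-1 : R) => q r.
  by move: `|x i - b i| `|x i - _| `|_ - b i| => A1 A2 A3; lra.
apply/eqP; rewrite -subr_eq0 -normr_le0; apply/ler_addgt0Pr => e e0; rewrite add0r.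
have e2 : 0 < e / 2 by rewrite divr_gt0.
have [N NP] := dist_sq_modulus e2; have [m Nm xm] := near_x N.
have [_ [_ _ Ym gm] ym] := yxP m.
have h1 := NP y0 (Y m) (sigma b) Ky0 Ym (sK Bb) (near_upto_le Nm ym).
have h2 := NP x (X m) b Kx (XK m) (BK Bb) xm.
have g : d2 (Y m) (sigma b) = d2 (X m) b by exact: gm.
have -> : d2 y0 (sigma b) - d2 x b = (d2 y0 (sigma b) - d2 (Y m) (sigma b)) - (d2 x b - d2 (X m) b).
  by rewrite g; ring.
by apply: le_trans (ler_normB _ _) _; lra.
Qed.

Lemma image_graphC (A : set W) : image_graph (~` A) = image_graph setT `\` image_graph A.
Proof.
apply/seteqP; split => [y [x Ax g]|y [[x _ g] nA]].
  by split; [exists x|move=> [x' Ax' g']; apply: Ax; rewrite (graph_inj g g')].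
by exists x => // Ax; apply: nA; exists x.
Qed.

(** By injectivity the image of a complement is a difference of images, so the sets with measurable
    image form a sigma-algebra that contains the closed sets. *)
Lemma measurable_image_graph (A : set W) : measurable A -> measurable (image_graph A).
Proof.
have mT : measurable (image_graph setT) by apply: closed_measurable; apply: closed_image_graph; exact: closedT.
move=> mA; suff sub : <<s (@open T) >> `<=` [set X : set W | measurable (image_graph X)] by exact: sub mA.
apply: smallest_sub; last first.
  move=> O oO; have -> : O = ~` ~` O by rewrite setCK.
  rewrite /= image_graphC; apply: measurableD => //; apply: closed_measurable.
  by apply: closed_image_graph; rewrite closedC.
split => /=.
- rewrite (_ : image_graph set0 = set0); first exact: measurable0.
  by rewrite -subset0 => y [x].
- by move=> X mX; rewrite setTD image_graphC; apply: measurableD.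
- move=> X mX; rewrite (_ : image_graph _ = \bigcup_k image_graph (X k)); first exact: bigcupT_measurable.
  apply/seteqP; split => [y [x [k _ Xk] g]|y [k _ [x Xk g]]]; first by exists k => //; exists x.
  by exists x => //; exists k.
Qed.

Lemma measurable_image : measurable B -> measurable (sigma @` B).
Proof. by move=> mB; rewrite -image_graphE//; exact: measurable_image_graph. Qed.

Lemma closed_image (A : set T) : closed A -> (A : set W) `<=` B -> closed (sigma @` A : set T).
Proof. by move=> cA AB; rewrite -image_graphE//; exact: closed_image_graph. Qed.

End Image.

(** * Reduction to the monotone closed case *)

Section Regularity.
Context {R : realType}.
Local Notation T := {ptws nat -> R}.
Local Notation W := (Romega R).
Variable P : probability W R.

Lemma pr_bigcap_ge (F : nat -> set W) (l : R) : (forall n, measurable (F n)) ->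
  (forall n, F n.+1 `<=` F n) -> (forall n, l <= pr P (F n)) -> l <= pr P (\bigcap_n F n).
Proof.
move=> mF dF h; have mI : measurable (\bigcap_n F n) by exact: bigcapT_measurable.
have lim : (P \o F) n @[n --> \oo] --> P (\bigcap_n F n).
  apply: nonincreasing_cvg_mu => //.
  - by apply: le_lt_trans (probability_le1 P (mF 0%N)) (ltry _).
  - by apply/nonincreasing_seqP => n; rewrite subsetEset; exact: dF.
rewrite -lee_fin -prE// -(cvg_lim _ lim)//; apply: lime_ge.
  by apply/cvg_ex; eexists; exact: lim.
by apply: nearW => n /=; rewrite prE// lee_fin.
Qed.

(** Approximates [A] and its complement from inside at the same time, which makes the property
    symmetric under complements. *)
Definition squeezed (A : set W) := measurable A /\ forall d : R, 0 < d -> exists F F' : set T,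
  [/\ closed F, closed F', F `<=` A, F' `<=` ~` A & pr P (~` (F `|` F')) <= d].

Lemma squeezedC A : squeezed A -> squeezed (~` A).
Proof.
move=> [mA h]; split; first exact: measurableC.
move=> d d0; have [F [F' [cF cF' FA F'A hd]]] := h d d0.
by exists F', F; split => //; [rewrite setCK|rewrite setUC].
Qed.

Lemma squeezed_closed (A : set T) : closed A -> squeezed A.
Proof.
move=> cA; have mA : measurable (A : set W) by exact: closed_measurable.
split => // d d0; apply: contrapT => hno.
have [n hn] : exists n, pr P (thicken A n `&` ~` A) <= d.
  apply: contrapT => hn.
  have : d <= pr P (\bigcap_n (thicken A n `&` ~` A)).
    apply: pr_bigcap_ge => n.
    - by apply: measurableI; [exact: measurable_thicken|exact: measurableC].
    - move=> x [[y Ay xy] nA]; split => //; exists y => //.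
      by apply: near_upto_le xy; exact: leqnSn.
    - by rewrite leNgt; apply/negP => h; apply: hn; exists n; exact: ltW.
  rewrite (_ : \bigcap_n _ = set0); first by rewrite /pr measure0 /= leNgt d0.
  rewrite -subset0 => x hx; have [_ nA] := hx 0%N I; apply: nA.
  by apply: closed_near => // k; have [] := hx k I.
apply: hno; exists A, (~` thicken A n); split => //.
- by apply: open_closedC; exact: near_upto_open.
- by apply: subsetC => x Ax; exists x => // i _; rewrite subrr normr0 invr_gt0.
- by rewrite setCU setCK setIC.
Qed.

Lemma squeezed_bigcup (A : nat -> set W) : (forall n, squeezed (A n)) -> squeezed (\bigcup_n A n).
Proof.
move=> hA; have mA n : measurable (A n) by case: (hA n).
split; first exact: bigcupT_measurable.
move=> d d0; have d2 : 0 < d / 2 by rewrite divr_gt0.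
have /choice[FF FFP] : forall n, exists FF : set T * set T,
    [/\ closed FF.1, closed FF.2, FF.1 `<=` A n, FF.2 `<=` ~` A n &
    pr P (~` (FF.1 `|` FF.2)) <= d / 2 / (2 ^ n.+1)%:R].
  move=> n; have [_ h] := hA n; have [|F [F' ?]] := h (d / 2 / (2 ^ n.+1)%:R).
    by rewrite divr_gt0// ltr0n expn_gt0.
  by exists (F, F').
pose F n := (FF n).1; pose F' n := (FF n).2.
have cF n : closed (F n) by have [] := FFP n.
have cF' n : closed (F' n) by have [] := FFP n.
have mF n : measurable (F n : set W) by exact: closed_measurable.
have mF' n : measurable (F' n : set W) by exact: closed_measurable.
(* A finite part of the union, since the full union of the closed sets need not be closed. *)
pose G N : set T := \bigcup_(n in `I_N) F n.
have cG N : closed (G N) by apply: closed_bigcup => //; exact: finite_II.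
have mG N : measurable (G N : set W) by exact: closed_measurable.
have mUF : measurable (\bigcup_n F n : set W) by exact: bigcupT_measurable.
have [N hN] : exists N, pr P ((\bigcup_n F n) `&` ~` G N) <= d / 2.
  apply: contrapT => hn.
  have : d / 2 <= pr P (\bigcap_N ((\bigcup_n F n) `&` ~` G N)).
    apply: pr_bigcap_ge => N.
    - by apply: measurableI => //; exact: measurableC.
    - move=> x [hx nG]; split => // -[n nN Fx]; apply: nG; exists n => //=; exact: ltnW.
    - by rewrite leNgt; apply/negP => h; apply: hn; exists N; exact: ltW.
  rewrite (_ : \bigcap_N _ = set0); first by rewrite /pr measure0 /= leNgt d2.
  rewrite -subset0 => x hx; have [[n _ Fx] _] := hx 0%N I; have [_ nG] := hx n.+1 I.
  by apply: nG; exists n => /=.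
exists (G N), (\bigcap_n F' n); split => //.
- by apply: closed_bigI => n _; exact: cF'.
- by move=> x [n _ Fx]; exists n => //; have [_ _ h _ _] := FFP n; exact: h.
- by move=> x hx [n _ Ax]; have [_ _ _ h _] := FFP n; exact: (h x (hx n I)).
pose E n : set W := ~` (F n `|` F' n).
have mE n : measurable (E n) by apply: measurableC; exact: measurableU.
have mUE : measurable (\bigcup_n E n) by exact: bigcupT_measurable.
have hE : pr P (\bigcup_n E n) <= d / 2.
  rewrite -lee_fin -prE//; apply: le_trans (measure_sigma_subadditive P mE mUE (@subset_refl _ _)) _.
  apply: le_trans (epsilon_trick0 xpredT (ltW d2)).
  apply: lee_nneseries => // n _; rewrite [leLHS](_ : _ = (pr P (E n))%:E) ?lee_fin; last exact: prE.
  by have [_ _ _ _] := FFP n.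
apply: (@le_trans _ _ (pr P (\bigcup_n E n) + pr P ((\bigcup_n F n) `&` ~` G N))); last by move: hE hN; lra.
apply: le_trans (prU P mUE _); last by apply: measurableI => //; exact: measurableC.
apply: pr_le; [|by apply: measurableU => //; apply: measurableI => //; exact: measurableC|].
  apply: measurableC; apply: measurableU => //.
  exact: (bigcapT_measurable (F := F' : nat -> set W)).
move=> x; rewrite setCU => -[nG /existsNP[n /not_implyP[_ nF']]].
have [Fx|Fx] := pselect (F n x); [right|left]; first by split => //; exists n.
by exists n => // -[].
Qed.

Lemma borel_squeezed (A : set W) : measurable A -> squeezed A.
Proof.
move=> mA; suff sub : <<s (@open T) >> `<=` [set X : set W | squeezed X] by exact: sub mA.
apply: smallest_sub; last first.
  move=> O oO /=; rewrite -(setCK O); apply: squeezedC.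
  by apply: squeezed_closed; rewrite closedC.
split => /=.
- by apply: squeezed_closed; exact: closed0.
- by move=> X hX; rewrite setTD; exact: squeezedC.
- exact: squeezed_bigcup.
Qed.

Lemma inner_closed (A : set W) (d : R) : measurable A -> 0 < d ->
  exists F : set T, [/\ closed F, F `<=` A & pr P A - d <= pr P F].
Proof.
move=> mA d0; have [_ h] := borel_squeezed mA; have [F [F' [cF cF' FA F'A hd]]] := h d d0.
exists F; split => //; have mF : measurable (F : set W) by exact: closed_measurable.
have mF' : measurable (F' : set W) by exact: closed_measurable.
have : pr P A <= pr P (F `|` ~` (F `|` F')).
  apply: pr_le => //; first by apply: measurableU => //; apply: measurableC; exact: measurableU.
  move=> x Ax; have [Fx|nF] := pselect (F x); [by left|right].
  by move=> [//|/F'A]; exact.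
have : pr P (F `|` ~` (F `|` F')) <= pr P F + pr P (~` (F `|` F')).
  by apply: prU => //; apply: measurableC; exact: measurableU.
by move: hd; lra.
Qed.

Hypothesis P_prod : is_product_lebesgue P.
Variable a : nat -> R.
Hypothesis a_gt0 : forall i, 0 < a i.
Hypothesis a_sum : cvgn (series (fun i : nat => a i ^+ 2)).
Hypothesis a_mono : forall i j, (i <= j)%N -> a j <= a i.

Lemma congruence_sub (B C : set W) sigma : C `<=` B -> congruence a B sigma -> congruence a C sigma.
Proof.
move=> CB [BK sK sd]; split; first exact: subset_trans BK.
  by move=> _ [x Cx <-]; apply: sK; exists x => //; exact: CB.
by move=> x y Cx Cy; apply: sd; exact: CB.
Qed.

Lemma pr_image_ge (B : set W) sigma : measurable B -> congruence a B sigma ->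
  pr P B <= pr P (sigma @` B).
Proof.
move=> mB cong; have mI := measurable_image a_gt0 a_sum cong mB.
apply/ler_addgt0Pr => d d0; have [F [cF FB hF]] := inner_closed mB d0.
suff : pr P F <= pr P (sigma @` B) by move: hF; lra.
have mF : measurable (F : set W) by exact: closed_measurable.
have congF := congruence_sub FB cong.
have cI : closed (sigma @` F : set T) by exact: (closed_image a_gt0 a_sum congF).
apply: (@le_trans _ _ (pr P (sigma @` F))); last first.
  by apply: pr_le => //; [exact: closed_measurable|exact: image_subset].
have [F0|F0] := leP (pr P F) 0; first by apply: le_trans F0 _; exact: pr_ge0.
have [p [p' [Bp Bp' p_off p_on small]]] := columns_defect P_prod a_gt0 a_sum a_mono cF congF F0.
exact: (volume_le P_prod a_gt0 a_sum mF congF cI Bp Bp' p_off p_on small).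
Qed.

Lemma congruence_inj (B : set W) sigma x y : congruence a B sigma -> B x -> B y ->
  sigma x = sigma y -> x = y.
Proof.
move=> [BK sK sd] Bx By e; apply: (dist_sq_eq0 a_gt0 a_sum) => //; [exact: BK|exact: BK|].
move=> d d0; rewrite -sd// e dist_sq_refl//; first exact: ltW.
by apply: sK; exists y.
Qed.

Lemma congruence_invariant_mono (B : set W) sigma : measurable B -> congruence a B sigma ->
  measurable (sigma @` B) /\ pr P (sigma @` B) = pr P B.
Proof.
move=> mB cong; have mI := measurable_image a_gt0 a_sum cong mB; split => //.
apply/eqP; rewrite eq_le pr_image_ge// andbT.
(* The inverse congruence; its values outside the image of [B] are arbitrary. *)
have /choice[tau tauP] : forall y : W, exists x, (sigma @` B) y -> B x /\ sigma x = y.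
  move=> y; have [[x Bx xy]|n] := pselect ((sigma @` B) y); first by exists x.
  by exists y.
have [BK sK sd] := cong.
have tauK x : B x -> tau (sigma x) = x.
  move=> Bx; have [Bt st] := tauP (sigma x) (imageP sigma Bx).
  exact: (congruence_inj cong).
have tB : tau @` (sigma @` B) = B.
  apply/seteqP; split => [_ [_ [x Bx <-] <-]|x Bx]; first by rewrite tauK.
  by exists (sigma x); [exists x|exact: tauK].
have ctau : congruence a (sigma @` B) tau.
  split => //; first by rewrite tB.
  by move=> _ _ [x Bx <-] [y By <-]; rewrite !tauK// sd.
by have := pr_image_ge mI ctau; rewrite tB.
Qed.

End Regularity.

(** * Nonincreasing rearrangement of the weights *)

Section Sorting.
Context {R : realType}.

Lemma sum_uniq_le (f : nat -> R) (l : seq nat) N : (forall j, 0 <= f j) -> uniq l ->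
  (forall k, k \in l -> (k < N)%N) -> \sum_(k <- l) f k <= \sum_(k < N) f k.
Proof.
move=> f0 ul lN; have pl : perm_eq l [seq k <- iota 0 N | k \in l].
  apply: uniq_perm => //; first by rewrite filter_uniq// iota_uniq.
  move=> k; rewrite mem_filter mem_iota add0n/=.
  by case kl: (k \in l) => //=; rewrite lN.
rewrite (perm_big _ pl)/= big_filter big_mkcond/= -(big_mkord xpredT f) /index_iota subn0.
by apply: ler_sum => k _; case: ifP.
Qed.

Lemma sum_injective_le (f : nat -> R) (s : nat -> nat) (l : R) n : (forall j, 0 <= f j) ->
  injective s -> sums f l -> \sum_(i < n) f (s i) <= l.
Proof.
move=> f0 si fl; rewrite -(big_mkord xpredT (fun i => f (s i))) /index_iota subn0.
rewrite -(big_map s xpredT f).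
apply: le_trans (sums_ge (\max_(k <- [seq s i | i <- iota 0 n]) k).+1 f0 fl).
apply: sum_uniq_le => //; first by rewrite map_inj_uniq ?iota_uniq.
by move=> k kl; rewrite ltnS; apply: leq_bigmax_seq.
Qed.

Lemma sums_permute (f : nat -> R) (s t : nat -> nat) (l : R) : (forall j, 0 <= f j) ->
  cancel s t -> cancel t s -> sums f l -> sums (fun i => f (s i)) l.
Proof.
move=> f0 st ts fl; have si := can_inj st; have ti := can_inj ts.
have c : cvgn (series (fun i => f (s i))).
  apply: nondecreasing_is_cvgn; first by apply: nondecreasing_series => n _ _; exact: f0.
  by exists l => _ [n _ <-]; rewrite seriesEord/=; exact: (@sum_injective_le f s l n f0 si fl).
have h1 : limn (series (fun i => f (s i))) <= l.
  apply: limr_le => //; apply: nearW => n; rewrite seriesEord/=; exact: (@sum_injective_le f s l n f0 si fl).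
have h2 : l <= limn (series (fun i => f (s i))).
  have cf : cvgn (series f) by apply/cvg_ex; exists l.
  rewrite -[leLHS](cvg_lim (@Rhausdorff R) fl); apply: limr_le => //; apply: nearW => n.
  rewrite seriesEord/=; have /= := @sum_injective_le (fun i => f (s i)) t _ n (fun j => f0 (s j)) ti c.
  by rewrite (eq_bigr (fun i : 'I_n => f i)) => [|i _]; last rewrite ts.
by rewrite /sums (_ : l = limn (series (fun i => f (s i)))) //; apply/eqP; rewrite eq_le h1 h2.
Qed.

Variable a : nat -> R.
Hypothesis a_gt0 : forall i, 0 < a i.
Hypothesis a_sum : cvgn (series (fun i : nat => a i ^+ 2)).

(** As [a] tends to 0, all but finitely many weights are at most that of a fixed index [k0] outside
    the list, so the maximum is attained. *)
Lemma next_largest (l : seq nat) : exists i, i \notin l /\ forall k, k \notin l -> a k <= a i.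
Proof.
pose k0 := (\max_(k <- l) k).+1.
have k0l : k0 \notin l.
  apply/negP => h; have : (k0 <= \max_(k <- l) k)%N by apply: leq_bigmax_seq.
  by rewrite /k0 ltnn.
have a20 : 0 < a k0 ^+ 2 by rewrite exprn_gt0.
have /cvgrPdist_lt/(_ _ a20)[N _ hN] := cvg_series_cvg_0 a_sum.
have far k : (N <= k)%N -> a k <= a k0.
  move=> Nk; have := hN k Nk; rewrite /= sub0r normrN ger0_norm ?sqr_ge0// => h.
  by rewrite leNgt; apply/negP => h2; move: h; rewrite ltNge ler_sqr ?nnegrE ?ltW.
pose M := maxn N k0.+1; have k0M : (k0 < M)%N by exact: leq_maxr.
case: (@Order.TotalTheory.arg_maxP _ _ _ (Ordinal k0M) (fun i : 'I_M => (i : nat) \notin l)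
  (fun i : 'I_M => a i) k0l) => i il hi.
exists (nat_of_ord i); split => // k kl; have [kM|Mk] := ltnP k M; first exact: (hi (Ordinal kM)).
apply: le_trans (far k (leq_trans (leq_maxl _ _) Mk)) _; exact: (hi (Ordinal k0M)).
Qed.

(** Takes the largest remaining weight again and again. An index that is never taken would bound all
    the chosen weights from below, against summability. *)
Lemma sorting : exists s t : nat -> nat,
  [/\ cancel s t, cancel t s & forall i j, (i <= j)%N -> a (s j) <= a (s i)].
Proof.
have /choice[nx nxP] := next_largest.
pose L := fix L n := if n is m.+1 then rcons (L m) (nx (L m)) else [::].
pose s n := nx (L n).
have memL n k : (k \in L n) <-> exists2 m, (m < n)%N & k = s m.
  elim: n => [|n IH] /=; first by split => // -[].
  rewrite mem_rcons inE; split => [/predU1P[->|/IH[m mn ->]]|[m]].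
  - by exists n.
  - by exists m => //; exact: leqW.
  - rewrite ltnS leq_eqVlt => /predU1P[-> ->|mn km]; first by rewrite eqxx.
    by apply/orP; right; apply/IH; exists m.
have sN n k : (forall m, (m < n)%N -> k <> s m) -> a k <= a (s n).
  move=> h; have [_] := nxP (L n); apply; apply/negP => /memL[m mn]; exact: h.
have sneq m n : (m < n)%N -> s n <> s m.
  by move=> mn e; have [/negP h _] := nxP (L n); apply: h; apply/memL; exists m.
have si : injective s.
  by move=> m n e; case: (ltngtP m n) => // /sneq; rewrite e.
have surj k : exists m, s m = k.
  apply: contrapT => hno; have ak m : a k <= a (s m).
    by apply: sN => l _ e; apply: hno; exists l.
  have [S hS] : exists S, sums (fun j => a j ^+ 2) S by exists (limn (series (fun i => a i ^+ 2))).
  have a20 : 0 < a k ^+ 2 by rewrite exprn_gt0.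
  have S0 : 0 <= S by have := sums_ge 0 (fun j => sqr_ge0 (a j)) hS; rewrite big_ord0.
  pose n := Num.bound (S / a k ^+ 2).
  have := @sum_injective_le (fun j => a j ^+ 2) s S n (fun j => sqr_ge0 (a j)) si hS.
  apply/negP; rewrite -ltNge.
  have h1 : S < n%:R * a k ^+ 2.
    by rewrite -ltr_pdivrMr//; apply: archi_boundP; apply: divr_ge0 => //; exact: ltW.
  apply: (lt_le_trans h1); rewrite mulr_natl -[in leLHS](card_ord n) -sumr_const.
  apply: ler_sum => i _; apply: lerXn2r; rewrite ?nnegrE; [exact: ltW|exact: ltW|exact: ak].
have /choice[t ts] := surj.
exists s, t; split => //; first by move=> n; apply: si; exact: ts.
move=> i j; rewrite leq_eqVlt => /predU1P[->//|ij]; apply: sN => m mi.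
by apply: sneq; exact: ltn_trans mi ij.
Qed.

End Sorting.

(** * Permutations of the coordinates *)

Section Reindex.
Context {R : realType}.
Local Notation W := (Romega R).
Local Notation lam := (@lebesgue_measure R).
Variable P : probability W R.
Hypothesis P_prod : is_product_lebesgue P.
Variables s t : nat -> nat.
Hypothesis st : cancel s t.
Hypothesis ts : cancel t s.

Definition reindex (s : nat -> nat) (x : W) : W := fun i => x (s i).

Lemma reindex_rectangle n (A : nat -> set R) : reindex s @^-1` rectangle n A =
  rectangle (\max_(i < n) s i).+1 (fun k => if (t k < n)%N then A (t k) else setT).
Proof.
apply/seteqP; split => x /= h k kn.
  by case: ifP => // tn; have := h (t k) tn; rewrite /reindex ts.
have := h (s k); rewrite st kn; apply; rewrite ltnS.
exact: (leq_bigmax (Ordinal kn)).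
Qed.

Lemma measurable_reindex : measurable_fun setT (reindex s).
Proof.
apply: (measurability _ (@measurable_rectangles R)).
move=> _ [_ [n [A mA ->]] <-]; rewrite setTI reindex_rectangle.
by apply: rectangle_measurable => k; case: ifP.
Qed.

Lemma reindex_preserving (X : set W) : measurable X -> P (reindex s @^-1` X) = P X.
Proof.
pose m0 : {measure set W -> \bar R} := pushforward P (reindex s).
pose m := m0 measurable_reindex.
move=> mX; suff E : forall Y, measurable Y -> m Y = P Y by exact: (E X mX).
apply: measure_unique_rectangles => [|n A mA].
  change (P (reindex s @^-1` setT) < +oo)%E; rewrite preimage_setT.
  by apply: le_lt_trans (probability_le1 P measurableT) (ltry _).
change (P (reindex s @^-1` rectangle n A) = P (rectangle n A)).
rewrite reindex_rectangle !probability_rectangle//; last by move=> k; case: ifP.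
set N := (\max_(i < n) s i).+1; pose g i := lam (A i `&` `[0%R, 1%R]).
transitivity (\prod_(k < N | (t k < n)%N) g (t k))%E.
  rewrite [RHS]big_mkcond/=; apply: eq_bigr => k _; case: ifP => // _.
  exact: lebesgue_unit_itv.
rewrite -(big_mkord (fun k => (t k < n)%N) (fun k => g (t k))) -big_filter /index_iota subn0.
rewrite (perm_big [seq s i | i <- iota 0 n]).
  rewrite big_map -[RHS](big_mkord xpredT g) /index_iota subn0.
  by apply: eq_bigr => i _; rewrite st.
apply: uniq_perm; first by rewrite filter_uniq// iota_uniq.
  by rewrite (map_inj_uniq (can_inj st)) iota_uniq.
move=> k; rewrite mem_filter mem_iota add0n/=; apply/andP/mapP => [[tn _]|[i]].
  by exists (t k); rewrite ?ts// mem_iota add0n.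
rewrite mem_iota add0n/= => i_n ->; rewrite st; split => //.
by rewrite /N ltnS; exact: (leq_bigmax (Ordinal i_n)).
Qed.

Lemma dist_reindex (a : nat -> R) (x y : W) : cvgn (series (fun i : nat => a i ^+ 2)) ->
  @hilbert_cube R x -> @hilbert_cube R y ->
  dist_a (fun i => a (s i)) (reindex s x) (reindex s y) = dist_a a x y.
Proof.
move=> a_sum Kx Ky.
have [l hl] : exists l, sums (fun j => a j ^+ 2 * (x j - y j) ^+ 2) l by eexists; exact: sums_dist.
have f0 j : 0 <= a j ^+ 2 * (x j - y j) ^+ 2 by rewrite mulr_ge0 ?sqr_ge0.
have hl' := sums_permute f0 st ts hl.
by rewrite /dist_a (cvg_lim (@Rhausdorff R) hl) (cvg_lim (@Rhausdorff R) hl').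
Qed.

End Reindex.

(** * Weights in arbitrary order *)

Section Final.
Context {R : realType}.
Local Notation W := (Romega R).
Variable P : probability W R.
Hypothesis P_prod : is_product_lebesgue P.

Lemma reindexK (s t : nat -> nat) : cancel t s -> cancel (reindex (R := R) s) (reindex t).
Proof. by move=> ts x; apply/funext => i; rewrite /reindex ts. Qed.

(** A permutation of coordinates preserves [P] and is an isometry onto the cube with permuted
    weights, so [sigma] may be conjugated by the sorting permutation. *)
Lemma congruence_invariant (a : nat -> R) (B : set W) sigma :
  (forall i, 0 < a i) -> cvgn (series (fun i : nat => a i ^+ 2)) ->
  measurable B -> congruence a B sigma ->
  measurable (sigma @` B) /\ P (sigma @` B) = P B.
Proof.
move=> a_gt0 a_sum mB [BK sK sd].
have [s [t [st ts smono]]] := sorting a_gt0 a_sum.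
pose F : W -> W := reindex s; pose G : W -> W := reindex t.
have FG : cancel G F := reindexK st.
have GF : cancel F G := reindexK ts.
have preF (X : set W) : F @` X = G @^-1` X.
  by apply/seteqP; split => [_ [x Xx <-]|y Xy]; [rewrite /= GF|exists (G y)].
have preK (X : set W) : F @^-1` (F @` X) = X.
  by apply/seteqP; split => [x [y Xy /(can_inj GF) <-//]|x Xx]; exists x.
have mG : measurable_fun setT G by exact: measurable_reindex.
have mF : measurable_fun setT F by exact: measurable_reindex.
have mFX (X : set W) : measurable X -> measurable (F @` X).
  by move=> mX; rewrite preF -[X in measurable X]setTI; exact: (mG measurableT _ mX).
have a_sum' : cvgn (series (fun i => a (s i) ^+ 2)).
  have [l hl] : exists l, sums (fun j => a j ^+ 2) l by exists (limn (series (fun i => a i ^+ 2))).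
  by apply/cvg_ex; exists l; exact: (sums_permute (fun j => sqr_ge0 (a j)) st ts hl).
have cong' : congruence (fun i => a (s i)) (F @` B) (F \o sigma \o G).
  split.
  - by move=> _ [x Bx <-] i; exact: (BK _ Bx (s i)).
  - by move=> _ [_ [x Bx <-] <-] i; rewrite /= GF; exact: (sK _ (imageP sigma Bx) (s i)).
  - move=> _ _ [x Bx <-] [y By <-]; rewrite /= !GF.
    rewrite (dist_reindex st ts a_sum (sK _ (imageP sigma Bx)) (sK _ (imageP sigma By))) sd//.
    by rewrite (dist_reindex st ts a_sum (BK _ Bx) (BK _ By)).
have imE : (F \o sigma \o G) @` (F @` B) = F @` (sigma @` B).
  apply/seteqP; split => [_ [_ [x Bx <-] <-]|_ [_ [x Bx <-] <-]].
    by exists (sigma x); [exists x|rewrite /= GF].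
  by exists (F x); [exists x|rewrite /= GF].
have [mI pI] := congruence_invariant_mono P_prod (fun i => a_gt0 (s i)) a_sum' smono (mFX B mB) cong'.
rewrite imE in mI pI.
have mS : measurable (sigma @` B).
  by rewrite -(preK (sigma @` B)) -[X in measurable X]setTI; exact: (mF measurableT _ mI).
split => //; rewrite (prE P mS) (prE P mB); congr EFin.
have e (X : set W) : measurable X -> pr P X = pr P (F @` X).
  by move=> mX; rewrite /pr -(reindex_preserving P_prod st ts (mFX X mX)) preK.
by rewrite (e _ mS) (e _ mB).
Qed.

End Final.

Lemma measure_as_probability {d} {T : measurableType d} {R : realType}
    (mu : {measure set T -> \bar R}) :
  mu setT = 1%E -> exists P : probability T R, forall X, P X = mu X.
Proof.
case: mu => m c mu1.
pose mm : {measure set T -> \bar R} := Measure.Pack c.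
pose b := Measure_isProbability.Build _ _ _ mm mu1.
by pose P : probability T R := HB.pack (Measure.sort mm) b; exists P.
Qed.

Theorem theorem6p1 (R : realType) (a : nat -> R)
    (a_gt0 : forall i, 0 < a i)
    (a_sq_summable : cvgn (series (fun i : nat => a i ^+ 2)))
    (mu : {measure set (Romega R) -> \bar R})
    (mu_prod : is_product_lebesgue mu)
    (B : set (Romega R)) (mB : measurable B)
    (sigma : Romega R -> Romega R) (sigma_congr : congruence a B sigma) :
  measurable (sigma @` B) /\ mu (sigma @` B) = mu B.
Proof.
have mu1 : mu setT = 1%E.
  have := mu_prod 0%N (fun=> setT) (fun=> measurableT); rewrite big_ord0 => <-.
  by congr (mu _); apply/seteqP; split.
have [P PE] := measure_as_probability mu1.
have P_prod : is_product_lebesgue P 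
  by move=> n A mA; exact: etrans (PE _) (mu_prod n A mA).
by rewrite -!PE; exact: (congruence_invariant P_prod a_gt0 a_sq_summable mB sigma_congr).
Qed.
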